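(* Let $(X_0,X_1)$ be a compatible couple and $1\le q<\infty$. Let $b\in SV(0,\infty)$ satisfy $$\int_0^\infty t^{-1}b^{q}(t)\,dt<\infty .$$ Let $\beta\in SV(0,\infty)$ be such that $$\int_x^\infty t^{-1}\beta^q(t)\,dt<\infty\ \text{ for all } x>0,\qquad \int_0^\infty t^{-1}\beta^q(t)\,dt=\infty,$$ and let $B\in SV(0,\infty)$ be given by $$B(x):=b(x)\ \text{ if } x\in[1,\infty),\qquad B(x)\approx\beta(x)\ \text{ if } x\in(0,1).$$ Put $$A(x):=B^{-q/q'}(x)\int_x^\infty t^{-1}B^q(t)\,dt\quad\text{for all } x>0$$ (so $A(x)=\int_x^\infty t^{-1}B(t)\,dt$ if $q=1$). Then $$(X_0,X_1)_{0,q,b;K}=(X_0,X_0+X_1)_{0,q,B;K}=(X_0,X_0+X_1)_{0,q,A;J}.$$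
   Context: A pair $(X_0,X_1)$ of Banach spaces is a compatible couple if there is a Hausdorff topological vector space in which both $X_0$ and $X_1$ are continuously embedded. $X_0\cap X_1$ carries the norm $\max\{\|f\|_{X_0},\|f\|_{X_1}\}$ and $X_0+X_1$ the norm $\inf\{\|f_0\|_{X_0}+\|f_1\|_{X_1}: f=f_0+f_1\}$. For $t>0$, $$K(f,t;X_0,X_1):=\inf\{\|f_0\|_{X_0}+t\|f_1\|_{X_1}: f=f_0+f_1,\ f_0\in X_0,\ f_1\in X_1\}\quad (f\in X_0+X_1),$$ $$J(f,t;X_0,X_1):=\max\{\|f\|_{X_0},t\|f\|_{X_1}\}\quad (f\in X_0\cap X_1).$$ For $1\le q\le\infty$, $\|\cdot\|_{q,(c,d)}$ is the $L_q$-norm on $(c,d)$ with respect to Lebesgue measure, $1/q+1/q'=1$, and $1/\infty=0$. For a weight $v$ on $(0,\infty)$ (non-negative, measurable, finite a.e.): - $(X_0,X_1)_{0,q,v;K}$ is the set of $f\in X_0+X_1$ with $\|f\|_{0,q,v;K}:=\|t^{-1/q}v(t)K(f,t;X_0,X_1)\|_{q,(0,\infty)}<\infty$. - $(X_0,X_1)_{0,q,v;J}$ is the set of $f\in X_0+X_1$ for which there is a strongly measurable $u:(0,\infty)\to X_0\cap X_1$ with $f=\int_0^\infty u(s)\,\frac{ds}{s}$ (convergence in $X_0+X_1$) and for which $\|f\|_{0,q,v;J}:=\inf\|t^{-1/q}v(t)J(u(t),t;X_0,X_1)\|_{q,(0,\infty)}$ is finite, the infimum being over all such representations of $f$. The same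 definitions are used for the compatible couple $(X_0,X_0+X_1)$. Equality of two spaces means that they are equal as sets and their norms are equivalent. For non-negative expressions, $\mathcal A\approx\mathcal B$ means that each is bounded by a positive constant multiple of the other, the constants being independent of the significant quantities (here, of $x$). $SV(0,\infty)$ is the set of slowly varying functions: positive, finite, Lebesgue-measurable functions $b$ on $(0,\infty)$ such that for each $\varepsilon>0$, $t^{\varepsilon}b(t)$ is equivalent ($\approx$) to a non-decreasing function on $(0,\infty)$ and $t^{-\varepsilon}b(t)$ is equivalent to a non-increasing function on $(0,\infty)$. *)

(* Defs.v *)
From HB Require Import structures.
From mathcomp Require Import all_boot all_order all_algebra.
From mathcomp Require Import all_classical all_reals all_analysis.
From mathcomp Require Import lra.

Set Implicit Arguments.
Unset Strict Implicit.
Unset Printing Implicit Defensive.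

Import Order.TTheory GRing.Theory Num.Theory.
Import numFieldNormedType.Exports.

Local Open Scope classical_set_scope.
Local Open Scope ring_scope.

Section bochner.
Context d (T : measurableType d) (R : realType) (V : normedModType R).
Implicit Types (mu : {measure set T -> \bar R}) (D : set T) (s f : T -> V).

Definition simple_function s : Prop :=
  finite_set (range s) /\ forall v, measurable (s @^-1` [set v]).

Definition strongly_measurable mu D f : Prop :=
  exists2 s_ : nat -> T -> V, forall n, simple_function (s_ n) &
    {ae mu, forall x, D x -> s_ ^~ x @ \oo --> f x}.

Definition integrable_simple_function mu D s : Prop :=
  simple_function s /\
  forall v, v != 0 -> (mu (D `&` s @^-1` [set v]) < +oo)%E.

Definition simple_integral mu D s : V :=
  \sum_(v \in range s) fine (mu (D `&` s @^-1` [set v])) *: v.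

Definition is_bochner_integral mu D f (I : V) : Prop :=
  exists s_ : nat -> T -> V,
    [/\ forall n, integrable_simple_function mu D (s_ n),
        {ae mu, forall x, D x -> s_ ^~ x @ \oo --> f x},
        (fun n => \int[mu]_(x in D) (`|f x - s_ n x|)%:E)%E @ \oo --> 0%E &
        (fun n => simple_integral mu D (s_ n)) @ \oo --> I].

End bochner.

Record compatible_couple (R : realType) (E : topologicalLmodType R) :=
  CompatibleCouple {
  cc_hausdorff : hausdorff_space E ;
  X0 : completeNormedModType R ;
  X1 : completeNormedModType R ;
  emb0 : {linear X0 -> E} ;
  emb1 : {linear X1 -> E} ;
  emb0_inj : injective emb0 ;
  emb1_inj : injective emb1 ;
  emb0_continuous : continuous emb0 ;
  emb1_continuous : continuous emb1 }.
Arguments emb0 {R E} c.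
Arguments emb1 {R E} c.

Section sum_space.
Context (R : realType) (E : topologicalLmodType R) (C : compatible_couple E).

Definition decompositions (f : E) : set (X0 C * X1 C) :=
  [set x | f = emb0 C x.1 + emb1 C x.2].

Definition in_sum : {pred E} := fun f => `[< decompositions f !=set0 >].

Lemma in_sumP f : reflect (exists x, decompositions f x) (f \in in_sum).
Proof. exact: asboolP. Qed.

Fact in_sum_submod_closed : submod_closed in_sum.
Proof.
split=> [|a f g /in_sumP[x ->] /in_sumP[y ->]]; apply/in_sumP.
  by exists (0, 0); rewrite /decompositions /= !raddf0 addr0.
exists (a *: x.1 + y.1, a *: x.2 + y.2).
by rewrite /decompositions /= !linearP scalerDr addrACA.
Qed.

HB.instance Definition _ :=
  GRing.isSubmodClosed.Build R E in_sum in_sum_submod_closed.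

Definition sum_space : Type := {f : E | f \in in_sum}.

HB.instance Definition _ := SubChoice.on sum_space.
HB.instance Definition _ := [SubChoice_isSubLmodule of sum_space by <:].

Definition sum_norm (f : sum_space) : R :=
  inf [set `|x.1| + `|x.2| | x in decompositions (val f)].

Let values (f : sum_space) :=
  [set `|x.1| + `|x.2| | x in decompositions (val f)].

Let values_inf f : has_inf (values f).
Proof.
split; first by have /in_sumP[x fx] := valP f; exists (`|x.1| + `|x.2|), x.
by exists 0 => _ [x _ <-]; rewrite addr_ge0.
Qed.

Fact sum_norm_le (f : sum_space) x :
  decompositions (val f) x -> sum_norm f <= `|x.1| + `|x.2|.
Proof. by move=> fx; apply: ge_inf; [have [] := values_inf f|exists x]. Qed.

Fact sum_norm_lt (f : sum_space) e : sum_norm f < e ->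
  exists2 x, decompositions (val f) x & `|x.1| + `|x.2| < e.
Proof. by move/inf_lt => /(_ (values_inf f).1)[_ [x fx <-] xe]; exists x. Qed.

Fact sum_norm_ge0 f : 0 <= sum_norm f.
Proof.
apply: lb_le_inf; first by have [] := values_inf f.
by move=> _ [x _ <-]; rewrite addr_ge0.
Qed.

Fact ler_sum_normD f g : sum_norm (f + g) <= sum_norm f + sum_norm g.
Proof.
apply/ler_addgt0Pr => e e0.
have e2 : 0 < e / 2 by rewrite divr_gt0.
have /sum_norm_lt[x fx xe] : sum_norm f < sum_norm f + e / 2 by rewrite ltrDl.
have /sum_norm_lt[y gy ye] : sum_norm g < sum_norm g + e / 2 by rewrite ltrDl.
have fgxy : decompositions (val (f + g)) (x + y).
  by rewrite /decompositions /= raddfD /= fx gy !raddfD /= addrACA.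
apply: (le_trans (sum_norm_le fgxy)).
rewrite [e]splitr addrACA; apply: (le_trans _ (ltW (ltrD xe ye))).
by rewrite [leRHS]addrACA lerD// ler_normD.
Qed.

Fact sum_normZ_le a f : sum_norm (a *: f) <= `|a| * sum_norm f.
Proof.
have [->|a0] := eqVneq a 0.
  rewrite scale0r normr0 mul0r.
  have : decompositions (val (0 : sum_space)) 0.
    by rewrite /decompositions /= !raddf0 addr0.
  by move/sum_norm_le; rewrite /= !normr0 addr0.
apply/ler_addgt0Pr => e e0.
have na0 : 0 < `|a| by rewrite normr_gt0.
have /sum_norm_lt[x fx xe] : sum_norm f < sum_norm f + e / `|a|.
  by rewrite ltrDl divr_gt0.
have afx : decompositions (val (a *: f)) (a *: x).
  by rewrite /decompositions /= linearZ /= fx scalerDr !linearZ.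
apply: (le_trans (sum_norm_le afx)).
rewrite !normrZ -mulrDr (le_trans (ler_wpM2l _ (ltW xe)))//.
by rewrite mulrDr mulrCA divff ?mulr1// gt_eqF.
Qed.

Fact sum_normZ a f : sum_norm (a *: f) = `|a| * sum_norm f.
Proof.
apply/le_anti; rewrite sum_normZ_le /=.
have [->|a0] := eqVneq a 0; first by rewrite normr0 mul0r sum_norm_ge0.
have := sum_normZ_le a^-1 (a *: f).
rewrite scalerA mulVf// scale1r normfV => /(ler_wpM2l (normr_ge0 a)).
by rewrite mulrA divff ?normr_eq0// mul1r.
Qed.

Let sum_norm_nbhs0 (U : set E) : nbhs 0 U ->
  exists2 e : R, 0 < e & forall f, sum_norm f < e -> U (val f).
Proof.
move=> U0.
have : (fun x : X0 C * X1 C => emb0 C x.1 + emb1 C x.2) @ nbhs (0, 0)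
    --> nbhs (0 : E).
  have := @add_continuous E (0, 0); rewrite /continuous_at /= addr0 => addc.
  apply: (@cvg_trans _ ((fun z : E * E => z.1 + z.2) @ nbhs (0 : E, 0 : E)));
    last exact: addc.
  move=> A; rewrite /= => -[[P Q] /= [P0 Q0] PQ].
  exists (emb0 C @^-1` P, emb1 C @^-1` Q) => /=.
    split; [apply: emb0_continuous|apply: emb1_continuous];
    by rewrite raddf0.
  by move=> x [/= Px Qx]; apply: (PQ (_, _)).
move=> /(_ _ U0) [[P Q] /= [/nbhs_ballP[e e0 eP] /nbhs_ballP[e' e'0 e'Q]] PQ].
exists (Num.min e e'); first by rewrite lt_min e0.
move=> f /sum_norm_lt[x -> xe].
apply: (PQ x); split; [apply: eP|apply: e'Q];
  rewrite -ball_normE /= sub0r normrN; apply: le_lt_trans (lt_le_trans xe _).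
- by rewrite lerDl.
- by rewrite ge_min lexx.
- by rewrite lerDr.
- by rewrite ge_min lexx orbT.
Qed.

Fact sum_norm0_eq0 f : sum_norm f = 0 -> f = 0.
Proof.
move=> f0; apply/val_inj/esym/(cc_hausdorff C) => A B A0 Bf.
exists (val f); split; last exact: nbhs_singleton.
by have [e e0] := sum_norm_nbhs0 A0; apply; rewrite f0.
Qed.

HB.instance Definition _ := @Lmodule_isNormed.Build R sum_space sum_norm
  ler_sum_normD sum_normZ sum_norm0_eq0.

Fact sum_normE (f : sum_space) :
  `|f| = inf [set `|x.1| + `|x.2| | x in decompositions (val f)].
Proof. by []. Qed.

Fact val_sum_continuous : continuous (val : sum_space -> E).
Proof.
move=> f U Uf.
have : nbhs (0 : E) ((fun z => z + val f) @^-1` U).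
  have /(_ U) := @add_continuous E (0, val f).
  rewrite /= add0r => /(_ Uf)[[P Q] /= [P0 Qf] PQ].
  apply: filterS P0 => z Pz; apply: (PQ (z, _)).
  by split=> //; exact: nbhs_singleton.
move=> /sum_norm_nbhs0[e e0 eU]; apply/nbhs_ballP; exists e => //= g.
rewrite -ball_normE /= distrC => /eU.
by rewrite raddfB /= subrK.
Qed.

Fact sum_cauchy_cvg (F : set_system sum_space) :
  ProperFilter F -> cauchy F -> cvg F.
Proof.
move=> FF /cauchy_ballP Fc.
pose r (n : nat) : R := geometric 1 2^-1 n.
have r0 n : 0 < r n by rewrite /r /= mul1r exprn_gt0// invr_gt0.
have half1 : `|2^-1 : R| < 1 by rewrite ger0_norm ?invr_ge0// invf_lt1 ?ltr1n.
have /choice[x Fx] n : exists x : sum_space, F (ball x (r n)).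
  have [[A B] /= [FA FB] AB] := Fc _ (r0 n).
  have [z Az] := filter_ex FA.
  by exists z; apply: filterS FB => t Bt; apply: (AB (z, t)).
have /choice[y xy] n : exists y, decompositions (val (x n.+1 - x n)) y /\
    `|y.1| + `|y.2| < geometric 2 2^-1 n.
  have [z [xz x'z]] := filter_ex (filterI (Fx n) (Fx n.+1)).
  suff /sum_norm_lt[y ? ?] : sum_norm (x n.+1 - x n) < geometric 2 2^-1 n.
    by exists y.
  move: xz x'z; rewrite -!ball_normE /= => xz x'z.
  apply: (@le_lt_trans _ _ (`|x n.+1 - z| + `|x n - z|)).
    by rewrite (distrC (x n)); exact: (ler_distD z (x n.+1) (x n)).
  apply: (lt_le_trans (ltrD x'z xz)).
  by rewrite /r /= !mul1r exprS; have := r0 n; rewrite /r /= mul1r; lra.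
have cvgy (V : completeNormedModType R) (v : nat -> V) :
    (forall n, `|v n| <= geometric 2 2^-1 n) -> cvgn (series v).
  move=> vle; apply: normed_cvg.
  apply: (@series_le_cvg _ _ (geometric 2 2^-1)) => //.
  - by move=> n; exact: normr_ge0.
  - by move=> n; rewrite /= mulr_ge0// exprn_ge0.
  - exact: is_cvg_geometric_series.
pose v0 n := (y n).1; pose v1 n := (y n).2.
have c0 : cvgn (series v0).
  by apply: cvgy => n; apply: le_trans (ltW (xy n).2); rewrite lerDl.
have c1 : cvgn (series v1).
  by apply: cvgy => n; apply: le_trans (ltW (xy n).2); rewrite lerDr.
pose L := (limn (series v0), limn (series v1)).
have Lsum : emb0 C L.1 + emb1 C L.2 \in in_sum by apply/in_sumP; exists L.
pose g : sum_space := x 0 + (Sub (emb0 C L.1 + emb1 C L.2) Lsum).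
have xE n : val (x n) =
    val (x 0) + (emb0 C (series v0 n) + emb1 C (series v1 n)).
  elim: n => [|n IH]; first by rewrite !seriesEnat /= !big_geq// !raddf0 !addr0.
  have := (xy n).1; rewrite /decompositions raddfB /= => /eqP.
  rewrite subr_eq => /eqP ->; rewrite IH !seriesSr !raddfD /=.
  by rewrite addrC -addrA; congr (_ + _); rewrite addrACA.
have gx n : `|g - x n| <= `|L.1 - series v0 n| + `|L.2 - series v1 n|.
  apply: (@sum_norm_le (g - x n) (L.1 - series v0 n, L.2 - series v1 n)).
  rewrite /decompositions raddfB /= (xE n) !raddfB /=.
  by rewrite opprD addrACA subrr add0r opprD addrACA.
apply/cvg_ex; exists g; apply/cvg_ballP => e e0.
have e3 : 0 < e / 3 by rewrite divr_gt0.
have [n [[rn n0] n1]] : exists n, (r n < e / 3 /\ `|L.1 - series v0 n| < e / 3)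
    /\ `|L.2 - series v1 n| < e / 3.
  near \oo => n; exists n; split; [split|]; near: n.
  - have : r @ \oo --> 0 by exact: cvg_geometric.
    move=> /cvgr_lt; exact.
  - by move/cvgrPdist_lt : c0; exact.
  - by move/cvgrPdist_lt : c1; exact.
apply: filterS (Fx n) => z; rewrite -!ball_normE /= => xz.
rewrite -(subrKA (x n)); apply: (le_lt_trans (ler_normD _ _)).
apply: (lt_le_trans (ltrD (le_lt_trans (gx n) (ltrD n0 n1)) (lt_trans xz rn))).
lra.
Unshelve. all: by end_near.
Qed.

HB.instance Definition _ := Uniform_isComplete.Build sum_space sum_cauchy_cvg.

End sum_space.
Arguments decompositions {R E} C f.
(* X_0 `&` X_1, as the fibre product of X_0 and X_1 over the ambient space. *)
Section cap_space.
Context (R : realType) (E : topologicalLmodType R) (C : compatible_couple E).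

Definition in_cap : {pred X0 C * X1 C} := fun x => emb0 C x.1 == emb1 C x.2.

Fact in_cap_submod_closed : submod_closed in_cap.
Proof.
split=> [|a x y]; rewrite !unfold_in; first by rewrite /= !raddf0.
by move=> /eqP xE /eqP yE; rewrite /= !linearP xE yE.
Qed.

HB.instance Definition _ :=
  GRing.isSubmodClosed.Build R (X0 C * X1 C)%type in_cap in_cap_submod_closed.

Definition cap_space : Type := {x : X0 C * X1 C | x \in in_cap}.

HB.instance Definition _ := SubChoice.on cap_space.
HB.instance Definition _ := [SubChoice_isSubLmodule of cap_space by <:].

Definition cap_norm (f : cap_space) : R :=
  Num.max `|(val f).1| `|(val f).2|.

Fact ler_cap_normD f g : cap_norm (f + g) <= cap_norm f + cap_norm g.
Proof. exact: (ler_normD (val f) (val g)). Qed.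

Fact cap_normZ a f : cap_norm (a *: f) = `|a| * cap_norm f.
Proof. exact: (normrZ a (val f)). Qed.

Fact cap_norm0_eq0 f : cap_norm f = 0 -> f = 0.
Proof. by move=> f0; apply/val_inj/(@normr0_eq0 _ _ (val f)). Qed.

HB.instance Definition _ := @Lmodule_isNormed.Build R cap_space cap_norm
  ler_cap_normD cap_normZ cap_norm0_eq0.

Fact cap_normE (f : cap_space) : `|f| = Num.max `|(val f).1| `|(val f).2|.
Proof. by []. Qed.

Fact cap_in_sum (f : cap_space) : emb0 C (val f).1 \in in_sum C.
Proof.
apply/in_sumP; exists ((val f).1, 0).
by rewrite /decompositions /= raddf0 addr0.
Qed.

Definition cap_to_sum (f : cap_space) : sum_space C :=
  Sub (emb0 C (val f).1) (cap_in_sum f).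

End cap_space.

Definition sum_couple (R : realType) (E : topologicalLmodType R)
    (C : compatible_couple E) : compatible_couple E :=
  @CompatibleCouple R E (cc_hausdorff C)
    (X0 C) (sum_space C : completeNormedModType R)
    (emb0 C) (val : {linear sum_space C -> E})
    (@emb0_inj _ _ C) val_inj
    (@emb0_continuous _ _ C) (@val_sum_continuous _ _ C).

(* A subset of E together with a functional on it, which takes the value of a
   norm; only the values on the subset matter. *)
Record normed_subset (R : realType) (E : Type) := NormedSubset {
  ns_set : set E ;
  ns_norm : E -> \bar R }.

Definition same_space (R : realType) (E : Type) (Y Z : normed_subset R E) :=
  ns_set Y = ns_set Z /\
  exists2 c : R, 0 < c & forall f, ns_set Y f ->
    (ns_norm Y f <= c%:E * ns_norm Z f)%E /\
    (ns_norm Z f <= c%:E * ns_norm Y f)%E.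

Section interpolation_spaces.
Context (R : realType).

(* Defined on all Lebesgue measurable sets; [lebesgue_measure] only has the
   Borel sets. *)
Local Notation leb := (@completed_lebesgue_measure R).

Definition Lq_norm (q : \bar R) (D : set R) (g : R -> R) : \bar R :=
  'N[leb]_q[(EFin \o g) \_ D]%E.

Context (E : topologicalLmodType R) (C : compatible_couple E).

Definition Kfun (f : E) (t : R) : R :=
  inf [set `|x.1| + t * `|x.2| | x in decompositions C f].

Definition Jfun (f : cap_space C) (t : R) : R :=
  Num.max `|(val f).1| (t * `|(val f).2|).

(* [fine +oo] is [0] and [0^-1] is [0], hence [(fine q)^-1] is 1/q also when
   q is +oo. *)
Definition interp_norm (q : \bar R) (v h : R -> R) : \bar R :=
  Lq_norm q `]0, +oo[ (fun t => t `^ (- (fine q)^-1) * v t * h t).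

Definition Knorm (q : \bar R) (v : R -> R) (f : E) : \bar R :=
  interp_norm q v (Kfun f).

Definition Kspace (q : \bar R) (v : R -> R) : normed_subset R E :=
  NormedSubset [set f | f \in in_sum C /\ (Knorm q v f < +oo)%E] (Knorm q v).

Definition J_representations (f : E) : set (R -> cap_space C) :=
  [set u | strongly_measurable leb `]0, +oo[ u /\
    exists2 g : sum_space C, val g = f &
      is_bochner_integral leb `]0, +oo[ (fun s => s^-1 *: cap_to_sum (u s)) g].

Definition Jnorm (q : \bar R) (v : R -> R) (f : E) : \bar R :=
  ereal_inf [set interp_norm q v (fun t => Jfun (u t) t) |
             u in J_representations f].

Definition Jspace (q : \bar R) (v : R -> R) : normed_subset R E :=
  NormedSubset [set f | J_representations f !=set0 /\ (Jnorm q v f < +oo)%E]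
    (Jnorm q v).

End interpolation_spaces.
Arguments J_representations {R E} C f.

Section slowly_varying.
Context (R : realType).
Local Notation leb := (@completed_lebesgue_measure R).
Local Notation lebesgueType := (caratheodory_type (@wlength R idfun)^*%mu).
Implicit Types (D : set R) (b f g : R -> R).

Definition equivalent_on D f g : Prop :=
  exists2 c, 0 < c & forall x, D x -> f x <= c * g x /\ g x <= c * f x.

Definition slowly_varying b : Prop :=
  [/\ measurable_fun (`]0, +oo[ : set lebesgueType) (b : lebesgueType -> R),
      forall t, 0 < t -> 0 < b t &
      forall e, 0 < e ->
        (exists2 phi : R -> R,
           {in `]0, +oo[ &, {homo phi : x y / x <= y}} &
           equivalent_on `]0, +oo[ (fun t => t `^ e * b t) phi) /\
        (exists2 phi : R -> R,
           {in `]0, +oo[ &, {homo phi : x y /~ x <= y}} &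
           equivalent_on `]0, +oo[ (fun t => t `^ (- e) * b t) phi)].

Definition tail_integral (q : R) b (x : R) : \bar R :=
  \int[leb]_(t in `]x, +oo[) (t^-1 * b t `^ q)%:E.

(* q/q' is written q (1 - 1/q). *)
Definition dual_weight (q : R) b (x : R) : R :=
  b x `^ (- (q * (1 - q^-1))) * fine (tail_integral q b x).

End slowly_varying.

(* Main.v *)
Require Import Defs.
From mathcomp Require Import all_boot all_order all_algebra.
From mathcomp Require Import all_classical all_reals all_analysis.
From mathcomp Require Import measurable_realfun.
From mathcomp Require Import lra ring.

(** Let [Y] be the sum [X_0 + X_1], let [w t = t^-1 * B t ^ q] be the density
attached to the weight and [W x] its integral over [(x, oo)], so that the dual
weight is [A = B ^ (1 - q) * W].

K-spaces of [(X_0, X_1)] and [(X_0, Y)].  The K-functional of [(X_0, Y)] is that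
of [(X_0, X_1)] for [t >= 1] and equals [t * K f 1] for [t <= 1]
([Kfun_sum_couple_ge1], [Kfun_sum_couple_le1]).  Since [b] and [B] agree on
[[1, oo)], the two norms have the same part over [(1, oo)], and this part
dominates [K f 1 ^ q * W 1].  On [(0, 1)] each of them is at most [K f 1 ^ q]
times a finite integral ([energy_comparison]).

Slow variation enters through one property: [t ^ (1/2) * B t] is non-decreasing
up to a constant factor ([slowly_varying_quasi_monotone]).  It gives
[c * B ^ q <= W] ([tail_lower]), hence [c * B <= A], and also
[c * x ^ (- q/2) <= W x] for [x >= 1].

From J to K.  For fixed [t] the K-functional is a seminorm bounded by a multiple
of the norm of the sum, so it passes under the Bochner integral
([seminorm_bochner_le]).  If [f] is the integral of [u s / s] and
[j s = J (u s) s], this yields ([Kfun_le_integral])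

  [K f t <= int_0^t s^-1 * j s ds + t * int_t^oo s^-2 * j s ds].

The first term is estimated by Hardy's inequality with weights [w] and
[W ^ q * w ^ (1 - q)] ([weighted_hardy]), and the second weight is exactly the
one in the J-norm ([energy_dual_weightE]).  The second term is estimated by a
dual Hardy inequality with the weight [B], which is at most a multiple of [A]
([dual_hardy]).  Both inequalities come from the Schur test, that is, from
Jensen's inequality followed by Tonelli's theorem ([schur_test]).

From K to J.  On dyadic blocks the mass of [w] can be much smaller than the tail
[W], and then the classical discretisation at the points [2 ^ k] loses the factor
by which [A] exceeds [B].  So the points [x_k] are chosen by [x_0 = 1] and
[W (x_k) = 2 ^ (-k) * W 1] ([halving_sequence]), which makes the mass of each block
comparable with the tail.  Let [f = g_k + h_k] be nearly optimal for the
K-functional at [x_(k+1)], with [g_0 = 0] and [h_0 = f]; the choice at [k = 0] is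
possible because [f] belongs to the second space [Y], and it makes the region
[s < 1] disappear from the construction.  The increments
[g_(k+1) - g_k] lie in the intersection and add up to [f].  On the block
[(x_k, x_(k+1)]] put [u s = s * omega s * (g_(k+1) - g_k)], where [omega] is [w]
normalised to have integral 1 on that block.  There
[A s * J (u s) s <= c * B s * K f (x_(k+2))]; the mass of the block is four times
that of the block with index [k + 2], on which [K f] is at least
[K f (x_(k+2))], and summing over [k] gives the bound ([energy_Jfun_le_Kfun]).
Convergence holds because finiteness of the norm gives [K f x <= D * x ^ (1/2)]
while [x_k ^ (- 1/2)] decays geometrically ([Kfun_growth],
[halving_sequence_decay]). *)

Set Implicit Arguments.
Unset Strict Implicit.
Unset Printing Implicit Defensive.

Import Order.TTheory GRing.Theory Num.Theory.
Import numFieldNormedType.Exports.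

Local Open Scope classical_set_scope.
Local Open Scope ring_scope.

(** * Integrals of non-negative functions and the Schur test *)

Section measure_space.
Context d (T : measurableType d) (R : realType).
Variable mu : {measure set T -> \bar R}.
Local Open Scope ereal_scope.

Lemma ge0_integral_cover (D : set T) (F : nat -> set T) (f : T -> \bar R) :
  measurable D -> (forall i, measurable (F i)) -> measurable_fun [set: T] f ->
  (forall x, 0 <= f x) -> D `<=` \bigcup_i F i ->
  \int[mu]_(x in D) f x <= \sum_(i <oo) \int[mu]_(x in F i) f x.
Proof.
move=> mD mF mf f0 DF.
have mFi i : measurable_fun [set: T] (f \_ (F i)).
  by apply/(measurable_restrictT _ (mF i)); exact: measurable_funS mf.
have Fi0 i x : 0 <= (f \_ (F i)) x by rewrite patchE; case: ifP.
rewrite (eq_eseriesr (g := fun i => \int[mu]_x (f \_ (F i)) x)); last first.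
  by move=> i _; rewrite integral_mkcond.
rewrite -integral_nneseries// integral_mkcond.
apply: ge0_le_integral => //.
- by move=> x _; rewrite patchE; case: ifP.
- by apply/(measurable_restrictT _ mD); exact: measurable_funS mf.
- by apply: ge0_emeasurable_sum.
- move=> x _; rewrite [leLHS]patchE; case: ifPn => [|_]; last exact: nneseries_ge0.
  rewrite inE => /DF [i _ Fix].
  apply: le_trans (nneseries_lim_ge (P := xpredT) i.+1 _) => //.
  rewrite big_mkord big_ord_recr/= [X in _ + X]patchE mem_set//.
  by rewrite leeDr// sume_ge0.
Qed.

Lemma ge0_le_integral_EFin (D : set T) (f g : T -> R) :
  measurable D -> measurable_fun [set: T] f -> measurable_fun [set: T] g ->
  (forall x, D x -> 0 <= f x)%R -> (forall x, D x -> f x <= g x)%R ->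
  \int[mu]_(x in D) (f x)%:E <= \int[mu]_(x in D) (g x)%:E.
Proof.
move=> mD mf mg f0 fg; apply: ge0_le_integral => //.
- exact/measurable_EFinP/measurable_funTS.
- exact/measurable_EFinP/measurable_funTS.
Qed.

Lemma ge0_subset_integral_EFin (A B : set T) (f : T -> R) :
  measurable A -> measurable B -> measurable_fun [set: T] f ->
  (forall x, 0 <= f x)%R -> A `<=` B ->
  \int[mu]_(x in A) (f x)%:E <= \int[mu]_(x in B) (f x)%:E.
Proof.
move=> mA mB mf f0 AB; apply: ge0_subset_integral => //.
- exact/measurable_EFinP/measurable_funTS.
- by move=> x _; rewrite lee_fin.
Qed.

Lemma ge0_integralZl_EFinM (D : set T) (c : R) (f : T -> R) :
  measurable D -> measurable_fun [set: T] f -> (0 <= c)%R ->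
  (forall x, 0 <= f x)%R ->
  \int[mu]_(x in D) (c * f x)%:E = c%:E * \int[mu]_(x in D) (f x)%:E.
Proof.
move=> mD mf c0 f0; under eq_integral do rewrite EFinM.
apply: ge0_integralZl_EFin => //; first by move=> x _; rewrite lee_fin.
exact/measurable_EFinP/measurable_funTS.
Qed.

Lemma ge0_integral_nondecreasing_bigcup_le (F : nat -> set T) (f : T -> R)
    (y : \bar R) :
  (forall m n, (m <= n)%N -> F m `<=` F n) -> (forall n, measurable (F n)) ->
  measurable_fun [set: T] f -> (forall x, 0 <= f x)%R ->
  (forall n, \int[mu]_(x in F n) (f x)%:E <= y) ->
  \int[mu]_(x in \bigcup_n F n) (f x)%:E <= y.
Proof.
move=> ndF mF mf f0 fy.
have cvgF : \int[mu]_(x in F i) (f x)%:E @[i --> \oo] -->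
    \int[mu]_(x in \bigcup_i F i) (f x)%:E.
  apply: ge0_nondecreasing_set_cvg_integral => //.
  - by move=> m n mn; apply/subsetPset; exact: ndF.
  - by move=> n; exact/measurable_EFinP/measurable_funTS.
  - by move=> n x _; rewrite lee_fin.
by apply: (cvge_le _ cvgF); exact: nearW.
Qed.

(** Hoelder's inequality for [k ^ (1 - 1/q)] and [k ^ (1/q) * g]: the mass of [k]
may be any number up to [kappa], and only the power [q - 1] of it is lost. *)
Lemma weighted_jensen (q kappa : R) (k g : T -> R) : (1 <= q)%R ->
  measurable_fun [set: T] k -> measurable_fun [set: T] g ->
  (forall x, 0 <= k x)%R -> (forall x, 0 <= g x)%R ->
  \int[mu]_x (k x)%:E <= kappa%:E ->
  (\int[mu]_x (k x * g x)%:E) `^ q <=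
  (kappa `^ (q - 1))%:E * \int[mu]_x (k x * g x `^ q)%:E.
Proof.
move=> q1 mk mg k0 g0 kk.
have kappa0 : (0 <= kappa)%R.
  rewrite -lee_fin; apply: le_trans kk.
  by apply: integral_ge0 => x _; rewrite lee_fin.
have [->|qn1] := eqVneq q 1%R.
  rewrite subrr powRr0 mul1e poweRe1; last first.
    by apply: integral_ge0 => x _; rewrite lee_fin mulr_ge0.
  by under [leRHS]eq_integral do rewrite powRr1//.
have q0 : (0 < q)%R by lra.
have {qn1 q1}q1 : (1 < q)%R by rewrite lt_neqAle eq_sym qn1.
pose p := (q / (q - 1))%R.
have qB0 : (0 < q - 1)%R by lra.
have p0 : (0 < p)%R by rewrite divr_gt0.
have pV : (p^-1 = (q - 1) / q)%R by rewrite /p invf_div.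
have pq : (p^-1 + q^-1 = 1)%R.
  by rewrite pV -[X in (_ + X)%R]mul1r -mulrDl subrK divff// gt_eqF.
have mkr r : measurable_fun [set: T] (fun x => k x `^ r)%R.
  exact: (measurableT_comp (measurable_powR r) mk).
have := @hoelder _ T R mu (fun x => k x `^ p^-1)%R
  (fun x => k x `^ q^-1 * g x)%R p q (mkr _)
  (measurable_funM (mkr _) mg) p0 q0 pq.
rewrite Lnorm1.
under eq_integral => x _.
  rewrite /= mulrA -powRD ?pq ?oner_eq0// powRr1// ger0_norm ?mulr_ge0//.
  over.
move=> /(@gt0_ler_poweR _ _ (ltW q0)).
rewrite !in_itv/= !leey !andbT integral_ge0; last first.
  by move=> x _; rewrite lee_fin mulr_ge0.
rewrite mule_ge0 ?Lnorm_ge0// => /(_ isT isT)/le_trans; apply.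
rewrite poweRM ?Lnorm_ge0// (poweR_Lnorm mu _ (lt0r_neq0 q0)).
apply: lee_pmul.
- exact: poweR_ge0.
- by apply: integral_ge0 => x _; exact: poweR_ge0.
- rewrite unlock -poweRrM.
  have -> : (p^-1 * q = q - 1)%R by rewrite pV divfK// gt_eqF.
  under eq_integral => x _.
    rewrite /= ger0_norm ?powR_ge0// -powRrM mulVf ?gt_eqF// powRr1//.
    over.
  rewrite -poweR_EFin; apply: gt0_ler_poweR => //; first exact: ltW.
  + by rewrite in_itv/= leey andbT integral_ge0// => x _; rewrite lee_fin.
  + by rewrite in_itv/= leey andbT lee_fin.
- under eq_integral => x _.
    rewrite /= ger0_norm ?mulr_ge0 ?powR_ge0// powRM ?powR_ge0//.
    rewrite -powRrM mulVf ?gt_eqF// powRr1//.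
    over.
  by [].
Qed.

End measure_space.

Section schur.
Context d (T : measurableType d) (R : realType).
Variable mu : {sigma_finite_measure set T -> \bar R}.
Local Open Scope ereal_scope.

(** Jensen's inequality for the kernel at fixed [t] turns the q-th power of the
integral into an integral of [k (t, s) * g s ^ q]; exchanging the integrals
leaves [lambda] as the new weight.  The two bounds are only required where [a]
and [g] do not vanish, so that functions on a part of the space can be extended
by zero. *)
Lemma schur_test (q : R) (k : T * T -> R) (a kappa lambda g : T -> R) :
  (1 <= q)%R -> measurable_fun [set: T * T] k -> measurable_fun [set: T] a ->
  measurable_fun [set: T] kappa -> measurable_fun [set: T] g ->
  measurable_fun [set: T] lambda ->
  (forall z, 0 <= k z)%R -> (forall x, 0 <= a x)%R -> (forall x, 0 <= g x)%R ->
  (forall t, a t != 0%R -> \int[mu]_s (k (t, s))%:E <= (kappa t)%:E) ->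
  (forall s, g s != 0%R ->
    \int[mu]_t (a t * kappa t `^ (q - 1) * k (t, s))%:E <= (lambda s)%:E) ->
  \int[mu]_t ((a t)%:E * (\int[mu]_s (k (t, s) * g s)%:E) `^ q) <=
  \int[mu]_s (lambda s * g s `^ q)%:E.
Proof.
move=> q1 mk ma mkappa mg ml k0 a0 g0 hk hl.
have q0 : (0 < q)%R by lra.
have mgq : measurable_fun [set: T] (fun x => g x `^ q)%R.
  exact: (measurableT_comp (measurable_powR q) mg).
have mkq : measurable_fun [set: T] (fun x => kappa x `^ (q - 1))%R.
  exact: (measurableT_comp (measurable_powR (q - 1)) mkappa).
have mks t : measurable_fun [set: T] (fun s => k (t, s)).
  exact: (measurableT_comp mk (pair1_measurable t)).
have mkt s : measurable_fun [set: T] (fun t => k (t, s)).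
  exact: (measurableT_comp mk (pair2_measurable s)).
pose F (z : T * T) := (a z.1 * kappa z.1 `^ (q - 1) * k z * g z.2 `^ q)%R.
have F0 z : (0 <= F z)%R by rewrite /F !mulr_ge0 ?powR_ge0.
have mF : measurable_fun [set: T * T] (EFin \o F).
  apply/measurable_EFinP; apply: measurable_funM; last first.
    exact: (measurableT_comp mgq measurable_snd).
  apply: measurable_funM => //; apply: measurable_funM.
    exact: (measurableT_comp ma measurable_fst).
  exact: (measurableT_comp mkq measurable_fst).
apply: (@le_trans _ _ (\int[mu]_t \int[mu]_s (EFin \o F) (t, s))).
  apply: ge0_le_integral => //.
  - by move=> t _; rewrite mule_ge0 ?lee_fin ?poweR_ge0.
  - apply: emeasurable_funM; first exact/measurable_EFinP.
    apply: (measurableT_comp (measurable_poweR q)).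
    apply: (@measurable_fun_fubini_tonelli_F _ _ T T R mu
       (fun z => (k z * g z.2)%:E)); last first.
      by move=> z; rewrite lee_fin mulr_ge0.
    apply/measurable_EFinP; apply: measurable_funM => //.
    exact: (measurableT_comp mg measurable_snd).
  - by apply: measurable_fun_fubini_tonelli_F => // z; rewrite lee_fin.
  - move=> t _.
    have [at0|at0] := eqVneq (a t) 0%R.
      by rewrite at0 mul0e integral_ge0// => s _; rewrite lee_fin.
    apply: (@le_trans _ _ ((a t)%:E * ((kappa t `^ (q - 1))%:E *
        \int[mu]_s (k (t, s) * g s `^ q)%:E))).
      rewrite lee_pmul2l ?lte_fin ?lt_neqAle 1?eq_sym ?at0 ?a0//.
      apply: weighted_jensen => //.
      exact: hk.
    rewrite muleA -EFinM -ge0_integralZl//.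
    + by under [leRHS]eq_integral do rewrite /= /F /= -mulrA EFinM.
    + by apply/measurable_EFinP; exact: measurable_funM.
    + by move=> s _; rewrite lee_fin mulr_ge0 ?powR_ge0.
    + by rewrite lee_fin mulr_ge0 ?powR_ge0.
rewrite (fubini_tonelli (EFin \o F) mF) => [|z]; last by rewrite lee_fin.
apply: ge0_le_integral => //.
- by move=> s _; apply: integral_ge0 => t _; rewrite lee_fin.
- by apply: measurable_fun_fubini_tonelli_G => // z; rewrite lee_fin.
- by apply/measurable_EFinP; exact: measurable_funM.
- move=> s _.
  have [gs0|gs0] := eqVneq (g s) 0%R.
    rewrite /F/= gs0 powR0 ?gt_eqF// mulr0.
    under eq_integral do rewrite mulr0.
    by rewrite integral0.
  under eq_integral do rewrite /F /= EFinM.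
  rewrite ge0_integralZr//.
  + by rewrite EFinM; apply: lee_wpmul2r; [rewrite lee_fin powR_ge0|exact: hl].
  + by apply/measurable_EFinP; apply: measurable_funM => //;
      exact: measurable_funM.
  + by move=> t _; rewrite lee_fin !mulr_ge0 ?powR_ge0.
  + by rewrite lee_fin powR_ge0.
Qed.

End schur.

(** * Simple functions with values in a normed space *)

Section finitely_valued.
Context d (T : measurableType d) (R : realType).
Variable mu : {measure set T -> \bar R}.

(** [simple_function] for an arbitrary target type; pairs of simple functions
and the real coefficients of a simple function are of this kind. *)
Definition finitely_valued (J : Type) (s : T -> J) : Prop :=
  finite_set (range s) /\ forall j, measurable (s @^-1` [set j]).

Lemma finitely_valued_preimage (J : Type) (s : T -> J) (A : set J) :
  finitely_valued s -> measurable (s @^-1` A).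
Proof.
move=> [fs ms].
have -> : s @^-1` A = \bigcup_(j in range s `&` A) s @^-1` [set j].
  apply/seteqP; split=> [x Ax|x [j [_ Aj] /= ->]//].
  by exists (s x) => //; split => //; exists x.
apply: fin_bigcup_measurable => //.
by apply: sub_finite_set fs => j [].
Qed.

Lemma finitely_valued_comp2 (J1 J2 J3 : Type) (h : J1 -> J2 -> J3)
    (s1 : T -> J1) (s2 : T -> J2) :
  finitely_valued s1 -> finitely_valued s2 ->
  finitely_valued (fun x => h (s1 x) (s2 x)).
Proof.
move=> f1 f2; split.
  apply: (@sub_finite_set _ _ ((fun z => h z.1 z.2) @` (range s1 `*` range s2))).
    by move=> _ [x _ <-]; exists (s1 x, s2 x).
  by apply: finite_image; apply: finite_setX; [have [] := f1|have [] := f2].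
move=> v.
have -> : (fun x => h (s1 x) (s2 x)) @^-1` [set v] =
    \bigcup_(j in range s1) (s1 @^-1` [set j] `&` s2 @^-1` [set i | h j i = v]).
  apply/seteqP; split=> [x hv|x [j _ [/= -> //]]].
  by exists (s1 x) => //; exists x.
apply: fin_bigcup_measurable; first by have [] := f1.
by move=> j _; apply: measurableI; exact: finitely_valued_preimage.
Qed.

Lemma finitely_valued_comp (J1 J2 : Type) (h : J1 -> J2) (s : T -> J1) :
  finitely_valued s -> finitely_valued (h \o s).
Proof. by move=> fs; apply: (finitely_valued_comp2 (fun x _ => h x) fs fs). Qed.

Lemma finitely_valued_measurable (J : Type) d' (U : measurableType d')
    (s : T -> J) (p : J -> U) (D : set T) :
  finitely_valued s -> measurable_fun D (p \o s).
Proof.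
move=> fs mD B mB; apply: measurableI => //.
by rewrite comp_preimage; exact: finitely_valued_preimage.
Qed.

Lemma integral_finitely_valued (J : choiceType) (s : T -> J) (p : J -> R)
    (D : set T) :
  measurable D -> finitely_valued s -> (forall j, 0 <= p j) ->
  (\int[mu]_(x in D) (p (s x))%:E =
   \sum_(j \in range s) (p j)%:E * mu (D `&` s @^-1` [set j]))%E.
Proof.
move=> mD fs p0.
have sE x : (p (s x))%:E =
    (\sum_(j \in range s) (p j)%:E * (\1_(s @^-1` [set j]) x)%:E)%E.
  rewrite (fsbigD1 (s x))/=; [|by have [] := fs|by exists x].
  rewrite indicE mem_set// mule1 fsbig1 ?adde0// => j [_ /= jx].
  by rewrite indicE memNset ?mule0//= => /esym.
under eq_integral do rewrite sE.
rewrite ge0_integral_fsum//; last by have [] := fs.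
- apply: eq_fsbigr => j _.
  rewrite ge0_integralZl//.
  + by rewrite integral_indic 1?setIC//; exact: finitely_valued_preimage.
  + apply/measurable_EFinP; apply: measurable_indic.
    exact: finitely_valued_preimage.
  + by rewrite lee_fin.
- move=> j; apply/measurable_EFinP; apply: measurable_funM => //.
  apply: measurable_indic; exact: finitely_valued_preimage.
- by move=> j x _; rewrite -EFinM lee_fin mulr_ge0.
Qed.

End finitely_valued.

Section bochner_theory.
Context d (T : measurableType d) (R : realType).
Variable mu : {measure set T -> \bar R}.
Variable V : normedModType R.
Implicit Types (D : set T) (s f : T -> V).

(** The defining sum may be taken over any finite partition on which the
function is constant, not only over the partition by its values.  Applied to the
partition by the pair of two functions it gives additivity. *)
Lemma simple_integral_comp (J : choiceType) (tau : T -> J) (g : J -> V) D :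
  measurable D -> finitely_valued tau ->
  (forall j, g j != 0 -> (mu (D `&` tau @^-1` [set j]) < +oo)%E) ->
  simple_integral mu D (g \o tau) =
  \sum_(j \in range tau) fine (mu (D `&` tau @^-1` [set j])) *: g j.
Proof.
move=> mD ft hfin; rewrite /simple_integral.
have frt : finite_set (range tau) by have [] := ft.
have frg : finite_set (range (g \o tau)).
  by have [] := finitely_valued_comp g ft.
pose m j := fine (mu (D `&` tau @^-1` [set j])).
transitivity (\sum_(v \in range (g \o tau)) \sum_(j \in range tau)
    (if g j == v then m j *: v else 0)).
  apply: eq_fsbigr => v _.
  have [->|v0] := eqVneq v 0.
    rewrite scaler0 fsbig1// => j _.
    by case: ifP => // _; rewrite scaler0.
  have -> : D `&` (g \o tau) @^-1` [set v] =
      \bigcup_(j in range tau `&` [set j | g j = v]) (D `&` tau @^-1` [set j]).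
    apply/seteqP; split => [x [Dx /= gv]|x [j [_ /= gv] [Dx /= tj]]].
      by exists (tau x) => //; split => //; exists x.
    by split => //=; rewrite tj.
  rewrite measure_fin_bigcup; last 3 first.
  - by apply: sub_finite_set frt => j [].
  - by move=> i j _ _ [x [[_ /= <-] [_ /= <-]]].
  - by move=> j _; apply: measurableI => //; exact: finitely_valued_preimage.
  rewrite fsbig_mkcondr/= !fsbig_finite//=.
  rewrite -sum_fine => [|j _]; last first.
    case: ifPn => // /[!inE]/= gj; rewrite ge0_fin_numE// hfin//.
    by rewrite gj.
  rewrite scaler_suml; apply: eq_bigr => j _.
  have [gj|gj] := eqVneq (g j) v; first by rewrite mem_set.
  by rewrite memNset ?scale0r// => /eqP; rewrite (negbTE gj).
rewrite exchange_fsbig//; apply: eq_fsbigr => j; rewrite inE => -[x _ <-].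
rewrite (fsbigD1 (g (tau x)))/=; [|done|by exists x].
rewrite eqxx fsbig1 ?addr0// => v [_ /= vx].
by case: eqP => // /esym.
Qed.

Lemma simple_functionD s1 s2 : simple_function s1 -> simple_function s2 ->
  simple_function (s1 \+ s2).
Proof. exact: finitely_valued_comp2. Qed.

Lemma simple_functionB s1 s2 : simple_function s1 -> simple_function s2 ->
  simple_function (s1 \- s2).
Proof. exact: (finitely_valued_comp2 (fun x y => x - y)). Qed.

Lemma integrable_simple_functionD D s1 s2 : measurable D ->
  integrable_simple_function mu D s1 -> integrable_simple_function mu D s2 ->
  integrable_simple_function mu D (s1 \+ s2) /\
  simple_integral mu D (s1 \+ s2) =
    simple_integral mu D s1 + simple_integral mu D s2.
Proof.
move=> mD [f1 h1] [f2 h2].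
pose tau x := (s1 x, s2 x).
have ft : finitely_valued tau := finitely_valued_comp2 pair f1 f2.
have frt : finite_set (range tau) by have [] := ft.
have mt j : measurable (D `&` tau @^-1` [set j]).
  by apply: measurableI => //; exact: finitely_valued_preimage.
have m1 v : measurable (D `&` s1 @^-1` [set v]).
  by apply: measurableI => //; exact: finitely_valued_preimage.
have m2 v : measurable (D `&` s2 @^-1` [set v]).
  by apply: measurableI => //; exact: finitely_valued_preimage.
have ht1 j : j.1 != 0 -> (mu (D `&` tau @^-1` [set j]) < +oo)%E.
  move=> /h1; apply: le_lt_trans.
  by apply: le_measure; rewrite ?inE// => x [Dx /= <-].
have ht2 j : j.2 != 0 -> (mu (D `&` tau @^-1` [set j]) < +oo)%E.
  move=> /h2; apply: le_lt_trans.
  by apply: le_measure; rewrite ?inE// => x [Dx /= <-].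
have ht j : j.1 + j.2 != 0 -> (mu (D `&` tau @^-1` [set j]) < +oo)%E.
  have [j1|/ht1//] := eqVneq j.1 0.
  by rewrite j1 add0r => /ht2.
split; last first.
  have -> : s1 \+ s2 = (fun z => z.1 + z.2) \o tau by [].
  rewrite (simple_integral_comp mD ft ht).
  have -> : simple_integral mu D s1 = _ := simple_integral_comp mD ft ht1.
  have -> : simple_integral mu D s2 = _ := simple_integral_comp mD ft ht2.
  rewrite !fsbig_finite//= -big_split/=.
  by apply: eq_bigr => j _; rewrite scalerDr.
split; first exact: simple_functionD.
move=> v v0.
have -> : D `&` (s1 \+ s2) @^-1` [set v] =
    \bigcup_(j in range tau `&` [set j | j.1 + j.2 = v])
      (D `&` tau @^-1` [set j]).
  apply/seteqP; split=> [x [Dx /= xv]|x [j [_ /= <-] [Dx /= tj]]].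
    by exists (tau x) => //; split => //; exists x.
  by split => //=; rewrite -tj.
rewrite measure_fin_bigcup//; last 2 first.
- by apply: sub_finite_set frt => j [].
- by move=> i j _ _ [x [[_ /= <-] [_ /= <-]]].
rewrite fsbig_mkcondr/= fsbig_finite//=.
apply/lte_sum_pinfty => j _.
by case: ifPn => // /[!inE]/= jv; apply: ht; rewrite jv.
Qed.

(** The only non-trivial case of finiteness is a value [c != 0] of [sigma], where
[c * mu (sigma = c)] is bounded by the integral. *)
Lemma integrable_simple_function_scale D (sigma : T -> R) (v : V) :
  measurable D -> finitely_valued sigma -> (forall x, 0 <= sigma x) ->
  (\int[mu]_(x in D) (sigma x)%:E < +oo)%E ->
  integrable_simple_function mu D (fun x => sigma x *: v) /\
  simple_integral mu D (fun x => sigma x *: v) =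
    fine (\int[mu]_(x in D) (sigma x)%:E) *: v.
Proof.
move=> mD fs s0 soo.
have frs : finite_set (range sigma) by have [] := fs.
have ms c : measurable (D `&` sigma @^-1` [set c]).
  by apply: measurableI => //; exact: finitely_valued_preimage.
have hfin c : c != 0 -> (mu (D `&` sigma @^-1` [set c]) < +oo)%E.
  move=> c0.
  have [[x0 _ x0c]|nc] := pselect ((range sigma) c); last first.
    suff -> : D `&` sigma @^-1` [set c] = set0 by rewrite measure0.
    by apply/seteqP; split=> // x [_ /= xc]; apply: nc; exists x.
  have cp : 0 < c by rewrite lt_neqAle eq_sym c0 -x0c s0.
  suff : (c%:E * mu (D `&` sigma @^-1` [set c]) < +oo)%E.
    by case: (mu _) => [r| |]//; rewrite ?ltry// gt0_muley ?lte_fin.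
  apply: le_lt_trans soo.
  rewrite -integral_cst//.
  rewrite (eq_integral (fun x => (sigma x)%:E)); last first.
    by move=> x /[!inE] -[_ /= ->].
  apply: ge0_subset_integral => //.
  - apply/measurable_EFinP.
    exact: (@finitely_valued_measurable _ T _ _ R sigma id D fs).
  - by move=> x _; rewrite lee_fin.
have hv c : c *: v != 0 -> (mu (D `&` sigma @^-1` [set c]) < +oo)%E.
  by rewrite scaler_eq0 negb_or => /andP[/hfin].
split.
  split; first exact: (finitely_valued_comp (fun c => c *: v) fs).
  move=> w w0.
  have -> : D `&` (fun x => sigma x *: v) @^-1` [set w] =
    \bigcup_(c in range sigma `&` [set c | c *: v = w])
      (D `&` sigma @^-1` [set c]).
    apply/seteqP; split=> [x [Dx /= xv]|x [j [_ /= <-] [Dx /= tj]]].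
      by exists (sigma x) => //; split => //; exists x.
    by split => //=; rewrite -tj.
  rewrite measure_fin_bigcup//; last 2 first.
  - by apply: sub_finite_set frs => j [].
  - by move=> i j _ _ [x [[_ /= <-] [_ /= <-]]].
  rewrite fsbig_mkcondr/= fsbig_finite//=.
  apply/lte_sum_pinfty => j _.
  by case: ifPn => // /[!inE]/= jv; apply: hv; rewrite jv.
rewrite (simple_integral_comp mD fs hv).
under eq_integral do rewrite -(ger0_norm (s0 _)).
rewrite (integral_finitely_valued mu (p := Num.norm) mD fs)//.
rewrite !fsbig_finite//= -sum_fine => [|c _]; last first.
  have [->|/hfin c0] := eqVneq c 0; first by rewrite normr0 mul0e.
  by rewrite fin_numM// ge0_fin_numE.
rewrite scaler_suml; apply: eq_big_seq => c.
rewrite in_fset_set// inE => -[x _ <-].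
have [->|/hfin c0] := eqVneq (sigma x) 0.
  by rewrite normr0 mul0e !scale0r scaler0.
by rewrite fineM// ?ge0_fin_numE//= ger0_norm// scalerA mulrC.
Qed.

End bochner_theory.

(** * Seminorms under the Bochner integral *)

Lemma lipschitz_continuous (R : realType) (V : normedModType R) (p : V -> R)
    (M : R) : 0 <= M -> (forall x y, `|p x - p y| <= M * `|x - y|) ->
  continuous p.
Proof.
move=> M0 pB x; apply/cvgrPdist_le => e e0.
have M1 : 0 < M + 1 by rewrite ltr_wpDl.
near=> y; apply: (le_trans (pB x y)).
apply: (@le_trans _ _ ((M + 1) * `|x - y|)).
  by rewrite ler_wpM2r// lerDl.
rewrite mulrC -ler_pdivlMr//; apply: ltW.
near: y; apply: (@cvgr_dist_lt _ _ _ (nbhs x) _ id) => //.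
by rewrite divr_gt0.
Unshelve. all: by end_near. Qed.

Section limits_of_simple_functions.
Context d (T : measurableType d) (R : realType).
Variable mu : {measure set T -> \bar R}.
Hypothesis cmu : measure_is_complete mu.
Variable V : normedModType R.

(** Convergence holds almost everywhere only, so completeness of the measure is
what makes the limit measurable. *)
Lemma measurable_ae_limit (D : set T) (s_ : nat -> T -> V) (f : T -> V)
    (p : V -> R) :
  measurable D -> (forall n, simple_function (s_ n)) -> continuous p ->
  {ae mu, forall x, D x -> s_ ^~ x @ \oo --> f x} ->
  measurable_fun D (p \o f).
Proof.
move=> mD ss cp sf.
pose h x := limn_esup (fun n => (p (s_ n x))%:E).
have mh : measurable_fun D h.
  apply: measurable_fun_limn_esup => n; apply/measurable_EFinP.
  exact: (@finitely_valued_measurable _ T _ _ R (s_ n) p D (ss n)).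
apply/measurable_EFinP; apply: (ae_measurable_fun cmu _ mh).
apply: filterS sf => x sfx Dx.
have psf : (fun n => (p (s_ n x))%:E) @ \oo --> (p (f x))%:E.
  apply/fine_cvgP; split; first by near=> n.
  exact: (cvg_comp (s_ ^~ x) p (sfx Dx) (cp (f x))).
by rewrite /h is_cvg_limn_esupE; [exact/cvg_lim|apply/cvg_ex; exists (p (f x))%:E].
Unshelve. all: by end_near. Qed.

(** For a simple function this is the triangle inequality.  In general, compare
[p] of the integral of [s_ n] with the integral of [p \o f] up to [M] times the
integral of [`|f - s_ n|], and let [n] tend to infinity.  The integrand [F] is any
measurable majorant of [p \o f]. *)
Lemma seminorm_bochner_le (D : set T) (f : T -> V) (I : V) (p : V -> R) (M : R)
    (F : T -> R) :
  measurable D -> 0 <= M ->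
  (forall x, 0 <= p x) -> (forall x y, p (x + y) <= p x + p y) ->
  (forall a x, 0 <= a -> p (a *: x) = a * p x) -> (forall x, p (- x) = p x) ->
  (forall x, p x <= M * `|x|) ->
  measurable_fun D F -> (forall x, D x -> p (f x) <= F x) ->
  is_bochner_integral mu D f I ->
  ((p I)%:E <= \int[mu]_(x in D) (F x)%:E)%E.
Proof.
move=> mD M0 p0 pD pZ pN pM mF pF [s_ [is_ sf f0 sI]].
have pB x y : `|p x - p y| <= M * `|x - y|.
  apply: le_trans (pM _).
  have := pD x (y - x); have := pD y (x - y); rewrite !subrKC.
  rewrite -[p (y - x)]pN opprB ler_norml => ? ?.
  by apply/andP; split; lra.
have cp : continuous p := lipschitz_continuous M0 pB.
have ss n : simple_function (s_ n) by have [] := is_ n.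
have mp : measurable_fun D (p \o f) by apply: (measurable_ae_limit mD ss cp sf).
have md n : measurable_fun D (fun x => `|f x - s_ n x|).
  apply: (@measurable_ae_limit D (fun m => s_ m \- s_ n) (f \- s_ n) Num.norm) => //.
  - by move=> m; exact: simple_functionB.
  - exact: norm_continuous.
  - apply: filterS sf => x sfx Dx.
    by apply: cvgB; [exact: sfx|exact: cvg_cst].
have key n : ((p (simple_integral mu D (s_ n)))%:E <=
   \int[mu]_(x in D) (p (f x))%:E +
   M%:E * \int[mu]_(x in D) (`|f x - s_ n x|)%:E)%E.
  apply: (@le_trans _ _ (\int[mu]_(x in D) (p (s_ n x))%:E)%E).
    rewrite (integral_finitely_valued mu mD (ss n))//.
    rewrite /simple_integral !fsbig_finite; try by have [] := ss n.
    have pz : p 0 = 0 by rewrite -(scale0r (0 : V)) pZ// mul0r.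
    have psum (r : seq V) (G : V -> V) :
        p (\sum_(v <- r) G v) <= \sum_(v <- r) p (G v).
      elim/big_ind2 : _ => //; first by rewrite pz.
      by move=> a b a' b' ab ab'; apply: (le_trans (pD _ _)); exact: lerD.
    move: (psum (finmap.enum_fset (fset_set (range (s_ n))))
      (fun v => fine (mu (D `&` s_ n @^-1` [set v])) *: v)).
    rewrite -lee_fin => /le_trans; apply.
    rewrite -sumEFin; apply: lee_sum => v _.
    rewrite pZ; last by rewrite fine_ge0.
    have [->|v0] := eqVneq v 0; first by rewrite pz mulr0 mul0e.
    by rewrite EFinM fineK 1?muleC// ge0_fin_numE//; apply: (is_ n).2.
  rewrite -ge0_integralZl//; last exact/measurable_EFinP.
  have mp' : measurable_fun D (fun x => (p (f x))%:E) by exact/measurable_EFinP.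
  have md' : measurable_fun D (fun x => M%:E * (`|f x - s_ n x|)%:E)%E.
    by apply: emeasurable_funM => //; exact/measurable_EFinP.
  rewrite -ge0_integralD//; last 2 first.
  - by move=> x _; rewrite lee_fin.
  - by move=> x _; rewrite -EFinM lee_fin mulr_ge0.
  apply: ge0_le_integral => //.
  - by move=> x _; rewrite lee_fin.
  - apply/measurable_EFinP.
    exact: (@finitely_valued_measurable _ T _ _ R (s_ n) p D (ss n)).
  - exact: emeasurable_funD.
  - move=> x _; rewrite lee_fin -lerBlDl.
    by apply: (le_trans (ler_norm _)); rewrite distrC; exact: pB.
apply: (@le_trans _ _ (\int[mu]_(x in D) (p (f x))%:E)%E); last first.
  apply: ge0_le_integral => //.
  - by move=> x _; rewrite lee_fin.
  - exact/measurable_EFinP.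
  - exact/measurable_EFinP.
have [->|pfoo] := eqVneq (\int[mu]_(x in D) (p (f x))%:E)%E +oo%E.
  by rewrite leey.
have lhs : (fun n => (p (simple_integral mu D (s_ n)))%:E) @ \oo --> (p I)%:E.
  apply/fine_cvgP; split; first by near=> n.
  exact: (cvg_comp _ p sI (cp I)).
have rhs : (fun n => \int[mu]_(x in D) (p (f x))%:E +
    M%:E * \int[mu]_(x in D) (`|f x - s_ n x|)%:E)%E @ \oo -->
    (\int[mu]_(x in D) (p (f x))%:E)%E.
  rewrite -[X in _ --> X]adde0 -(mule0 M%:E).
  apply: cvgeD; first by rewrite mule0 fin_num_adde_defl.
    exact: cvg_cst.
  by apply: cvgeZl.
by apply: (lee_cvg_to lhs rhs); near=> n; exact: key.
Unshelve. all: by end_near. Qed.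

End limits_of_simple_functions.

(** * Bochner integrals of a density times a sequence of vectors *)

Import HBNNSimple.

(** A function [x |-> omega x *: v (e x)] is a vector-valued step function with
countably many values multiplied by a scalar density. *)
Section density_times_sequence.
Context d (T : measurableType d) (R : realType).
Variable mu : {measure set T -> \bar R}.
Variable V : normedModType R.
Variables (omega : T -> R) (e : T -> nat) (v : nat -> V).
Hypothesis momega : measurable_fun [set: T] omega.
Hypothesis omega0 : forall x, 0 <= omega x.
Hypothesis me : forall k, measurable (e @^-1` [set k]).

Let momegaE : measurable_fun [set: T] (EFin \o omega).
Proof. exact/measurable_EFinP. Qed.

Let sigma (n : nat) : T -> R := nnsfun_approx measurableT momegaE n.

(* Truncate the number of vectors and replace the density by simple functions
   increasing to it. *)
Let trunc (n m : nat) (x : T) : V :=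
  \sum_(k < m) (sigma n x * \1_(e @^-1` [set (k : nat)]) x) *: v k.

Let truncE n m x : trunc n m x = if (e x < m)%N then sigma n x *: v (e x) else 0.
Proof.
rewrite /trunc; case: ltnP => [em|me'].
  rewrite (bigD1 (Ordinal em))//= indicE mem_set// mulr1 big1 ?addr0// => i ie.
  rewrite indicE memNset ?mulr0 ?scale0r//= => ei.
  by move/eqP: ie; apply; apply: val_inj.
rewrite big1// => i _; rewrite indicE memNset ?mulr0 ?scale0r//= => ei.
by move: (ltn_ord i); rewrite -ei ltnNge me'.
Qed.

Let sigma0 n x : 0 <= sigma n x.
Proof. by rewrite /sigma. Qed.

Let sigma_le n x : sigma n x <= omega x.
Proof.
rewrite -lee_fin /sigma nnsfun_approxE; apply: le_approx => // y _.
by rewrite lee_fin.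
Qed.

Let sigma_cvg x : sigma ^~ x @ \oo --> omega x.
Proof.
have w0 y : [set: T] y -> (0%R <= (EFin \o omega) y)%E by rewrite lee_fin.
have := @cvg_nnsfun_approx _ _ _ _ measurableT _ momegaE w0 x Logic.I.
by move=> /fine_cvgP[_]; apply: cvg_trans.
Qed.

Let fsigma n : finitely_valued (sigma n).
Proof. by split => [|r]; rewrite /sigma//. Qed.

Let fsigma1 n k : finitely_valued (fun x => sigma n x * \1_(e @^-1` [set k]) x).
Proof.
apply: (finitely_valued_comp2 (fun a b => a * b) (fsigma n)).
split=> [|r].
  apply: (@sub_finite_set _ _ [set 0; 1]); last by [].
  by move=> _ [x _ <-] /=; rewrite indicE; case: (_ \in _); [right|left].
rewrite -[X in measurable X]setTI; apply: measurable_indic => //.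
Qed.

Let simple_trunc n m : simple_function (trunc n m).
Proof.
elim: m => [|m IH].
  split.
    apply: (@sub_finite_set _ _ [set 0]) => // _ [x _ <-].
    by rewrite /trunc big_ord0.
  move=> w; rewrite [X in measurable X](_ : _ = if w == 0 then setT else set0).
    by case: ifP.
  apply/seteqP; rewrite /trunc; split=> x /=; rewrite big_ord0.
    by move=> <-; rewrite eqxx.
  by case: eqP => // ->.
have -> : trunc n m.+1 = trunc n m \+
    (fun x => (sigma n x * \1_(e @^-1` [set m]) x) *: v m).
  by apply/funext => x; rewrite /trunc big_ord_recr.
apply: simple_functionD => //.
exact: (finitely_valued_comp (fun c => c *: v m) (fsigma1 n m)).
Qed.

Let trunc_cvg x : (fun n => trunc n n x) @ \oo --> omega x *: v (e x).
Proof.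
apply: (@cvg_trans _ ((fun n => sigma n x *: v (e x)) @ \oo)); last first.
  by apply: cvgZl; exact: sigma_cvg.
apply: near_eq_cvg; near=> n; rewrite truncE ifT//.
by near: n; exact: nbhs_infty_gt.
Unshelve. all: by end_near. Qed.

Lemma strongly_measurable_density D :
  strongly_measurable mu D (fun x => omega x *: v (e x)).
Proof. by exists (fun n => trunc n n) => //; apply/aeW. Qed.

Lemma measurable_comp_fibers d' (W : measurableType d') (p : nat -> W) D :
  measurable D -> measurable_fun D (p \o e).
Proof.
move=> mD _ B mB; apply: measurableI => //.
have -> : (p \o e) @^-1` B = \bigcup_(k in p @^-1` B) e @^-1` [set k].
  by apply/seteqP; split=> [x Bx|x [k Bk /= ->]//]; exists (e x).
by apply: bigcup_measurable => k _.
Qed.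

Variables (D : set T) (I : V).
Hypothesis mD : measurable D.
Hypothesis omega1 :
  forall k, (\int[mu]_(x in D `&` e @^-1` [set k]) (omega x)%:E = 1)%E.
Hypothesis sumv : cvgn (series (fun k => `|v k|)).
Hypothesis vI : series v @ \oo --> I.

Let split_integral (h : T -> R) : measurable_fun [set: T] h ->
  (forall x, 0 <= h x) ->
  (\int[mu]_(x in D) (h x)%:E =
   \sum_(k <oo) \int[mu]_(x in D `&` e @^-1` [set k]) (h x)%:E)%E.
Proof.
move=> mh h0.
have DE : D = \bigcup_k (D `&` e @^-1` [set k]).
  by apply/seteqP; split=> [x Dx|x [k _ []]//]; exists (e x).
rewrite {1}DE ge0_integral_bigcup//.
- by move=> k; exact: measurableI.
- by rewrite -DE; apply/measurable_EFinP; exact: measurable_funS mh.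
- by move=> x _; rewrite lee_fin.
- by move=> i j _ _ [x [[_ /= <-] [_ /= <-]]].
Qed.

(** Each fibre of [e] carries density mass 1, so the integral of the norm is
[\sum_k `|v k|], which is finite.  The truncations then converge in L^1 by dominated
convergence, and their integrals [\sum_(k < n) c n k *: v k] differ from the partial
sums of [v] by at most the L^1 distance. *)
Lemma bochner_density :
  is_bochner_integral mu D (fun x => omega x *: v (e x)) I.
Proof.
pose h n x : R := (omega x - (if (e x < n)%N then sigma n x else 0)) * `|v (e x)|.
have hE n x : `|omega x *: v (e x) - trunc n n x| = h n x.
  rewrite truncE /h; case: ifP => _.
    by rewrite -scalerBl normrZ ger0_norm// subr_ge0.
  by rewrite !subr0 normrZ ger0_norm.
have h0 n x : 0 <= h n x by rewrite -hE.
have mv : measurable_fun [set: T] (fun x => `|v (e x)|).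
  exact: (@measurable_comp_fibers _ _ (fun k => `|v k|)).
have mh n : measurable_fun [set: T] (h n).
  apply: measurable_funM => //; apply: measurable_funB => //.
  apply: measurable_fun_if => //.
  - exact: (@measurable_comp_fibers _ _ (fun k => (k < n)%N)).
  - by apply: measurable_funTS.
pose g x : R := omega x * `|v (e x)|.
have g0 x : 0 <= g x by rewrite mulr_ge0.
have mg : measurable_fun [set: T] g by exact: measurable_funM.
have hg n x : h n x <= g x.
  by rewrite ler_wpM2r// gerBl; case: ifP.
have mDe k : measurable (D `&` e @^-1` [set k]) by exact: measurableI.
have gfin : (\int[mu]_(x in D) (g x)%:E < +oo)%E.
  rewrite split_integral//.
  under eq_eseriesr => k _.
    under eq_integral => x xk.
      have ek : e x = k by move: xk; rewrite inE => -[].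
      rewrite /g ek EFinM; over.
    rewrite ge0_integralZr//; last 2 first.
    - exact/measurable_EFinP/measurable_funTS.
    - by move=> x _; rewrite lee_fin.
    rewrite omega1 mul1e; over.
  have -> : (fun n => \sum_(0 <= k < n) (`|v k|)%:E)%E =
      EFin \o series (fun k => `|v k|).
    by apply/funext => n; rewrite sumEFin.
  by rewrite EFin_lim// ltry.
have ig : mu.-integrable D (EFin \o g).
  apply/integrableP; split.
    exact/measurable_EFinP/measurable_funTS.
  by under eq_integral do rewrite /= ger0_norm//.
have hcvg : (fun n => \int[mu]_(x in D) (h n x)%:E)%E @ \oo --> 0%E.
  rewrite -(integral0 mu D).
  have [] := @dominated_convergence _ _ _ mu D mD
    (fun n => EFin \o h n) (cst 0%E) (EFin \o g).
  - by move=> n; exact/measurable_EFinP/measurable_funTS.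
  - exact: measurable_cst.
  - apply/aeW => x Dx.
    apply/fine_cvgP; split; first by near=> n.
    rewrite -(normr0 V) -(subrr (omega x *: v (e x))).
    under eq_fun do rewrite /= -hE.
    by apply: cvg_norm; apply: cvgB; [exact: cvg_cst|exact: trunc_cvg].
  - exact: ig.
  - by apply/aeW => x n Dx; rewrite /= ger0_norm ?lee_fin.
  - by [].
have c1 n k : (\int[mu]_(x in D) (sigma n x * \1_(e @^-1` [set k]) x)%:E =
   \int[mu]_(x in D `&` e @^-1` [set k]) (sigma n x)%:E)%E.
  rewrite integral_mkcondr; apply: eq_integral => x _.
  by rewrite patchE indicE; case: ifP => _; rewrite ?mulr1 ?mulr0.
have cle n k : (\int[mu]_(x in D `&` e @^-1` [set k]) (sigma n x)%:E <= 1)%E.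
  rewrite -(omega1 k); apply: ge0_le_integral => //.
  - by move=> x _; rewrite lee_fin.
  - apply/measurable_EFinP; exact: measurable_funTS.
  - apply/measurable_EFinP; exact: measurable_funTS.
  - by move=> x _; rewrite lee_fin.
pose c n k := fine (\int[mu]_(x in D `&` e @^-1` [set k]) (sigma n x)%:E).
have cE n k : (c n k)%:E = (\int[mu]_(x in D `&` e @^-1` [set k]) (sigma n x)%:E)%E.
  rewrite fineK// ge0_fin_numE ?(le_lt_trans (cle n k)) ?ltry//.
  by apply: integral_ge0 => x _; rewrite lee_fin.
have isi n m : integrable_simple_function mu D (trunc n m) /\
    simple_integral mu D (trunc n m) = \sum_(k < m) c n k *: v k.
  elim: m => [|m [IH1 IH2]].
    have [] := @integrable_simple_function_scale _ T R mu V D (cst 0) 0 mD.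
    - split=> [|r]; last by rewrite preimage_cst; case: ifP.
      apply: (@sub_finite_set _ _ [set 0]); last by [].
      by move=> _ [x _ <-].
    - by [].
    - by rewrite integral0.
    have -> : (fun x : T => cst 0 x *: 0 : V) = trunc n 0.
      by apply/funext => x; rewrite /trunc big_ord0 scaler0.
    by rewrite scaler0 big_ord0.
  have [||] := @integrable_simple_function_scale _ T R mu V D
    (fun x => sigma n x * \1_(e @^-1` [set m]) x) (v m) mD (fsigma1 n m).
  - by move=> x; rewrite mulr_ge0// indicE.
  - by rewrite c1 -cE ltry.
  rewrite c1 -/(c n m) => i2 s2.
  have -> : trunc n m.+1 = trunc n m \+
      (fun x => (sigma n x * \1_(e @^-1` [set m]) x) *: v m).
    by apply/funext => x; rewrite /trunc big_ord_recr.
  have [i3 ->] := integrable_simple_functionD mD IH1 i2.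
  by split => //; rewrite IH2 s2 big_ord_recr.
exists (fun n => trunc n n); split.
- by move=> n; have [] := isi n n.
- exact/aeW.
- by under eq_fun do under eq_integral do rewrite hE.
- under eq_fun do rewrite (isi _ _).2.
  have diff n : `|series v n - \sum_(k < n) c n k *: v k| <=
      fine (\int[mu]_(x in D) (h n x)%:E).
    rewrite /series/= big_mkord -sumrB -lee_fin.
    have hfin : (\int[mu]_(x in D) (h n x)%:E < +oo)%E.
      apply: le_lt_trans gfin; apply: ge0_le_integral => //.
      - by move=> x _; rewrite lee_fin.
      - exact/measurable_EFinP/measurable_funTS.
      - exact/measurable_EFinP/measurable_funTS.
      - by move=> x _; rewrite lee_fin.
    rewrite fineK; last first.
      rewrite ge0_fin_numE//.
      by apply: integral_ge0 => x _; rewrite lee_fin.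
    rewrite split_integral//.
    apply: le_trans (nneseries_lim_ge (P := xpredT) n _); last first.
      by move=> k _ _; apply: integral_ge0 => x _; rewrite lee_fin.
    rewrite big_mkord.
    apply: (@le_trans _ _ (\sum_(k < n) `|v k - c n k *: v k|)%:E).
      by rewrite lee_fin ler_norm_sum.
    rewrite -sumEFin; apply: lee_sum => k _.
    rewrite -[X in X - _]scale1r -scalerBl normrZ.
    rewrite ger0_norm; last first.
      by rewrite subr_ge0 -lee_fin cE.
    under eq_integral => x xk.
      have ek : e x = k by move: xk; rewrite inE => -[].
      rewrite /h ek ltn_ord EFinM; over.
    rewrite ge0_integralZr//; last 2 first.
    - by apply/measurable_EFinP/measurable_funTS; exact: measurable_funB.
    - by move=> x _; rewrite lee_fin subr_ge0.
    rewrite EFinM; apply: lee_wpmul2r; first by rewrite lee_fin.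
    rewrite EFinB leeBlDr// cE -ge0_integralD//.
    - by rewrite -(omega1 k); under [leRHS]eq_integral do rewrite -EFinD subrK.
    - by move=> x _; rewrite lee_fin subr_ge0.
    - by apply/measurable_EFinP/measurable_funTS; exact: measurable_funB.
    - by move=> x _; rewrite lee_fin.
    - exact/measurable_EFinP/measurable_funTS.
  have -> : (fun n => \sum_(k < n) c n k *: v k) = (fun n => series v n -
      (series v n - \sum_(k < n) c n k *: v k)).
    by apply/funext => n; rewrite subKr.
  have -> : I = I - 0 by rewrite subr0.
  apply: cvgB => //; apply/norm_cvg0P.
  have up : (fun n => fine (\int[mu]_(x in D) (h n x)%:E)) @ \oo --> (0 : R).
    by move/fine_cvgP : hcvg => [].
  apply: (squeeze_cvgr _ (cvg_cst (0 : R)) up).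
  by near=> n; rewrite normr_ge0/= diff.
Unshelve. all: by end_near. Qed.

End density_times_sequence.

(** * Lebesgue measurable sets and dyadic layers of a tail *)

Section lebesgue.
Context (R : realType).
Local Notation leb := (@completed_lebesgue_measure R).
Local Notation lebT := (caratheodory_type (@wlength R idfun)^*%mu).

Lemma leb_measurable (A : set R) :
  measurable (A : set (measurableTypeR R)) -> measurable (A : set lebT).
Proof. exact: sub_caratheodory. Qed.

Lemma leb_measurable_itv (i : interval R) : measurable ([set` i] : set lebT).
Proof. by apply: leb_measurable; exact: measurable_itv. Qed.

Lemma leb_measurable_fun d (U : measurableType d) (f : R -> U) :
  measurable_fun [set: R] f -> measurable_fun [set: lebT] (f : lebT -> U).
Proof. by move=> mf _ B mB; apply: leb_measurable; exact: mf. Qed.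

Lemma nondecreasing_leb_measurable (f : R -> R) :
  {in `]0, +oo[ &, {homo f : x y / x <= y}} ->
  measurable_fun (`]0, +oo[ : set lebT) (f : lebT -> R).
Proof.
move=> f_nd.
apply: (measurability (@RGenCInfty.G R)) => [|/= _ [_] [r] -> <-].
  exact: RGenCInfty.measurableE.
apply: leb_measurable; apply: is_interval_measurable => s t/=.
rewrite !in_itv/= !andbT => -[s0 fs] [t0 ft] u /andP[su ut].
have u0 : 0 < u by exact: lt_le_trans su.
by split; rewrite in_itv/= andbT//; apply: (le_trans fs); apply: f_nd => //;
  rewrite in_itv/= andbT.
Qed.

Lemma nonincreasing_leb_measurable (f : R -> R) :
  {in `]0, +oo[ &, {homo f : x y /~ x <= y}} ->
  measurable_fun (`]0, +oo[ : set lebT) (f : lebT -> R).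
Proof.
move=> f_ni; rewrite -(opprK f); apply/measurable_funN.
by apply: nondecreasing_leb_measurable => x y x0 y0 xy; rewrite lerN2 f_ni.
Qed.

(** Points are null sets. *)
Lemma ge0_integral_lebD1 (f : R -> \bar R) (D : set R) (a : R) :
  measurable (D : set lebT) -> measurable_fun [set: lebT] (f : lebT -> \bar R) ->
  (forall x, (0 <= f x)%E) -> (D `<=` `]a, +oo[ `|` [set a])%classic ->
  (\int[leb]_(x in D) f x <= \int[leb]_(x in `]a, +oo[) f x)%E.
Proof.
move=> mD mf f0 Da.
have ma : measurable ([set a] : set lebT).
  by apply: leb_measurable; exact: measurable_set1.
have mo : measurable (`]a, +oo[%classic : set lebT) by exact: leb_measurable_itv.
apply: (@le_trans _ _ (\int[leb]_(x in (`]a, +oo[ `|` [set a])%classic) f x)%E).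
  apply: ge0_subset_integral => //; first exact: measurableU.
  exact: measurable_funTS.
rewrite ge0_integral_setU//.
- have a0 : leb ([set a] : set lebT) = 0%E by exact: lebesgue_measure_set1.
  rewrite [X in (_ + X)%E]null_set_integral ?adde0//.
  exact: measurable_funTS.
- exact: measurable_funTS.
- apply/disj_setPLR => x /= /[swap] ->.
  by rewrite in_itv/= ltxx.
Qed.

Lemma dyadic_layer_ge (a x : R) : 0 < a -> a <= x ->
  exists i, 2 ^+ i * a / 2 < x <= 2 ^+ i * a.
Proof.
move=> a0 ax.
have ex : exists i, x <= 2 ^+ i * a.
  exists (Num.truncn (x / a)).+1; rewrite -ler_pdivrMr//.
  apply: (le_trans (ltW (truncnS_gt _))).
  by rewrite -natrX ler_nat ltnW// ltn_expl.
have [i xi mi] := ex_minnP ex; exists i; rewrite xi andbT.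
case: i xi mi => [|i] _ mi; first by rewrite expr0; lra.
have : ~~ (x <= 2 ^+ i * a) by apply/negP => /mi; rewrite ltnn.
by rewrite -ltNge exprS; lra.
Qed.

Lemma dyadic_layer_le (a x : R) : 0 < x -> x <= a ->
  exists i, 2^-1 ^+ i * a / 2 < x <= 2^-1 ^+ i * a.
Proof.
move=> x0 xa.
have ex : exists i, 2^-1 ^+ i * a / 2 < x.
  exists (Num.truncn (a / x)).+1.
  rewrite ltr_pdivrMr// exprVn mulrC ltr_pdivrMr ?exprn_gt0//.
  rewrite -mulrA -ltr_pdivrMl// mulrC.
  apply: (lt_le_trans (truncnS_gt _)).
  rewrite -exprS -natrX ler_nat ltnW// (ltn_trans (ltnSn _))// ltn_expl//.
have [i xi mi] := ex_minnP ex; exists i; rewrite xi/=.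
case: i xi mi => [|i] _ mi; first by rewrite expr0; lra.
have : ~~ (2^-1 ^+ i * a / 2 < x) by apply/negP => /mi; rewrite ltnn.
by rewrite -leNgt exprS; lra.
Qed.

Lemma powR_lt1 (x r : R) : 0 <= x < 1 -> 0 < r -> x `^ r < 1.
Proof.
move=> /andP[x0 x1] r0; have p1 : 1 `^ r = 1 :> R by rewrite powR1.
by rewrite -[X in _ < X]p1 gt0_ltr_powR ?nnegrE.
Qed.

Lemma powR2_lt1 (r : R) : r < 0 -> 2 `^ r < 1.
Proof.
move=> r0; rewrite -[r]opprK powRN -[_^-1]powR_inv1 ?powR_ge0// powRAC.
rewrite powR_inv1// powR_lt1 ?oppr_gt0//.
by rewrite invr_ge0 ler0n invf_lt1// ltr1n.
Qed.

Lemma powRhalf_lt1 (r : R) : 0 < r -> 2^-1 `^ r < 1.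
Proof.
by move=> r0; rewrite powR_lt1// invr_ge0 ler0n invf_lt1// ltr1n.
Qed.

(** The situation of a density [w] whose tail integral is at most a non-increasing
function [V].  If [V] were the tail itself and continuous, the substitution
[y = V s] would turn the integral of [w * V ^ (- gamma)] into that of a power.
Splitting into the layers where [V] lies between [y / 2] and [y] gives the same
estimates, up to constants, for every such [V]. *)
Section layers.
Variables (w V : R -> R).
Hypothesis mw : measurable_fun [set: lebT] (w : lebT -> R).
Hypothesis w0 : forall x, 0 <= w x.
Hypothesis mV : measurable_fun [set: lebT] (V : lebT -> R).
Hypothesis V0 : forall x, 0 < x -> 0 < V x.
Hypothesis V_ni : {in `]0, +oo[ &, {homo V : x y /~ x <= y}}.
Hypothesis tailV :
  forall x, 0 < x -> (\int[leb]_(s in `]x, +oo[) (w s)%:E <= (V x)%:E)%E.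

Let sublevel y : measurable ([set s | 0 < s /\ V s <= y] : set lebT).
Proof.
rewrite [X in measurable X](_ : _ = `]0, +oo[ `&` V @^-1` `]-oo, y]).
  apply: measurableI; first exact: leb_measurable_itv.
  by rewrite -[X in measurable X]setTI; apply: mV => //.
by apply/seteqP; split=> s; rewrite /= !in_itv/= ?andbT.
Qed.

(** The sublevel set is a half-line, and at each of its points the tail of [w] is
at most [V], hence at most [y].  The end point of the half-line, which may be
outside the set, is approached from the right. *)
Lemma integral_sublevel_le y : 0 <= y ->
  (\int[leb]_(s in [set s | (0 < s)%R /\ (V s <= y)%R]) (w s)%:E <= y%:E)%E.
Proof.
move=> y0.
have [[s1 [s10 s1y]]|S0] := pselect (exists s, 0 < s /\ V s <= y); last first.
  rewrite [X in integral _ X _](_ : _ = set0) ?integral_set0 ?lee_fin//.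
  by apply/seteqP; split=> // s sy; apply: S0; exists s.
set S := [set s | _].
have infS : has_inf S.
  split; first by exists s1.
  by exists 0 => x [x0 _]; exact: ltW.
have x00 : 0 <= inf S by apply: lb_le_inf; [exists s1|move=> x [x0 _]; exact: ltW].
apply: (@le_trans _ _ (\int[leb]_(s in `]inf S, +oo[) (w s)%:E)%E).
  apply: ge0_integral_lebD1.
  - exact: sublevel.
  - exact/measurable_EFinP.
  - by move=> x; rewrite lee_fin.
  - move=> x Sx /=; have := ge_inf infS.2 Sx.
    by rewrite in_itv/= andbT le_eqVlt => /orP[/eqP|]; [right|left].
pose F n : set R := `]inf S + n.+1%:R^-1, +oo[%classic.
have Fcup : (`]inf S, +oo[%classic = \bigcup_n F n).
  apply/seteqP; split=> x /=; rewrite in_itv/= andbT.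
  - move=> ix; have xi0 : 0 < x - inf S by rewrite subr_gt0.
    have [n _ nx] := near_infty_natSinv_lt (PosNum xi0).
    exists n => //; rewrite /F/= in_itv/= andbT -ltrBrDl.
    exact: (nx n (leqnn n)).
  - move=> [n _]; rewrite /F/= in_itv/= andbT; apply: lt_trans.
    by rewrite ltrDl.
rewrite Fcup.
apply: ge0_integral_nondecreasing_bigcup_le.
- move=> m n mn x; rewrite /F/= !in_itv/= !andbT.
  apply: le_lt_trans; rewrite lerD2l lef_pV2 ?posrE//.
  by rewrite ler_nat.
- by move=> n; exact: leb_measurable_itv.
- exact: mw.
- exact: w0.
move=> n.
have n0 : (0 : R) < n.+1%:R^-1 by [].
have [s [s0 sy] sn] : exists2 s, S s & s < inf S + n.+1%:R^-1.
  by apply: inf_lt; [exists s1|rewrite ltrDl].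
have xn0 : 0 < inf S + n.+1%:R^-1 by rewrite ltr_wpDl.
apply: (le_trans (tailV xn0)); rewrite lee_fin.
apply: le_trans sy; apply: V_ni; rewrite ?in_itv/= ?andbT//.
exact: ltW.
Qed.

Lemma integral_layer_le (gamma y : R) : 0 <= gamma -> 0 < y ->
  (\int[leb]_(s in [set s | (0 < s)%R /\ (y / 2 < V s <= y)%R])
     (w s * V s `^ (- gamma))%:E <= ((2 `^ gamma) * y `^ (1 - gamma))%:E)%E.
Proof.
move=> g0 y0; set L := [set s | _].
have y20 : 0 < y / 2 by rewrite divr_gt0.
have mL : measurable (L : set lebT).
  rewrite [X in measurable X](_ : _ = [set s | 0 < s /\ V s <= y] `\`
      [set s | 0 < s /\ V s <= y / 2]).
    by apply: measurableD; exact: sublevel.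
  apply/seteqP; split=> s /= => [[s0 /andP[y2 sy]]|[[s0 sy] ny2]].
    by split => // -[_]; rewrite leNgt y2.
  by split => //; rewrite sy andbT ltNge; apply/negP => sy2; apply: ny2.
have mVg r : measurable_fun [set: lebT] (fun s : lebT => V s `^ r).
  exact: (measurableT_comp (measurable_powR r) mV).
have yg0 : 0 <= (y / 2) `^ (- gamma) by exact: powR_ge0.
apply: (@le_trans _ _ (\int[leb]_(s in L) ((y / 2) `^ (- gamma) * w s)%:E)%E).
  apply: ge0_le_integral_EFin.
  - exact: mL.
  - exact: (measurable_funM mw (mVg _)).
  - exact: (measurable_funM (measurable_cst _) mw).
  - by move=> s _; rewrite mulr_ge0 ?powR_ge0.
  - move=> s [s0 /andP[ys sy]]; rewrite mulrC ler_wpM2r//.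
    rewrite !powRN lef_pV2 ?posrE ?powR_gt0 ?V0//.
    by rewrite ge0_ler_powR ?nnegrE// ltW// V0.
rewrite (ge0_integralZl_EFinM leb mL mw yg0 w0).
apply: (@le_trans _ _ (((y / 2) `^ (- gamma))%:E * y%:E)%E).
  apply: lee_wpmul2l; first by rewrite lee_fin powR_ge0.
  apply: le_trans (integral_sublevel_le (ltW y0)).
  apply: ge0_subset_integral_EFin.
  - exact: mL.
  - exact: sublevel.
  - exact: mw.
  - exact: w0.
  - by move=> s [s0 /andP[]].
have y0' := ltW y0.
rewrite -EFinM lee_fin powRM ?invr_ge0// powRB; last first.
  by rewrite (gt_eqF y0) implybT.
rewrite powRr1// !powRN -[2^-1]powR_inv1// powRAC powR_inv1 ?powR_ge0// invrK.
by rewrite -mulrA mulrC mulrA.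
Qed.

(** On the layer of index [i] the integral is at most a multiple of
[(c ^ i * V t) ^ (1 - gamma)], so the layers form a geometric series of ratio
[c ^ (1 - gamma)].  Both [c = 2] with [gamma > 1] and [c = 1/2] with [gamma < 1] make
it converge. *)
Lemma integral_layers_le (gamma c t : R) (D : set R) :
  0 <= gamma -> 0 < c -> c `^ (1 - gamma) < 1 -> 0 < t ->
  measurable (D : set lebT) ->
  (forall s, D s -> 0 < s /\ exists i, c ^+ i * V t / 2 < V s <= c ^+ i * V t) ->
  (\int[leb]_(s in D) (w s * V s `^ (- gamma))%:E <=
    ((2 `^ gamma) / (1 - c `^ (1 - gamma)) * V t `^ (1 - gamma))%:E)%E.
Proof.
move=> g0 c0 r1 t0 mD Dcov; set r := c `^ (1 - gamma).
have r0 : 0 < r by exact: powR_gt0.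
pose F i := [set s | 0 < s /\ c ^+ i * V t / 2 < V s <= c ^+ i * V t].
have ci0 i : 0 < c ^+ i * V t by rewrite mulr_gt0 ?exprn_gt0// V0.
have mF i : measurable (F i : set lebT).
  rewrite [X in measurable X](_ : _ = [set s | 0 < s /\ V s <= c ^+ i * V t] `\`
      [set s | 0 < s /\ V s <= c ^+ i * V t / 2]).
    by apply: measurableD; exact: sublevel.
  apply/seteqP; split=> s /= => [[s0 /andP[y2 sy]]|[[s0 sy] ny2]].
    by split => // -[_]; rewrite leNgt y2.
  by split => //; rewrite sy andbT ltNge; apply/negP => sy2; apply: ny2.
have mwV : measurable_fun [set: lebT] (fun s : lebT => w s * V s `^ (- gamma)).
  exact: (measurable_funM mw (measurableT_comp (measurable_powR _) mV)).
have mwV' : measurable_fun [set: lebT]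
    (fun s : lebT => (w s * V s `^ (- gamma))%:E).
  exact/measurable_EFinP.
have wV0 s : (0 <= (w s * V s `^ (- gamma))%:E)%E.
  by rewrite lee_fin mulr_ge0 ?powR_ge0.
have DF : D `<=` \bigcup_i F i by move=> s /Dcov[s0 [i ?]]; exists i.
apply: le_trans (ge0_integral_cover leb mD mF mwV' wV0 DF) _.
pose K := 2 `^ gamma * V t `^ (1 - gamma).
have K0 : 0 <= K by rewrite mulr_ge0 ?powR_ge0.
have term i : (\int[leb]_(s in F i) (w s * V s `^ (- gamma))%:E <=
    (geometric K r i)%:E)%E.
  apply: (le_trans (integral_layer_le g0 (ci0 i))); rewrite lee_fin.
  have c0' := ltW c0; have V0' := ltW (V0 t0).
  rewrite powRM ?exprn_ge0// -powR_mulrn// -powRrM mulrC.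
  rewrite [i%:R * _]mulrC powRrM powR_mulrn ?powR_ge0//.
  by rewrite le_eqVlt; apply/orP; left; apply/eqP; rewrite /= /K -/r; ring.
apply: (@le_trans _ _ (\sum_(i <oo) (geometric K r i)%:E)%E).
  by apply: lee_nneseries => [i _ _|i _]; [apply: integral_ge0 => s _;
    rewrite lee_fin mulr_ge0 ?powR_ge0|exact: term].
have r1' : `|r| < 1 by rewrite ger0_norm// (ltW r0).
have -> : (fun n => \sum_(0 <= k < n) (geometric K r k)%:E)%E =
    EFin \o series (geometric K r).
  by apply/funext => n; rewrite sumEFin.
rewrite EFin_lim; last exact: is_cvg_geometric_series.
rewrite lee_fin (cvg_lim _ (cvg_geometric_series (a := K) r1'))//.
by rewrite /K mulrAC.
Qed.

Lemma integral_head_powR_le (gamma t : R) : 1 < gamma -> 0 < t ->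
  (\int[leb]_(s in `]0%R, t[) (w s * V s `^ (- gamma))%:E <=
    ((2 `^ gamma) / (1 - 2 `^ (1 - gamma)) * V t `^ (1 - gamma))%:E)%E.
Proof.
move=> g1 t0; apply: integral_layers_le => //.
- lra.
- by apply: powR2_lt1; lra.
- exact: leb_measurable_itv.
move=> s; rewrite /= in_itv/= => /andP[s0 st]; split => //.
apply: dyadic_layer_ge; first exact: V0.
by apply: V_ni; rewrite ?in_itv/= ?andbT// ltW.
Qed.

Lemma integral_tail_powR_le (delta t : R) : 0 <= delta < 1 -> 0 < t ->
  (\int[leb]_(s in `]t, +oo[) (w s * V s `^ (- delta))%:E <=
    ((2 `^ delta) / (1 - 2^-1 `^ (1 - delta)) * V t `^ (1 - delta))%:E)%E.
Proof.
move=> /andP[d0 d1] t0; apply: integral_layers_le => //.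
- by apply: powRhalf_lt1; lra.
- exact: leb_measurable_itv.
move=> s; rewrite /= in_itv/= andbT => ts; split; first exact: lt_trans ts.
have s0 := lt_trans t0 ts.
apply: dyadic_layer_le; first exact: V0.
by apply: V_ni; rewrite ?in_itv/= ?andbT// ltW.
Qed.

End layers.

End lebesgue.

(** * Tails and heads of power functions *)

Section hardy.
Context (R : realType).
Local Notation leb := (@completed_lebesgue_measure R).
Local Notation lebT := (caratheodory_type (@wlength R idfun)^*%mu).

Lemma powR_mul (x a b : R) : 0 < x -> x `^ a * x `^ b = x `^ (a + b).
Proof. by move=> x0; rewrite powRD// (gt_eqF x0) implybT. Qed.

Lemma measurable_patch_pos (f : R -> R) :
  measurable_fun (`]0, +oo[%classic : set lebT) (f : lebT -> R) ->
  measurable_fun [set: lebT] (fun t : lebT => if 0 < t then f t else 0 : R).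
Proof.
move=> mf.
have m0 : measurable (`]0, +oo[%classic : set lebT) by exact: leb_measurable_itv.
rewrite (_ : (fun t => _) = f \_ `]0, +oo[%classic).
  exact: (iffLR (measurable_restrictT _ m0)).
apply/funext => t; rewrite patchE.
have [t0|t0] := ltP 0 t.
  by rewrite mem_set//= in_itv/= t0.
by rewrite memNset//= in_itv/= andbT ltNge t0.
Qed.

Lemma measurable_id_lebT : measurable_fun [set: lebT] (fun t : lebT => t : R).
Proof. by apply: leb_measurable_fun; exact: measurable_id. Qed.

Lemma measurable_powR_lebT (r : R) :
  measurable_fun [set: lebT] (fun t : lebT => (t : R) `^ r).
Proof. by apply: leb_measurable_fun; exact: measurable_powR. Qed.

(** Computed on the dyadic intervals [(2 ^ i * x / 2, 2 ^ i * x]].  This one power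
serves as the density from which the other powers are obtained by
[integral_tail_powR_le] and [integral_head_powR_le]. *)
Lemma integral_inv_sqr_tail_le (x : R) : 0 < x ->
  (\int[leb]_(s in `]x, +oo[) (if 0 < s then s `^ (-2) else 0)%:E <=
   (4 / x)%:E)%E.
Proof.
move=> x0.
pose f s : R := if 0 < s then s `^ (-2) else 0.
have mf : measurable_fun [set: lebT] (f : lebT -> R).
  by apply: measurable_patch_pos; apply: measurable_funTS;
    exact: measurable_powR_lebT.
have mf' : measurable_fun [set: lebT] (fun s : lebT => (f s)%:E).
  exact/measurable_EFinP.
have f0 s : 0 <= f s by rewrite /f; case: ifP => // _; exact: powR_ge0.
have f0' s : (0 <= (f s)%:E)%E by rewrite lee_fin.
pose F i : set R := `]2 ^+ i * x / 2, 2 ^+ i * x]%classic.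
have mF i : measurable (F i : set lebT) by exact: leb_measurable_itv.
have mD : measurable (`]x, +oo[%classic : set lebT) by exact: leb_measurable_itv.
have DF : `]x, +oo[%classic `<=` \bigcup_i F i.
  move=> s; rewrite /= in_itv/= andbT => xs.
  by have [i ?] := dyadic_layer_ge x0 (ltW xs); exists i => //; rewrite /F/= in_itv.
apply: (le_trans (ge0_integral_cover leb mD mF mf' f0' DF)).
have h1 : `|2^-1 : R| < 1 by rewrite ger0_norm ?invr_ge0// invf_lt1// ltr1n.
have term i : (\int[leb]_(s in F i) (f s)%:E <=
    (geometric (2 / x) 2^-1 i)%:E)%E.
  pose y : R := 2 ^+ i * x / 2.
  have y0 : 0 < y by rewrite /y divr_gt0// mulr_gt0// exprn_gt0.
  apply: (@le_trans _ _ (\int[leb]_(s in F i) (y ^- 2)%:E)%E).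
    apply: ge0_le_integral_EFin.
    - exact: mF.
    - exact: mf.
    - exact: measurable_cst.
    - by move=> s _; exact: f0.
    - move=> s; rewrite /F/= in_itv/= -/y => /andP[ys _].
      have s0 : 0 < s by exact: lt_trans ys.
      rewrite /f s0 powR_invn ?(ltW s0)// lef_pV2 ?posrE ?exprn_gt0//.
      by rewrite lerXn2r ?nnegrE// ltW.
  rewrite integral_cst; last exact: mF.
  rewrite [X in (_ * X <= _)%E](_ : _ = y%:E); last first.
    transitivity (lebesgue_measure (F i)); first reflexivity.
    rewrite lebesgue_measure_itv/= lte_fin -/y.
    have -> : 2 ^+ i * x = y + y by rewrite /y -splitr.
    by rewrite ltrDl y0 -EFinB addrK.
  rewrite -EFinM lee_fin /=.
  have -> : y = 2 ^+ i * (x / 2) by rewrite /y mulrA.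
  have i0 : (2 : R) ^+ i != 0 by rewrite expf_neq0.
  have xn0 : x != 0 by rewrite gt_eqF.
  rewrite le_eqVlt; apply/orP; left; apply/eqP; rewrite exprVn.
  by field; rewrite xn0 i0.
apply: (@le_trans _ _ (\sum_(i <oo) (geometric (2 / x) 2^-1 i)%:E)%E).
  apply: lee_nneseries => [i _ _|i _]; last exact: term.
  by apply: integral_ge0 => s _.
have -> : (fun n => \sum_(0 <= k < n) (geometric (2 / x) 2^-1 k)%:E)%E =
    EFin \o series (geometric (2 / x) 2^-1).
  by apply/funext => n; rewrite sumEFin.
rewrite EFin_lim; last exact: is_cvg_geometric_series.
rewrite lee_fin (cvg_lim _ (cvg_geometric_series (a := 2 / x) h1))//.
by rewrite le_eqVlt; apply/orP; left; apply/eqP; field; rewrite gt_eqF//=; lra.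
Qed.

Let w2 (s : R) : R := if 0 < s then s `^ (-2) else 0.
(* The factor 4 is the constant of the tail estimate just proved. *)
Let V2 (s : R) : R := if 0 < s then 4 * s `^ (-1) else 0.

Let mw2 : measurable_fun [set: lebT] (w2 : lebT -> R).
Proof.
by apply: measurable_patch_pos; apply: measurable_funTS;
  exact: measurable_powR_lebT.
Qed.

Let w20 s : 0 <= w2 s.
Proof. by rewrite /w2; case: ifP => // _; exact: powR_ge0. Qed.

Let mV2 : measurable_fun [set: lebT] (V2 : lebT -> R).
Proof.
apply: measurable_patch_pos; apply: measurable_funTS.
exact: (measurable_funM (measurable_cst _) (measurable_powR_lebT _)).
Qed.

Let V20 s : 0 < s -> 0 < V2 s.
Proof. by move=> s0; rewrite /V2 s0 mulr_gt0// powR_gt0. Qed.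

Let V2_ni : {in `]0, +oo[ &, {homo V2 : x y /~ x <= y}}.
Proof.
move=> x y; rewrite !in_itv/= !andbT => x0 y0 xy; rewrite /V2 x0 y0.
have x0' := ltW x0; have y0' := ltW y0.
by rewrite ler_pM2l// !powR_inv1// lef_pV2 ?posrE.
Qed.

Let tailV2 x : 0 < x -> (\int[leb]_(s in `]x, +oo[) (w2 s)%:E <= (V2 x)%:E)%E.
Proof.
move=> x0; have x0' := ltW x0; rewrite /V2 x0 powR_inv1//.
exact: integral_inv_sqr_tail_le.
Qed.

Let wV2 g s : 0 < s ->
  w2 s * V2 s `^ (- g) = 4 `^ (- g) * s `^ (g - 2).
Proof.
move=> s0; rewrite /w2 /V2 s0 powRM ?powR_ge0// -powRrM mulN1r opprK.
by rewrite mulrCA powR_mul// addrC.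
Qed.

Lemma integral_powR_tail_le : exists2 c : R, 0 < c & forall x, 0 < x ->
  (\int[leb]_(s in `]x, +oo[) (s `^ (- (3 / 2)))%:E <=
   (c * x `^ (- 2^-1))%:E)%E.
Proof.
pose K : R := 2 `^ 2^-1 / (1 - 2^-1 `^ (1 - 2^-1)).
exists (4 `^ 2^-1 * (K * 4 `^ 2^-1)).
  by rewrite !mulr_gt0 ?powR_gt0// invr_gt0 subr_gt0 powRhalf_lt1//; lra.
move=> x x0.
have h01 : 0 <= (2^-1 : R) < 1 by rewrite invr_ge0// ler0n/= invf_lt1// ltr1n.
have := integral_tail_powR_le mw2 w20 mV2 V20 V2_ni tailV2 h01 x0.
rewrite -/K => h.
have mD : measurable (`]x, +oo[%classic : set lebT) by exact: leb_measurable_itv.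
rewrite (eq_integral (fun s : lebT => (4 `^ 2^-1 * (w2 s * V2 s `^ (- 2^-1)))%:E)); last first.
  move=> s; rewrite inE/= in_itv/= andbT => xs; congr EFin.
  rewrite wV2; last exact: lt_trans xs.
  rewrite mulrA powR_mul// subrr powRr0 mul1r; congr (_ `^ _); lra.
have mm : measurable_fun [set: lebT] (fun s : lebT => w2 s * V2 s `^ (- 2^-1)).
  exact: (measurable_funM mw2 (measurableT_comp (measurable_powR _) mV2)).
have c0 : 0 <= (4 : R) `^ 2^-1 by exact: powR_ge0.
have m0 s : 0 <= w2 s * V2 s `^ (- 2^-1) by rewrite mulr_ge0 ?powR_ge0.
rewrite (ge0_integralZl_EFinM leb mD mm c0 m0) -mulrA EFinM.
apply: lee_wpmul2l; first by rewrite lee_fin.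
apply: (le_trans h); rewrite lee_fin -mulrA ler_wpM2l//.
  by rewrite divr_ge0 ?powR_ge0// subr_ge0 ltW// powRhalf_lt1//; lra.
rewrite /V2 x0 powRM ?powR_ge0// -powRrM.
have -> : 1 - 2^-1 = 2^-1 :> R by lra.
by rewrite mulN1r.
Qed.

Lemma integral_powR_head_le : exists2 c : R, 0 < c & forall x, 0 < x ->
  (\int[leb]_(s in `]0%R, x[) (s `^ (- 2^-1))%:E <= (c * x `^ 2^-1)%:E)%E.
Proof.
pose g : R := 3 / 2.
pose K : R := 2 `^ g / (1 - 2 `^ (1 - g)).
have K0 : 0 < K.
  by rewrite divr_gt0 ?powR_gt0// subr_gt0 powR2_lt1// /g; lra.
exists (4 `^ g * (K * 4 `^ (- 2^-1))).
  apply: mulr_gt0; first exact: powR_gt0.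
  by apply: mulr_gt0 => //; exact: powR_gt0.
move=> x x0.
have g1 : 1 < g by rewrite /g; lra.
have := integral_head_powR_le mw2 w20 mV2 V20 V2_ni tailV2 g1 x0.
rewrite -/K => h.
have mD : measurable (`]0, x[%classic : set lebT) by exact: leb_measurable_itv.
rewrite (eq_integral (fun s : lebT => (4 `^ g * (w2 s * V2 s `^ (- g)))%:E)); last first.
  move=> s; rewrite inE/= in_itv/= => /andP[s0 _]; congr EFin.
  rewrite wV2//.
  rewrite mulrA powR_mul// subrr powRr0 mul1r; congr (_ `^ _); rewrite /g; lra.
have mm : measurable_fun [set: lebT] (fun s : lebT => w2 s * V2 s `^ (- g)).
  exact: (measurable_funM mw2 (measurableT_comp (measurable_powR _) mV2)).
have c0 : 0 <= (4 : R) `^ g by exact: powR_ge0.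
have m0 s : 0 <= w2 s * V2 s `^ (- g) by rewrite mulr_ge0 ?powR_ge0.
rewrite (ge0_integralZl_EFinM leb mD mm c0 m0) -mulrA EFinM.
apply: lee_wpmul2l; first by rewrite lee_fin.
apply: (le_trans h); rewrite lee_fin -mulrA ler_pM2l//.
rewrite /V2 x0 powRM ?powR_ge0// -powRrM.
have -> : 1 - g = - 2^-1 :> R by rewrite /g; lra.
by rewrite mulrNN mul1r.
Qed.

End hardy.

(** * Two Hardy inequalities *)

Section half_line.
Context (R : realType).
Local Notation leb := (@completed_lebesgue_measure R).
Local Notation lebT := (caratheodory_type (@wlength R idfun)^*%mu).
Local Notation pos := (`]0, +oo[%classic : set lebT).

Let patch0 (f : R -> R) (t : R) : R := if 0 < t then f t else 0.

Let patch0_ge0 f : (forall t, 0 < t -> 0 <= f t) -> forall t, 0 <= patch0 f t.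
Proof. by move=> f0 t; rewrite /patch0; case: ifPn => // /f0. Qed.

Let mpatch0 f : measurable_fun pos (f : lebT -> R) ->
  measurable_fun [set: lebT] (patch0 f : lebT -> R).
Proof. exact: measurable_patch_pos. Qed.

(** The Schur test for the kernel [r t s * rho s] on the half-line; the relation
[r] is [s < t] for Hardy's inequality and [t < s] for the dual one. *)
Lemma schur_test_half_line (q : R) (r : R -> R -> bool)
    (a kappa rho lambda g : R -> R) : 1 <= q ->
  measurable_fun [set: lebT * lebT] (fun z : lebT * lebT => r z.1 z.2) ->
  measurable_fun pos (a : lebT -> R) -> measurable_fun pos (kappa : lebT -> R) ->
  measurable_fun pos (rho : lebT -> R) -> measurable_fun pos (g : lebT -> R) ->
  measurable_fun pos (lambda : lebT -> R) ->
  (forall t, 0 < t -> 0 <= a t) -> (forall t, 0 < t -> 0 <= rho t) ->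
  (forall t, 0 < t -> 0 <= g t) ->
  (forall t, 0 < t ->
    (\int[leb]_(s in [set s | (0 < s)%R && r t s]) (rho s)%:E <=
      (kappa t)%:E)%E) ->
  (forall s, 0 < s ->
    (\int[leb]_(t in [set t | (0 < t)%R && r t s])
       (a t * kappa t `^ (q - 1))%:E <= (lambda s)%:E)%E) ->
  (\int[leb]_(t in `]0%R, +oo[) ((a t)%:E *
     (\int[leb]_(s in [set s | (0 < s)%R && r t s]) (rho s * g s)%:E) `^ q) <=
   \int[leb]_(s in `]0%R, +oo[) (lambda s * rho s * g s `^ q)%:E)%E.
Proof.
move=> q1 mr ma mk mrho mg ml a0 rho0 g0 hk hl.
have mpos : measurable pos by exact: leb_measurable_itv.
have m1 : measurable_fun [set: lebT * lebT] (fun z : lebT * lebT => (z.1 : R)).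
  exact: (measurableT_comp (@measurable_id_lebT R) measurable_fst).
have m2 : measurable_fun [set: lebT * lebT] (fun z : lebT * lebT => (z.2 : R)).
  exact: (measurableT_comp (@measurable_id_lebT R) measurable_snd).
pose k (z : lebT * lebT) : R :=
  if [&& (0 : R) < z.1, (0 : R) < z.2 & r z.1 z.2] then patch0 rho z.2 else 0.
have mk' : measurable_fun [set: lebT * lebT] k.
  apply: measurable_fun_ifT.
  - apply: measurable_and; first exact: measurable_fun_ltr.
    apply: measurable_and; last exact: mr.
    exact: measurable_fun_ltr.
  - exact: (measurableT_comp (mpatch0 mrho) measurable_snd).
  - exact: measurable_cst.
have k0 z : 0 <= k z by rewrite /k; case: ifP => // _; exact: patch0_ge0.
have pE (f : R -> \bar R) (P : R -> bool) :
    (\int[leb]_(s in [set s | (0 < s)%R && P s]) f s =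
     \int[leb]_s (if ((0 : R) < (s : R))%R && P s then f s else 0))%E.
  rewrite integral_mkcond; apply: eq_integral => s _; rewrite patchE.
  case: ifPn => [|/negP] sP; rewrite inE/= in sP; first by rewrite sP.
  by case: ifPn.
have posE (f : R -> \bar R) : (\int[leb]_(s in `]0%R, +oo[) f s =
     \int[leb]_s (if ((0 : R) < (s : R))%R then f s else 0))%E.
  rewrite integral_mkcond; apply: eq_integral => s _; rewrite patchE.
  case: ifPn => [|/negP] sP; rewrite inE/= in_itv/= andbT in sP.
    by rewrite sP.
  by case: ifPn.
have ml' : measurable_fun [set: lebT]
    (patch0 (fun s => lambda s * rho s) : lebT -> R).
  by apply: mpatch0; exact: measurable_funM.
have := @schur_test _ lebT R leb q k (patch0 a) (patch0 kappa)
  (patch0 (fun s => lambda s * rho s)) (patch0 g) q1 mk' (mpatch0 ma)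
  (mpatch0 mk) (mpatch0 mg) ml' k0 (patch0_ge0 a0) (patch0_ge0 g0).
move=> H.
rewrite posE (posE (fun s => (lambda s * rho s * g s `^ q)%:E)).
have inner t : 0 < t -> (\int[leb]_s (k (t, s) * patch0 g s)%:E =
    \int[leb]_(s in [set s | (0 < s)%R && r t s]) (rho s * g s)%:E)%E.
  move=> t0; rewrite (pE (fun s => (rho s * g s)%:E) (r t)).
  apply: eq_integral => s _; rewrite /k /patch0/= t0/=.
  by case: ifPn => [/andP[-> _]//|_]; rewrite mul0r.
rewrite [leLHS](_ : _ = \int[leb]_t ((patch0 a t)%:E *
    (\int[leb]_s (k (t, s) * patch0 g s)%:E) `^ q))%E; last first.
  apply: eq_integral => t _; rewrite {1}/patch0; case: ifPn => t0.
    by rewrite inner.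
  by rewrite mul0e.
rewrite [leRHS](_ : _ = \int[leb]_s (patch0 (fun s => lambda s * rho s) s *
    patch0 g s `^ q)%:E)%E; last first.
  apply: eq_integral => s _; rewrite /patch0; case: ifPn => s0 //.
  by rewrite mul0r.
apply: H.
- move=> t; rewrite /patch0; case: ifPn => [t0 _|]; last by rewrite eqxx.
  apply: le_trans (hk t t0); rewrite (pE (fun s => (rho s)%:E) (r t)).
  rewrite le_eqVlt; apply/orP; left; apply/eqP.
  apply: eq_integral => s _; rewrite /k /patch0/= t0/=.
  by case: ifPn => [/andP[-> _]|].
- move=> s; rewrite {1}/patch0; case: ifPn => [s0 _|]; last by rewrite eqxx.
  have mrs : measurable_fun [set: lebT] (fun t : lebT => r t s).
    exact: (measurableT_comp mr (pair2_measurable s)).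
  pose ak (t : lebT) : R :=
    if r t s then patch0 (fun t => a t * kappa t `^ (q - 1)) t else 0.
  have mak : measurable_fun [set: lebT] ak.
    apply: measurable_fun_ifT; [exact: mrs| |exact: measurable_cst].
    apply: mpatch0.
    exact: (measurable_funM ma (measurableT_comp (measurable_powR _) mk)).
  have ak0 t : 0 <= ak t.
    rewrite /ak; case: ifP => // _; apply: patch0_ge0 => u u0.
    by rewrite mulr_ge0 ?powR_ge0 ?a0.
  rewrite [leLHS](_ : _ = \int[leb]_t (rho s * ak t)%:E)%E; last first.
    apply: eq_integral => t _; rewrite /k /ak /patch0/= s0/=.
    case: ifPn => t0 /=; last by rewrite !mul0r if_same mulr0.
    by case: (r t s) => //=; rewrite ?mulr0// mulrC.
  rewrite /patch0 s0 mulrC.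
  rewrite (ge0_integralZl_EFinM leb measurableT mak (rho0 s s0) ak0).
  rewrite [leRHS]EFinM; apply: lee_wpmul2l; first by rewrite lee_fin rho0.
  apply: le_trans (hl s s0).
  rewrite (pE (fun t => (a t * kappa t `^ (q - 1))%:E) (r^~ s)).
  rewrite le_eqVlt; apply/orP; left; apply/eqP.
  apply: eq_integral => t _ /=; rewrite /ak /patch0.
  by case: (r t s); rewrite ?andbF// andbT; case: ifP.
Qed.

Lemma set_gt0_lt (t : R) : [set s | (0 < s) && (s < t)] = `]0, t[%classic.
Proof. by apply/seteqP; split=> s; rewrite /= in_itv. Qed.

Lemma set_gt0_gt (t : R) : 0 < t ->
  [set s | (0 < s) && (t < s)] = `]t, +oo[%classic.
Proof.
move=> t0; apply/seteqP; split=> s; rewrite /= in_itv/= andbT.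
  by case/andP.
by move=> ts; rewrite ts (lt_trans t0 ts).
Qed.

Let mlt : measurable_fun [set: lebT * lebT]
  (fun z : lebT * lebT => (z.1 : R) < (z.2 : R)).
Proof.
apply: measurable_fun_ltr.
- exact: (measurableT_comp (@measurable_id_lebT R) measurable_fst).
- exact: (measurableT_comp (@measurable_id_lebT R) measurable_snd).
Qed.

Let mgt : measurable_fun [set: lebT * lebT]
  (fun z : lebT * lebT => (z.2 : R) < (z.1 : R)).
Proof.
apply: measurable_fun_ltr.
- exact: (measurableT_comp (@measurable_id_lebT R) measurable_snd).
- exact: (measurableT_comp (@measurable_id_lebT R) measurable_fst).
Qed.

(** Schur test with [rho = w * V ^ (- gamma)] for an exponent [gamma > 1]: its
integral up to [t] is at most a multiple of [V t ^ (1 - gamma)].  The second condition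
then concerns the tail of [w * V ^ (- delta)] with [delta = (gamma - 1) * (q - 1)],
for which [delta < 1] is needed. *)
Lemma weighted_hardy (w V : R -> R) (q : R) : 1 <= q ->
  measurable_fun [set: lebT] (w : lebT -> R) -> (forall x, 0 <= w x) ->
  (forall x, 0 < x -> 0 < w x) ->
  measurable_fun [set: lebT] (V : lebT -> R) -> (forall x, 0 < x -> 0 < V x) ->
  {in `]0, +oo[ &, {homo V : x y /~ x <= y}} ->
  (forall x, 0 < x -> (\int[leb]_(s in `]x, +oo[) (w s)%:E <= (V x)%:E)%E) ->
  exists2 c : R, 0 < c & forall h : R -> R,
    measurable_fun pos (h : lebT -> R) -> (forall s, 0 < s -> 0 <= h s) ->
    (\int[leb]_(t in `]0%R, +oo[)
       ((w t)%:E * (\int[leb]_(s in `]0%R, t[) (h s)%:E) `^ q) <=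
     c%:E * \int[leb]_(s in `]0%R, +oo[)
       (V s `^ q * w s `^ (1 - q) * h s `^ q)%:E)%E.
Proof.
move=> q1 mw w0 wp mV V0 Vni tail.
have q0 : 0 < q by lra.
(* Any positive excess of [gam] over 1 smaller than [1 / (q - 1)] would do. *)
pose gam : R := 1 + (2 * q)^-1.
have q2 : 0 < (2 * q)^-1 by rewrite invr_gt0 mulr_gt0.
have gam1 : 1 < gam by rewrite /gam ltrDl.
pose delta : R := (gam - 1) * (q - 1).
have delta01 : 0 <= delta < 1.
  rewrite /delta /gam addrAC subrr add0r; apply/andP; split.
    by rewrite mulr_ge0// ?(ltW q2)//; lra.
  by rewrite mulrC ltr_pdivrMr ?mulr_gt0//; lra.
pose C1 : R := 2 `^ gam / (1 - 2 `^ (1 - gam)).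
pose C2 : R := 2 `^ delta / (1 - 2^-1 `^ (1 - delta)).
have C10 : 0 < C1.
  by rewrite divr_gt0 ?powR_gt0// subr_gt0 powR2_lt1//; lra.
have C20 : 0 < C2.
  by rewrite divr_gt0 ?powR_gt0// subr_gt0 powRhalf_lt1//; lra.
have gq : (1 - gam) * (q - 1) = - delta by rewrite /delta; ring.
have q1C : 0 < C1 `^ (q - 1) by exact: powR_gt0.
exists (C1 `^ (q - 1) * C2); first exact: mulr_gt0.
move=> h mh h0.
have mpos : measurable pos by exact: leb_measurable_itv.
have mVr r : measurable_fun [set: lebT] (fun s : lebT => V s `^ r).
  exact: (measurableT_comp (measurable_powR r) mV).
have mwr r : measurable_fun [set: lebT] (fun s : lebT => w s `^ r).
  exact: (measurableT_comp (measurable_powR r) mw).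
have mV' r : measurable_fun pos (fun s : lebT => V s `^ r).
  exact: measurable_funTS.
have mw' r : measurable_fun pos (fun s : lebT => w s `^ r).
  exact: measurable_funTS.
have mw1 : measurable_fun pos (w : lebT -> R) by exact: measurable_funTS.
have := @schur_test_half_line q (fun t s => s < t) w
  (fun t => C1 * V t `^ (1 - gam)) (fun s => w s * V s `^ (- gam))
  (fun s => C1 `^ (q - 1) * (C2 * V s `^ (1 - delta)))
  (fun s => h s * V s `^ gam * w s `^ (-1)) q1 mgt mw1
  (measurable_funM (measurable_cst C1) (mV' _))
  (measurable_funM mw1 (mV' _))
  (measurable_funM (measurable_funM mh (mV' _)) (mw' _))
  (measurable_funM (measurable_cst _)
    (measurable_funM (measurable_cst C2) (mV' _))).
move=> H.
have rg s : 0 < s ->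
    w s * V s `^ (- gam) * (h s * V s `^ gam * w s `^ (-1)) = h s.
  move=> s0; have ws := wp s s0; have Vs := V0 s s0.
  rewrite powRN powR_inv1//; field.
  by rewrite (gt_eqF ws) gt_eqF// powR_gt0.
rewrite [leLHS](_ : _ = \int[leb]_(t in `]0%R, +oo[) ((w t)%:E *
    (\int[leb]_(s in [set s | (0 < s)%R && (s < t)%R])
      (w s * V s `^ (- gam) * (h s * V s `^ gam * w s `^ (-1)))%:E) `^ q))%E;
    last first.
  apply: eq_integral => t _; rewrite set_gt0_lt; congr (_ * _ `^ _)%E.
  apply: eq_integral => s; rewrite inE/= in_itv/= => /andP[s0 _].
  by rewrite rg.
have cR0 : 0 <= C1 `^ (q - 1) * C2 by rewrite mulr_ge0// ltW.
rewrite [leRHS](_ : _ = \int[leb]_(s in `]0%R, +oo[)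
    (C1 `^ (q - 1) * (C2 * V s `^ (1 - delta)) * (w s * V s `^ (- gam)) *
     (h s * V s `^ gam * w s `^ (-1)) `^ q)%:E)%E; last first.
  have mF : measurable_fun pos (fun s : lebT =>
      (V s `^ q * w s `^ (1 - q) * h s `^ q)%:E).
    apply/measurable_EFinP.
    exact: (measurable_funM (measurable_funM (mV' _) (mw' _))
      (measurableT_comp (measurable_powR q) mh)).
  have F0 (s : lebT) : pos s ->
      (0%R <= (V s `^ q * w s `^ (1 - q) * h s `^ q)%:E)%E.
    by move=> _; rewrite lee_fin !mulr_ge0 ?powR_ge0.
  have cR0' : (0%R <= (C1 `^ (q - 1) * C2)%:E)%E by rewrite lee_fin.
  rewrite -(ge0_integralZl leb mpos mF F0 cR0').
  apply: eq_integral => s; rewrite inE/= in_itv/= andbT => s0.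
  have ws := wp s s0; have Vs := V0 s s0.
  rewrite -EFinM; congr EFin.
  have hs := h0 s s0.
  have -> : (h s * V s `^ gam * w s `^ (-1)) `^ q =
      h s `^ q * V s `^ (gam * q) * w s `^ (-1 * q).
    rewrite (powRrM (V s)) (powRrM (w s)) -powRM ?powR_ge0//.
    by rewrite -powRM// ?mulr_ge0// ?powR_ge0.
  have -> : V s `^ q = V s `^ (1 - delta) * V s `^ (- gam) * V s `^ (gam * q).
    by rewrite !powR_mul//; congr (_ `^ _); rewrite /delta; ring.
  have -> : w s `^ (1 - q) = w s * w s `^ (-1 * q).
    by rewrite -{2}[w s]powRr1 ?(ltW ws)// powR_mul//; congr (_ `^ _); ring.
  by ring.
apply: H.
- by move=> t _; exact: w0.
- by move=> t t0; rewrite mulr_ge0 ?powR_ge0.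
- by move=> t t0; rewrite !mulr_ge0 ?powR_ge0 ?h0.
- move=> t t0; rewrite set_gt0_lt.
  exact: integral_head_powR_le.
- move=> s s0; rewrite set_gt0_gt//.
  have ms : measurable (`]s, +oo[%classic : set lebT).
    exact: leb_measurable_itv.
  rewrite (eq_integral (fun t : lebT =>
      (C1 `^ (q - 1) * (w t * V t `^ (- delta)))%:E)); last first.
    move=> t; rewrite inE/= in_itv/= andbT => st.
    have t0 : 0 < t by exact: lt_trans st.
    rewrite powRM ?powR_ge0 ?(ltW C10)// -powRrM gq; congr EFin.
    by rewrite mulrCA.
  have mm : measurable_fun [set: lebT] (fun t : lebT => w t * V t `^ (- delta)).
    exact: (measurable_funM mw (mVr _)).
  have m0 t : 0 <= w t * V t `^ (- delta) by rewrite mulr_ge0 ?powR_ge0.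
  rewrite (ge0_integralZl_EFinM leb ms mm (ltW q1C) m0).
  rewrite [leRHS]EFinM; apply: lee_wpmul2l; first by rewrite lee_fin ltW.
  exact: integral_tail_powR_le.
Qed.

(** Schur test with [rho s = s ^ (- 3/2)].  The power left over in the second
condition is [t ^ (- 1/2)] times the q-th power of [t ^ (1/2) * b t], and the latter is
at most a multiple of its value at [s]. *)
Lemma dual_hardy (b : R -> R) (q m : R) : 1 <= q -> 0 < m ->
  measurable_fun pos (b : lebT -> R) -> (forall x, 0 < x -> 0 < b x) ->
  (forall s t, 0 < s -> s <= t -> s `^ 2^-1 * b s <= m * (t `^ 2^-1 * b t)) ->
  exists2 c : R, 0 < c & forall j : R -> R,
    measurable_fun pos (j : lebT -> R) -> (forall s, 0 < s -> 0 <= j s) ->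
    (\int[leb]_(t in `]0%R, +oo[) ((t `^ (q - 1) * b t `^ q)%:E *
       (\int[leb]_(s in `]t, +oo[) (s `^ (-2) * j s)%:E) `^ q) <=
     c%:E * \int[leb]_(s in `]0%R, +oo[) (s^-1 * b s `^ q * j s `^ q)%:E)%E.
Proof.
move=> q1 m0 mb b0 qm.
have q0 : 0 < q by lra.
have [c1 c10 hc1] := integral_powR_tail_le R.
have [c2 c20 hc2] := integral_powR_head_le R.
have q1C : 0 < c1 `^ (q - 1) by exact: powR_gt0.
have mqC : 0 < m `^ q by exact: powR_gt0.
pose c := c1 `^ (q - 1) * m `^ q * c2.
have c0 : 0 < c by rewrite !mulr_gt0.
exists c => // j mj j0.
have mpos : measurable pos by exact: leb_measurable_itv.
have mt r : measurable_fun pos (fun s : lebT => (s : R) `^ r).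
  by apply: measurable_funTS; exact: measurable_powR_lebT.
have mbr r : measurable_fun pos (fun s : lebT => b s `^ r).
  exact: (measurableT_comp (measurable_powR r) mb).
have := @schur_test_half_line q (fun t s => t < s)
  (fun t => t `^ (q - 1) * b t `^ q)
  (fun t => c1 * t `^ (- 2^-1)) (fun s => s `^ (- (3 / 2)))
  (fun s => c * (s `^ ((q + 1) / 2) * b s `^ q))
  (fun s => s `^ (- 2^-1) * j s) q1 mlt
  (measurable_funM (mt _) (mbr _))
  (measurable_funM (measurable_cst c1) (mt _)) (mt _)
  (measurable_funM (mt _) mj)
  (measurable_funM (measurable_cst c) (measurable_funM (mt _) (mbr _))).
move=> H.
rewrite [leLHS](_ : _ = \int[leb]_(t in `]0%R, +oo[)
    ((t `^ (q - 1) * b t `^ q)%:E *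
    (\int[leb]_(s in [set s | (0 < s)%R && (t < s)%R])
      (s `^ (- (3 / 2)) * (s `^ (- 2^-1) * j s))%:E) `^ q))%E; last first.
  apply: eq_integral => t; rewrite inE/= in_itv/= andbT => t0.
  rewrite set_gt0_gt//; congr (_ * _ `^ _)%E.
  apply: eq_integral => s; rewrite inE/= in_itv/= andbT => ts.
  rewrite mulrA powR_mul; last exact: lt_trans ts.
  by congr (_ `^ _ * _)%:E; lra.
rewrite [leRHS](_ : _ = \int[leb]_(s in `]0%R, +oo[)
    (c * (s `^ ((q + 1) / 2) * b s `^ q) * s `^ (- (3 / 2)) *
     (s `^ (- 2^-1) * j s) `^ q)%:E)%E; last first.
  have mF : measurable_fun pos (fun s : lebT =>
      ((s : R)^-1 * b s `^ q * j s `^ q)%:E).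
    apply/measurable_EFinP.
    apply: (eq_measurable_fun (fun s : lebT =>
        (s : R) `^ (-1) * b s `^ q * j s `^ q)).
      move=> s; rewrite inE/= in_itv/= andbT => s0.
      by rewrite powR_inv1// ltW.
    exact: (measurable_funM (measurable_funM (mt _) (mbr _))
      (measurableT_comp (measurable_powR q) mj)).
  have F0 (s : lebT) : pos s ->
      (0%R <= ((s : R)^-1 * b s `^ q * j s `^ q)%:E)%E.
    rewrite /= in_itv/= andbT => s0.
    by rewrite lee_fin !mulr_ge0 ?powR_ge0// invr_ge0 ltW.
  have c0' : (0%R <= c%:E)%E by rewrite lee_fin ltW.
  rewrite -(ge0_integralZl leb mpos mF F0 c0').
  apply: eq_integral => s; rewrite inE/= in_itv/= andbT => s0.
  rewrite -EFinM; congr EFin.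
  rewrite [(_ * j s) `^ q]powRM ?powR_ge0 ?j0// -powRrM.
  have -> : s^-1 = s `^ ((q + 1) / 2) * s `^ (- (3 / 2)) * s `^ (- 2^-1 * q).
    by rewrite !powR_mul// -powR_inv1 ?(ltW s0)//; congr (_ `^ _); lra.
  by ring.
apply: H.
- by move=> t t0; rewrite mulr_ge0 ?powR_ge0.
- by move=> t t0; rewrite powR_ge0.
- by move=> t t0; rewrite mulr_ge0 ?powR_ge0 ?j0.
- by move=> t t0; rewrite set_gt0_gt//; exact: hc1.
- move=> s s0; rewrite set_gt0_lt.
  have ms : measurable (`]0, s[%classic : set lebT).
    exact: leb_measurable_itv.
  pose K := c1 `^ (q - 1) * (m `^ q * (s `^ (q / 2) * b s `^ q)).
  have K0 : 0 <= K by rewrite /K !mulr_ge0 ?powR_ge0.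
  apply: (@le_trans _ _ (\int[leb]_(t in `]0%R, s[) (K * t `^ (- 2^-1))%:E)%E).
    apply: ge0_le_integral.
    - exact: ms.
    - move=> t; rewrite /= in_itv/= => /andP[t0 _].
      by rewrite lee_fin !mulr_ge0 ?powR_ge0.
    - have sub : (`]0, s[%classic `<=` pos)%classic.
        by move=> t; rewrite /= !in_itv/= andbT => /andP[].
      apply/measurable_EFinP; apply: (measurable_funS mpos sub).
      apply: (measurable_funM (measurable_funM (mt _) (mbr _))).
      exact: (measurableT_comp (measurable_powR _)
        (measurable_funM (measurable_cst c1) (mt _))).
    - apply/measurable_EFinP; apply: measurable_funTS.
      exact: (measurable_funM (measurable_cst K) (measurable_powR_lebT _)).
    - move=> t; rewrite /= in_itv/= => /andP[t0 ts]; rewrite lee_fin.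
      have tb : t `^ (q / 2) * b t `^ q <= m `^ q * (s `^ (q / 2) * b s `^ q).
        have pw u : 0 < u -> u `^ (q / 2) * b u `^ q = (u `^ 2^-1 * b u) `^ q.
          move=> u0; have bu := ltW (b0 u u0).
          by rewrite powRM ?powR_ge0// -powRrM mulrC [q / 2]mulrC mulrC.
        have tb0 u : 0 < u -> 0 <= u `^ 2^-1 * b u.
          by move=> u0; have bu := ltW (b0 u u0); rewrite mulr_ge0 ?powR_ge0.
        rewrite !pw// -(powRM _ (ltW m0) (tb0 s s0)).
        apply: (ge0_ler_powR (ltW q0)); rewrite ?nnegrE.
        + exact: tb0.
        + exact: mulr_ge0 (ltW m0) (tb0 s s0).
        + exact: qm (ltW ts).
      rewrite powRM ?powR_ge0 ?(ltW c10)// -powRrM.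
      have -> : t `^ (q - 1) * b t `^ q *
          (c1 `^ (q - 1) * t `^ (- 2^-1 * (q - 1))) =
          c1 `^ (q - 1) * (t `^ (q / 2) * b t `^ q) * t `^ (- 2^-1).
        have -> : t `^ (q - 1) = t `^ (q / 2) * t `^ (- 2^-1) *
            t `^ (2^-1 * (q - 1)).
          by rewrite !powR_mul//; congr (_ `^ _); lra.
        have -> : t `^ (- 2^-1 * (q - 1)) = (t `^ (2^-1 * (q - 1)))^-1.
          by rewrite mulNr powRN.
        field.
        by rewrite gt_eqF// powR_gt0.
      by rewrite ler_wpM2r ?powR_ge0// ler_wpM2l ?powR_ge0.
  have t0' t : 0 <= t `^ (- 2^-1) :> R by exact: powR_ge0.
  rewrite (ge0_integralZl_EFinM leb ms (measurable_powR_lebT _) K0 t0').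
  apply: (@le_trans _ _ (K%:E * (c2 * s `^ 2^-1)%:E)%E).
    by apply: lee_wpmul2l; [rewrite lee_fin|exact: hc2].
  rewrite -EFinM lee_fin le_eqVlt; apply/orP; left; apply/eqP.
  have -> : s `^ ((q + 1) / 2) = s `^ (q / 2) * s `^ 2^-1.
    by rewrite powR_mul//; congr (_ `^ _); lra.
  by rewrite /K /c; ring.
Qed.

End half_line.

(** * A quasi-monotone weight and its tail *)

Section weight.
Context (R : realType).
Local Notation leb := (@completed_lebesgue_measure R).
Local Notation lebT := (caratheodory_type (@wlength R idfun)^*%mu).
Local Notation pos := (`]0, +oo[%classic : set lebT).

(** The exponent 1/2 is one choice in the definition of slow variation; any value
strictly between 0 and 1 would serve. *)
Lemma slowly_varying_quasi_monotone (b : R -> R) : slowly_varying b ->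
  exists2 m : R, 0 < m & forall s t, 0 < s -> s <= t ->
    s `^ 2^-1 * b s <= m * (t `^ 2^-1 * b t).
Proof.
move=> [_ _ /(_ 2^-1)]; rewrite invr_gt0 ltr0n => /(_ isT) [[phi phi_nd [c c0 eq]] _].
exists (c * c); first exact: mulr_gt0.
move=> s t s0 st; have t0 : 0 < t by exact: lt_le_trans st.
have sp : `]0, +oo[%classic s by rewrite /= in_itv/= s0.
have tp : `]0, +oo[%classic t by rewrite /= in_itv/= t0.
apply: (le_trans (eq s sp).1); rewrite -mulrA ler_pM2l//.
by apply: le_trans (eq t tp).2; apply: phi_nd.
Qed.

Variables (b : R -> R) (q m : R).
Hypothesis q1 : 1 <= q.
Hypothesis mb : measurable_fun pos (b : lebT -> R).
Hypothesis b0 : forall t, 0 < t -> 0 < b t.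
Hypothesis m0 : 0 < m.
Hypothesis qm : forall s t, 0 < s -> s <= t ->
    s `^ 2^-1 * b s <= m * (t `^ 2^-1 * b t).
Hypothesis tail_fin : forall x, 0 < x -> (tail_integral q b x < +oo)%E.

Let q0 : 0 < q. Proof. by apply: lt_le_trans q1. Qed.

(** [density] and [tail] are extended by zero to the whole line, so that they are
measurable there. *)
Definition density (t : R) : R := if 0 < t then t^-1 * b t `^ q else 0.
Definition tail (x : R) : R := if 0 < x then fine (tail_integral q b x) else 0.

Lemma measurable_density : measurable_fun [set: lebT] (density : lebT -> R).
Proof.
apply: (@measurable_patch_pos R (fun t => t^-1 * b t `^ q)).
apply: (eq_measurable_fun (fun s : lebT => (s : R) `^ (-1) * b s `^ q)).
  move=> s; rewrite inE/= in_itv/= andbT => s0.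
  by rewrite powR_inv1// ltW.
apply: (measurable_funM (measurable_funTS (measurable_powR_lebT _))).
exact: (measurableT_comp (measurable_powR q) mb).
Qed.

Lemma density_ge0 t : 0 <= density t.
Proof.
rewrite /density; case: ifPn => // t0.
by rewrite mulr_ge0 ?powR_ge0// invr_ge0 ltW.
Qed.

Lemma density_gt0 t : 0 < t -> 0 < density t.
Proof.
by move=> t0; rewrite /density t0 mulr_gt0 ?invr_gt0// powR_gt0// b0.
Qed.

Lemma tailE x : 0 < x ->
  (tail x)%:E = (\int[leb]_(t in `]x, +oo[) (density t)%:E)%E.
Proof.
move=> x0; rewrite /tail x0 fineK.
  apply: eq_integral => t; rewrite inE/= in_itv/= andbT => xt.
  by rewrite /density (lt_trans x0 xt).
rewrite ge0_fin_numE ?tail_fin//; apply: integral_ge0 => t.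
rewrite /= in_itv/= andbT => xt.
by rewrite lee_fin mulr_ge0 ?powR_ge0// invr_ge0 (ltW (lt_trans x0 xt)).
Qed.

Lemma tail_split x y : 0 < x -> x <= y ->
  (tail x)%:E = (\int[leb]_(t in `]x, y]) (density t)%:E + (tail y)%:E)%E.
Proof.
move=> x0 xy; have y0 : 0 < y by exact: lt_le_trans xy.
have md := measurable_density.
rewrite !tailE// -ge0_integral_setU.
- congr integral; apply/seteqP; split=> t; rewrite /= !in_itv/= ?andbT.
    by move=> xt; rewrite xt/=; case: (leP t y) => ty; [left|right].
  by move=> [/andP[]//|]; apply: le_lt_trans.
- exact: leb_measurable_itv.
- exact: leb_measurable_itv.
- by apply/measurable_EFinP; exact: measurable_funTS.
- by move=> t _; rewrite lee_fin density_ge0.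
- apply/disj_setPLR => t /=; rewrite !in_itv/= andbT => /andP[_ ty] yt.
  by have := lt_le_trans yt ty; rewrite ltxx.
Qed.

Lemma tail_nonincreasing : {in `]0, +oo[ &, {homo tail : x y /~ x <= y}}.
Proof.
move=> x y; rewrite !in_itv/= !andbT => x0 y0 yx.
rewrite -lee_fin (tail_split y0 yx) leeDr// integral_ge0// => t _.
by rewrite lee_fin density_ge0.
Qed.

Lemma measurable_tail : measurable_fun [set: lebT] (tail : lebT -> R).
Proof.
rewrite (_ : tail = fun x => if 0 < x then tail x else 0).
  apply: measurable_patch_pos; apply: nonincreasing_leb_measurable.
  exact: tail_nonincreasing.
by apply/funext => x; rewrite /tail; case: ifP.
Qed.

Lemma density_lower t x : 0 < x -> x <= t <= 2 * x ->
  (2 * x)^-1 * ((2 `^ (- 2^-1) / m) * b x) `^ q <= density t.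
Proof.
move=> x0 /andP[xt t2x]; have t0 : 0 < t by exact: lt_le_trans xt.
have bx := b0 x0; have bt := b0 t0.
rewrite /density t0; apply: ler_pM.
- by rewrite invr_ge0 mulr_ge0// ltW.
- exact: powR_ge0.
- by rewrite lef_pV2 ?posrE// mulr_gt0.
rewrite ge0_ler_powR ?nnegrE ?(ltW q0) ?(ltW bt)//.
  by rewrite !mulr_ge0 ?powR_ge0 ?invr_ge0 ?(ltW m0) ?(ltW bx).
rewrite mulrAC ler_pdivrMr// powRN mulrC ler_pdivrMr ?powR_gt0//.
have x20 : 0 < x `^ 2^-1 by exact: powR_gt0.
rewrite -(ler_pM2l x20); apply: (le_trans (qm x0 xt)).
have -> : x `^ 2^-1 * (b t * m * 2 `^ 2^-1) =
    m * ((2 * x) `^ 2^-1 * b t).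
  by rewrite powRM ?(ltW x0)//; ring.
rewrite ler_pM2l// ler_pM2r// ge0_ler_powR ?nnegrE ?invr_ge0 ?(ltW t0)//.
by rewrite mulr_ge0 ?(ltW x0).
Qed.

(** Already the integral over [(x, 2 * x]] is at least a multiple of [b x ^ q],
because [b t] is at least a multiple of [b x] on that interval. *)
Lemma tail_lower : exists2 c : R, 0 < c & forall x, 0 < x ->
  c * b x `^ q <= tail x.
Proof.
pose k := 2 `^ (- 2^-1) / m.
have k0 : 0 < k by rewrite divr_gt0 ?powR_gt0.
exists (2^-1 * k `^ q); first by rewrite mulr_gt0 ?powR_gt0.
move=> x x0; have bx := b0 x0.
have x2x : x <= 2 * x by lra.
have c0 : 0 <= (2 * x)^-1 * (k * b x) `^ q.
  by rewrite mulr_ge0 ?powR_ge0// invr_ge0 mulr_ge0// ltW.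
have md := measurable_density.
rewrite -lee_fin (tail_split x0 x2x).
apply: (@le_trans _ _ (\int[leb]_(t in `]x, (2 * x)%R]) (density t)%:E)%E); last first.
  rewrite leeDl// tailE ?mulr_gt0// integral_ge0// => t _.
  by rewrite lee_fin density_ge0.
apply: (@le_trans _ _ (\int[leb]_(t in `]x, (2 * x)%R])
    ((2 * x)^-1 * (k * b x) `^ q)%:E)%E); last first.
  apply: ge0_le_integral_EFin.
  - exact: leb_measurable_itv.
  - exact: measurable_cst.
  - exact: md.
  - by [].
  - move=> t; rewrite /= in_itv/= => /andP[xt tx]; apply: density_lower => //.
    by rewrite (ltW xt).
rewrite integral_cst; last exact: leb_measurable_itv.
rewrite [X in (_ <= _ * X)%E](_ : _ = x%:E); last first.
  transitivity (lebesgue_measure `]x, (2 * x)%R]); first reflexivity.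
  have -> : 2 * x = x + x by ring.
  by rewrite lebesgue_measure_itv/= lte_fin ltrDl x0 -EFinB addrK.
rewrite -EFinM lee_fin powRM ?(ltW k0) ?(ltW bx)//.
rewrite le_eqVlt; apply/orP; left; apply/eqP; field.
by rewrite gt_eqF.
Qed.

Lemma tail_gt0 x : 0 < x -> 0 < tail x.
Proof.
move=> x0; have [c c0 /(_ x x0)] := tail_lower; apply: lt_le_trans.
by rewrite mulr_gt0// powR_gt0// b0.
Qed.

(** Quasi-monotonicity between 1 and [x] gives [b x >= c * x ^ (- 1/2)]. *)
Lemma tail_lower_powR : exists2 c : R, 0 < c & forall x, 1 <= x ->
  c * x `^ (- (q / 2)) <= tail x.
Proof.
have [c c0 hc] := tail_lower.
have b1 := b0 (@ltr01 R).
pose k := b 1 / m.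
have k0 : 0 < k by rewrite divr_gt0.
exists (c * k `^ q); first by rewrite mulr_gt0 ?powR_gt0.
move=> x x1; have x0 : 0 < x by exact: lt_le_trans x1.
have bx := b0 x0.
apply: le_trans (hc x x0); rewrite -mulrA ler_pM2l//.
have -> : x `^ (- (q / 2)) = (x `^ (- 2^-1)) `^ q.
  by rewrite -powRrM; congr (_ `^ _); lra.
have xp : 0 <= x `^ (- 2^-1) by exact: powR_ge0.
rewrite -powRM ?(ltW k0)//.
apply: (ge0_ler_powR (ltW q0)); rewrite ?nnegrE ?(ltW bx)//.
  exact: mulr_ge0 (ltW k0) xp.
rewrite /k powRN mulrAC ler_pdivrMr// ler_pdivrMr ?powR_gt0//.
have := qm ltr01 x1; rewrite powR1 mul1r => /le_trans; apply.
by rewrite le_eqVlt; apply/orP; left; apply/eqP; ring.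
Qed.

(** Absolute continuity of the integral of [density] over [(a, oo)]. *)
Lemma tail_uniform_continuous a e : 0 < a -> 0 < e ->
  exists2 d : R, 0 < d & forall x y, a <= x -> x <= y -> y - x < d ->
    tail x - tail y < e.
Proof.
move=> a0 e0.
pose f : R -> R := density \_ `]a, +oo[%classic.
have ma : measurable (`]a, +oo[%classic : set lebT) by exact: leb_measurable_itv.
have mf : measurable_fun [set: lebT] (f : lebT -> R).
  apply: (iffLR (measurable_restrictT _ ma)).
  by apply: measurable_funTS; exact: measurable_density.
have f0 t : 0 <= f t.
  by rewrite /f patchE; case: ifP => // _; exact: density_ge0.
have intf : leb.-integrable [set: lebT] (EFin \o (f : lebT -> R)).
  apply/integrableP; split; first exact/measurable_EFinP.
  have -> : (\int[leb]_x `|(EFin \o (f : lebT -> R)) x| = (tail a)%:E)%E.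
    rewrite tailE// [RHS]integral_mkcond; apply: eq_integral => t _ /=.
    by rewrite ger0_norm// /f !patchE; case: ifP.
  exact: ltry.
have [d [d0 hd]] := integral_normr_continuous intf e0.
exists d => // x y ax xy yxd.
have x0 : 0 < x by exact: lt_le_trans ax.
have mxy : measurable (`]x, y]%classic : set lebT) by exact: leb_measurable_itv.
have lxy : (leb (`]x, y]%classic : set lebT) < d%:E)%E.
  apply: (@le_lt_trans _ _ (y - x)%:E%E); last by rewrite lte_fin.
  rewrite [leLHS](_ : _ = lebesgue_measure (`]x, y]%classic : set R)); last reflexivity.
  rewrite lebesgue_measure_itv/= lte_fin; case: ifPn => // _.
  by rewrite lee_fin subr_ge0.
have := hd _ mxy lxy; apply: le_lt_trans.
rewrite lerBlDr -lee_fin (tail_split x0 xy) EFinD leeD2r//.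
rewrite /Rintegral.
have -> : (\int[leb]_(t in `]x, y]) (`|f t|)%:E =
    \int[leb]_(t in `]x, y]) (density t)%:E)%E.
  apply: eq_integral => t; rewrite inE/= in_itv/= => /andP[xt _].
  rewrite ger0_norm// /f patchE ifT// inE/= in_itv/= andbT.
  exact: le_lt_trans xt.
rewrite fineK// ge0_fin_numE; last first.
  by apply: integral_ge0 => t _; rewrite lee_fin density_ge0.
apply: (@le_lt_trans _ _ (tail x)%:E); last exact: ltry.
by rewrite (tail_split x0 xy) leeDl// lee_fin ltW// tail_gt0// (lt_le_trans x0 xy).
Qed.

Lemma tail_continuous x : 0 < x -> {for x, continuous tail}.
Proof.
move=> x0; apply/cvgrPdist_lt => e e0.
have x2 : 0 < x / 2 by rewrite divr_gt0.
have [d d0 hd] := tail_uniform_continuous x2 e0.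
near=> y.
have yx : `|x - y| < Num.min d (x / 2).
  near: y; apply: (@cvgr_dist_lt _ _ _ (nbhs x) _ id) => //.
  by rewrite lt_min d0.
move: yx; rewrite lt_min => /andP[yd yx].
have xy : x / 2 <= y by have := ler_norm (x - y); lra.
have y0 : 0 < y by exact: lt_le_trans xy.
have [le|/ltW le] := leP x y.
- have := tail_nonincreasing; move=> /(_ y x).
  rewrite !in_itv/= !andbT => /(_ y0 x0 le) h.
  rewrite ger0_norm ?subr_ge0//; apply: hd => //; first lra.
  by apply: le_lt_trans yd; rewrite distrC ler_norm.
- have := tail_nonincreasing; move=> /(_ x y).
  rewrite !in_itv/= !andbT => /(_ x0 y0 le) h.
  rewrite distrC ger0_norm ?subr_ge0//; apply: hd => //.
  by apply: le_lt_trans yd; rewrite ler_norm.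
Unshelve. all: by end_near. Qed.

Lemma tail_small x e : 0 < x -> 0 < e -> exists2 y, x <= y & tail y < e.
Proof.
move=> x0 e0.
have md := measurable_density.
have [|ny] := pselect (exists2 y, x <= y & tail y < e) => //.
have ty y : x <= y -> e <= tail y.
  by move=> xy; rewrite leNgt; apply/negP => ye; apply: ny; exists y.
have : ((tail x)%:E <= (tail x - e)%:E)%E.
  pose F n : set R := `]x, x + n%:R]%classic.
  have FE : (`]x, +oo[%classic = \bigcup_n F n).
    apply/seteqP; split=> t; rewrite /F/= in_itv/= ?andbT.
      move=> xt; exists (Num.truncn (t - x)).+1 => //=.
      by rewrite in_itv/= xt/= -lerBlDl ltW// truncnS_gt.
    by move=> [n _ /=]; rewrite in_itv/= => /andP[].
  rewrite tailE// FE; apply: ge0_integral_nondecreasing_bigcup_le.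
  - move=> i j ij t; rewrite /F/= !in_itv/= => /andP[-> ti]/=.
    by apply: (le_trans ti); rewrite lerD2l ler_nat.
  - by move=> n; exact: leb_measurable_itv.
  - exact: md.
  - exact: density_ge0.
  - move=> n; have xn : x <= x + n%:R by rewrite lerDl.
    rewrite EFinB (tail_split x0 xn) leeBrDr//.
    by apply: leeD2l; rewrite lee_fin ty.
by rewrite lee_fin => ?; exfalso; lra.
Qed.

Lemma tail_surjective x y : 0 < x -> 0 < y -> y <= tail x ->
  exists2 z, x <= z & tail z = y.
Proof.
move=> x0 y0 yx; have [t xt ty] := tail_small x0 y0.
have : {within `[x, t], continuous tail}.
  apply: continuous_in_subspaceT => u; rewrite inE/= in_itv/= => /andP[xu _].
  by apply: tail_continuous; exact: lt_le_trans xu.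
move=> ct; have [|z] := @IVT _ _ _ _ y xt ct.
  by rewrite ge_min le_max (ltW ty) yx orbT.
by rewrite in_itv/= => /andP[xz _] zy; exists z.
Qed.

(** The tail is continuous, positive and tends to 0, so it takes the values
[tail 1 * 2^-1 ^+ k]; positivity forces the points to be unbounded. *)
Lemma halving_sequence : exists x_ : nat -> R,
  [/\ x_ 0%N = 1, forall k, tail (x_ k) = tail 1 * 2^-1 ^+ k,
      forall k, x_ k < x_ k.+1 & forall s, exists k, s <= x_ k].
Proof.
have t1 := tail_gt0 (@ltr01 R).
have h01 : 0 < (2^-1 : R) < 1 by rewrite invr_gt0 ltr0n invf_lt1// ltr1n.
have /choice[x_ x_P] (k : nat) : exists z, [/\ 1 <= z,
    tail z = tail 1 * 2^-1 ^+ k & (k = 0%N -> z = 1)].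
  case: k => [|k]; first by exists 1; rewrite mulr1.
  have [||z z1 zE] := @tail_surjective 1 (tail 1 * 2^-1 ^+ k.+1) ltr01.
  - by rewrite mulr_gt0// exprn_gt0//; case/andP: h01.
  - by rewrite ger_pMr// exprn_ile1 ?invr_ge0// invf_le1// ler1n.
  - by exists z.
have x1 k : 1 <= x_ k by have [] := x_P k.
have x0 k : 0 < x_ k by exact: lt_le_trans (x1 k).
have xE k : tail (x_ k) = tail 1 * 2^-1 ^+ k by have [] := x_P k.
have lt_of_tail s t : 0 < s -> 0 < t -> tail t < tail s -> s < t.
  move=> s0 t0; rewrite ltNge; apply: contraNlt => ts.
  by apply: tail_nonincreasing; rewrite ?in_itv/= ?andbT.
exists x_; split=> //.
- by have [_ _ ->] := x_P 0%N.
- move=> k; apply: lt_of_tail => //; rewrite !xE exprS.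
  rewrite ltr_pM2l// gtr_pMl ?exprn_gt0//; by case/andP: h01.
- move=> s; have [s0|s0] := ltP 0 s; last by exists 0%N; rewrite (le_trans s0)// ltW.
  have ts := tail_gt0 s0.
  have [n nP] : exists n, tail 1 * 2^-1 ^+ n < tail s.
    exists (Num.truncn (tail 1 / tail s)).+1.
    rewrite exprVn ltr_pdivrMr ?exprn_gt0// mulrC -ltr_pdivrMr//.
    apply: (lt_trans (truncnS_gt _)).
    by rewrite -natrX ltr_nat ltn_expl.
  by exists n; apply: ltW; apply: lt_of_tail => //; rewrite xE.
Qed.

End weight.

(** * The K- and J-functionals, and the couple of a space with the sum *)

Section K_functional.
Context (R : realType) (E : topologicalLmodType R) (C : compatible_couple E).
Implicit Types (f g : E) (t : R).

Lemma Kfun_le f x t : 0 <= t -> decompositions C f x ->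
  Kfun C f t <= `|x.1| + t * `|x.2|.
Proof.
move=> t0 fx; apply: ge_inf; last by exists x.
by exists 0 => _ [y _ <-]; rewrite addr_ge0// mulr_ge0.
Qed.

Lemma Kfun_glb f t y : f \in in_sum C ->
  (forall x, decompositions C f x -> y <= `|x.1| + t * `|x.2|) ->
  y <= Kfun C f t.
Proof.
move=> /in_sumP[x fx] h; apply: lb_le_inf; first by exists (`|x.1| + t * `|x.2|), x.
by move=> _ [z fz <-]; exact: h.
Qed.

Lemma Kfun_lt f t e : f \in in_sum C -> Kfun C f t < e ->
  exists2 x, decompositions C f x & `|x.1| + t * `|x.2| < e.
Proof.
move=> /in_sumP[x fx] /inf_lt[|_ [z fz <-] ze]; last by exists z.
by exists (`|x.1| + t * `|x.2|), x.
Qed.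

Lemma Kfun_ge0 f t : f \in in_sum C -> 0 <= t -> 0 <= Kfun C f t.
Proof.
by move=> fC t0; apply: Kfun_glb => // x _; rewrite addr_ge0// mulr_ge0.
Qed.

Lemma Kfun_nondecreasing f s t : f \in in_sum C -> 0 <= s -> s <= t ->
  Kfun C f s <= Kfun C f t.
Proof.
move=> fC s0 st; apply: Kfun_glb => // x fx.
apply: (le_trans (Kfun_le s0 fx)); rewrite lerD2l.
by apply: ler_wpM2r.
Qed.

Lemma measurable_Kfun f : f \in in_sum C ->
  measurable_fun (`]0, +oo[%classic :
      set (caratheodory_type (@wlength R idfun)^*%mu))
    (Kfun C f : caratheodory_type (@wlength R idfun)^*%mu -> R).
Proof.
move=> fC; apply: nondecreasing_leb_measurable => s t.
by rewrite !in_itv/= !andbT => s0 _ st; apply: Kfun_nondecreasing => //; exact: ltW.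
Qed.

Lemma KfunD f g t : f \in in_sum C -> g \in in_sum C -> 0 <= t ->
  Kfun C (f + g) t <= Kfun C f t + Kfun C g t.
Proof.
move=> fC gC t0; rewrite -lerBlDr; apply: Kfun_glb => // x fx.
rewrite lerBlDr -lerBlDl; apply: Kfun_glb => // y gy.
have fgxy : decompositions C (f + g) (x + y).
  by rewrite /decompositions /= fx gy !raddfD /= addrACA.
rewrite lerBlDl; apply: (le_trans (Kfun_le t0 fgxy)) => /=.
have := ler_normD x.1 y.1.
have : t * `|x.2 + y.2| <= t * (`|x.2| + `|y.2|).
  by rewrite ler_wpM2l// ler_normD.
by rewrite mulrDr; lra.
Qed.

Let KfunZ_le a f t : f \in in_sum C -> 0 <= t -> 0 < a ->
  Kfun C (a *: f) t <= a * Kfun C f t.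
Proof.
move=> fC t0 a0; rewrite -ler_pdivrMl// mulrC; apply: Kfun_glb => // x fx.
rewrite ler_pdivrMr// mulrC.
have afx : decompositions C (a *: f) (a *: x).
  by rewrite /decompositions /= fx scalerDr !linearZ.
apply: (le_trans (Kfun_le t0 afx)) => /=.
by rewrite !normrZ gtr0_norm// mulrDr mulrCA.
Qed.

Lemma Kfun0 t : 0 <= t -> Kfun C 0 t = 0.
Proof.
move=> t0; apply/le_anti/andP; split; last first.
  by apply: Kfun_ge0 => //; exact: rpred0.
have d0 : decompositions C 0 (0, 0).
  by rewrite /decompositions /= !raddf0 addr0.
by apply: (le_trans (Kfun_le t0 d0)); rewrite /= !normr0 mulr0 addr0.
Qed.

Lemma KfunZ a f t : f \in in_sum C -> 0 <= t -> 0 <= a ->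
  Kfun C (a *: f) t = a * Kfun C f t.
Proof.
move=> fC t0; rewrite le_eqVlt => /orP[/eqP <-|a0].
  by rewrite scale0r mul0r Kfun0.
apply/le_anti; rewrite KfunZ_le//=.
rewrite -ler_pdivlMl//.
have afC : a *: f \in in_sum C by exact: rpredZ.
have ai : 0 < a^-1 by rewrite invr_gt0.
have := KfunZ_le afC t0 ai.
by rewrite scalerA mulVf ?gt_eqF// scale1r.
Qed.

Lemma KfunN f t : Kfun C (- f) t = Kfun C f t.
Proof.
congr inf; apply/seteqP; split=> _ [x fx <-]; exists (- x); rewrite /= ?normrN//;
  move: fx; rewrite /decompositions /= !raddfN /= -opprD.
- by move=> <-; rewrite opprK.
- by move=> ->.
Qed.

Lemma Kfun_sum_norm (f : sum_space C) : Kfun C (val f) 1 = `|f|.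
Proof.
rewrite sum_normE; congr inf; apply/seteqP; split=> _ [x fx <-]; exists x => //;
  by rewrite mul1r.
Qed.

Lemma Kfun_le_norm (f : sum_space C) t : 0 <= t ->
  Kfun C (val f) t <= Num.max 1 t * `|f|.
Proof.
move=> t0.
have m0 : 0 < Num.max 1 t by rewrite lt_max ltr01.
rewrite -ler_pdivrMl// -Kfun_sum_norm; apply: Kfun_glb; first exact: valP.
move=> x fx; rewrite mul1r ler_pdivrMl//.
apply: (le_trans (Kfun_le t0 fx)); rewrite mulrDr lerD//.
  by rewrite ler_peMl// le_max lexx.
by rewrite ler_wpM2r// le_max lexx orbT.
Qed.

(** The factor 2 leaves room above the infimum when it is positive.  When it is 0,
the vector itself is 0, since the norm of the sum is bounded by a multiple of the
K-functional. *)
Lemma Kfun_near_optimal f t : f \in in_sum C -> 0 < t ->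
  exists2 x, decompositions C f x & `|x.1| + t * `|x.2| <= 2 * Kfun C f t.
Proof.
move=> fC t0; have K0 := Kfun_ge0 fC (ltW t0).
have [Kz|Kz] := eqVneq (Kfun C f t) 0; last first.
  have [|x fx xK] := @Kfun_lt f t (2 * Kfun C f t) fC.
    have : 0 < Kfun C f t by rewrite lt_neqAle eq_sym Kz.
    by lra.
  by exists x => //; exact: ltW.
exists (0, 0); last by rewrite /= !normr0 mulr0 addr0 Kz mulr0.
suff -> : f = 0 by rewrite /decompositions /= !raddf0 addr0.
have : `|Sub f fC : sum_space C| = 0.
  apply/le_anti; rewrite normr_ge0 andbT -Kfun_sum_norm SubK.
  apply/ler_addgt0Pr => e e0; rewrite add0r.
  have m0 : 0 < Num.min 1 t by rewrite lt_min ltr01.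
  have [|x fx xe] := @Kfun_lt f t (e * Num.min 1 t) fC.
    by rewrite Kz mulr_gt0.
  apply: (le_trans (Kfun_le ler01 fx)); rewrite mul1r -(ler_pM2r m0).
  apply: le_trans (ltW xe); rewrite mulrDl lerD//.
    by rewrite ler_piMr// ge_min lexx.
  by rewrite mulrC ler_wpM2r// ge_min lexx orbT.
by move=> /normr0_eq0/(congr1 val); rewrite SubK.
Qed.

Lemma Kfun_cap_le1 (u : cap_space C) t : 0 <= t ->
  Kfun C (val (cap_to_sum u)) t <= `|(val u).1|.
Proof.
move=> t0.
have d : decompositions C (val (cap_to_sum u)) ((val u).1, 0).
  by rewrite /decompositions /= raddf0 addr0.
by apply: (le_trans (Kfun_le t0 d)); rewrite /= normr0 mulr0 addr0.
Qed.

Lemma Kfun_cap_le2 (u : cap_space C) t : 0 <= t ->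
  Kfun C (val (cap_to_sum u)) t <= t * `|(val u).2|.
Proof.
move=> t0.
have d : decompositions C (val (cap_to_sum u)) (0, (val u).2).
  rewrite /decompositions /= raddf0 add0r.
  by have := valP u; rewrite unfold_in => /eqP.
by apply: (le_trans (Kfun_le t0 d)); rewrite /= normr0 add0r.
Qed.

Lemma cap_to_sumZ a (u : cap_space C) :
  cap_to_sum (a *: u) = a *: cap_to_sum u.
Proof. by apply/val_inj; rewrite /= linearZ. Qed.

Lemma Jfun_ge0 (u : cap_space C) t : 0 <= Jfun u t.
Proof. by rewrite /Jfun le_max normr_ge0. Qed.

Lemma JfunZ a (u : cap_space C) t : 0 <= a -> Jfun (a *: u) t = a * Jfun u t.
Proof.
move=> a0; rewrite /Jfun /= !normrZ ger0_norm// maxr_pMr//.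
by congr Num.max; rewrite mulrCA.
Qed.

Lemma Jfun_nondecreasing (u : cap_space C) s t : s <= t -> Jfun u s <= Jfun u t.
Proof.
move=> st; rewrite /Jfun ge_max !le_max lexx/=; apply/orP; right.
by apply: ler_wpM2r.
Qed.

Local Notation leb := (@completed_lebesgue_measure R).
Local Notation lebT := (caratheodory_type (@wlength R idfun)^*%mu).

Lemma measurable_Jfun (D : set R) (u : R -> cap_space C) :
  measurable (D : set lebT) -> strongly_measurable leb D u ->
  measurable_fun (D : set lebT) (fun s : lebT => Jfun (u s) s).
Proof.
move=> mD [s_ ss su].
have c1 : continuous (fun c : cap_space C => `|(val c).1|).
  apply: (lipschitz_continuous ler01) => x y; rewrite mul1r; apply: (le_trans (ler_dist_dist _ _)).
  by rewrite cap_normE le_max lexx.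
have c2 : continuous (fun c : cap_space C => `|(val c).2|).
  apply: (lipschitz_continuous ler01) => x y; rewrite mul1r; apply: (le_trans (ler_dist_dist _ _)).
  by rewrite cap_normE le_max lexx orbT.
have m1 := measurable_ae_limit completed_lebesgue_measure_is_complete mD ss c1 su.
have m2 := measurable_ae_limit completed_lebesgue_measure_is_complete mD ss c2 su.
exact: (measurable_maxr m1
  (measurable_funM (measurable_funTS (@measurable_id_lebT R)) m2)).
Qed.

End K_functional.

Section sum_couple_facts.
Context (R : realType) (E : topologicalLmodType R) (C : compatible_couple E).
Local Notation S := (sum_couple C).

Lemma in_sum_couple f : (f \in in_sum S) = (f \in in_sum C).
Proof.
apply/idP/idP => [/in_sumP[[x g] /= fxg]|fC].
  have /in_sumP[y gy] := valP g.
  apply/in_sumP; exists (x + y.1, y.2); rewrite /decompositions /=.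
  by move: fxg; rewrite /decompositions /= => ->; rewrite gy raddfD addrA.
apply/in_sumP; exists (0, Sub f fC).
by rewrite /decompositions /= raddf0 add0r.
Qed.

(** A decomposition of the [X_0 + X_1] component sends a further part to [X_0];
this costs at most its norm multiplied by [t], because [t >= 1]. *)
Lemma Kfun_sum_couple_ge1 f t : f \in in_sum C -> 1 <= t ->
  Kfun S f t = Kfun C f t.
Proof.
move=> fC t1; have t0 : 0 < t by exact: lt_le_trans t1.
have fS : f \in in_sum S by rewrite in_sum_couple.
apply/le_anti/andP; split.
  apply: Kfun_glb => // x fx.
  have x2 : emb1 C x.2 \in in_sum C.
    by apply/in_sumP; exists (0, x.2); rewrite /decompositions /= raddf0 add0r.
  have fS' : decompositions S f (x.1, Sub (emb1 C x.2) x2) by [].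
  apply: (le_trans (Kfun_le (ltW t0) fS')); rewrite /= lerD2l ler_pM2l//.
  have d : decompositions C (val (Sub (emb1 C x.2) x2 : sum_space C)) (0, x.2).
    by rewrite /decompositions /= raddf0 add0r.
  by apply: (le_trans (sum_norm_le d)); rewrite /= normr0 add0r.
apply: Kfun_glb => // -[x g] /= fxg.
apply/ler_addgt0Pr => e e0.
have /sum_norm_lt[y gy ye] : sum_norm g < sum_norm g + e / t.
  by rewrite ltrDl divr_gt0.
have d : decompositions C f (x + y.1, y.2).
  by move: fxg; rewrite /decompositions /= => ->; rewrite gy raddfD addrA.
apply: (le_trans (Kfun_le (ltW t0) d)) => /=.
have h1 := ler_normD x y.1.
have h2 : t * (`|y.1| + `|y.2|) <= t * (sum_norm g + e / t).
  by rewrite ler_pM2l// ltW.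
have h3 : `|y.1| <= t * `|y.1| by rewrite ler_peMl.
have h4 : t * (sum_norm g + e / t) = t * sum_norm g + e.
  by rewrite mulrDr mulrCA divff ?mulr1// gt_eqF.
have -> : `|g| = sum_norm g by [].
by rewrite h4 mulrDr in h2; lra.
Qed.

(** For [t <= 1] it is cheapest to put the whole vector into [X_0 + X_1], whose norm
on [X_0] is at most that of [X_0]. *)
Lemma Kfun_sum_couple_le1 f t : f \in in_sum C -> 0 <= t <= 1 ->
  Kfun S f t = t * Kfun C f 1.
Proof.
move=> fC /andP[t0 t1].
have fS : f \in in_sum S by rewrite in_sum_couple.
have -> : Kfun C f 1 = `|Sub f fC : sum_space C| by rewrite -Kfun_sum_norm SubK.
apply/le_anti/andP; split.
  have d : decompositions S f (0, Sub f fC).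
    by rewrite /decompositions /= raddf0 add0r.
  by apply: (le_trans (Kfun_le t0 d)); rewrite /= normr0 add0r.
apply: Kfun_glb => // -[x g] /= fxg.
have xC : emb0 C x \in in_sum C.
  by apply/in_sumP; exists (x, 0); rewrite /decompositions /= raddf0 addr0.
have -> : Sub f fC = (Sub (emb0 C x) xC : sum_space C) + g.
  by apply: (@val_inj _ _ (sum_space C)); exact: fxg.
have nx : `|Sub (emb0 C x) xC : sum_space C| <= `|x|.
  have d : decompositions C (val (Sub (emb0 C x) xC : sum_space C)) (x, 0).
    by rewrite /decompositions /= raddf0 addr0.
  by apply: (le_trans (sum_norm_le d)); rewrite /= normr0 addr0.
apply: (le_trans (ler_wpM2l t0 (ler_normD _ _))).
rewrite mulrDr lerD2r; apply: (le_trans _ nx).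
by rewrite ler_piMl.
Qed.

End sum_couple_facts.

(** * Norms as integrals of q-th powers *)

Section energy.
Context (R : realType).
Local Notation leb := (@completed_lebesgue_measure R).
Local Notation lebT := (caratheodory_type (@wlength R idfun)^*%mu).
Local Notation pos := (`]0, +oo[%classic : set lebT).
Implicit Types v h : R -> R.

(** The q-th power of [interp_norm q v h] for non-negative [v] and [h]; the
factor [t^-1] is the q-th power of [t ^ (- 1/q)]. *)
Definition energy (q : R) v h : \bar R :=
  (\int[leb]_(t in `]0%R, +oo[) (t^-1 * v t `^ q * h t `^ q)%:E)%E.

Lemma energy_ge0 q v h : (0 <= energy q v h)%E.
Proof.
apply: integral_ge0 => t; rewrite /= in_itv/= andbT => t0.
by rewrite lee_fin !mulr_ge0 ?powR_ge0// invr_ge0 ltW.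
Qed.

Lemma interp_normE q v h : 1 <= q -> (forall t, 0 < t -> 0 <= v t) ->
  (forall t, 0 < t -> 0 <= h t) ->
  interp_norm q%:E v h = (energy q v h `^ q^-1)%E.
Proof.
move=> q1 v0 h0; have q0 : 0 < q by exact: lt_le_trans q1.
rewrite /interp_norm /Lq_norm unlock; congr (_ `^ _)%E.
rewrite /energy [RHS]integral_mkcond; apply: eq_integral => t _.
rewrite !patchE; case: ifPn => tD; last first.
  by rewrite abse0 poweR0r// gt_eqF.
move: tD; rewrite inE/= in_itv/= andbT => t0.
congr EFin.
have t1 : 0 <= t `^ (- q^-1) by exact: powR_ge0.
rewrite ger0_norm ?mulr_ge0 ?v0 ?h0//.
rewrite powRM ?mulr_ge0 ?v0 ?h0// powRM ?v0// -powRrM.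
by rewrite mulNr mulVf ?gt_eqF// powR_inv1// ltW.
Qed.

Lemma interp_norm_le q v h v' h' c : 1 <= q -> 0 <= c ->
  (forall t, 0 < t -> 0 <= v t) -> (forall t, 0 < t -> 0 <= h t) ->
  (forall t, 0 < t -> 0 <= v' t) -> (forall t, 0 < t -> 0 <= h' t) ->
  (energy q v h <= c%:E * energy q v' h')%E ->
  (interp_norm q%:E v h <= (c `^ q^-1)%:E * interp_norm q%:E v' h')%E.
Proof.
move=> q1 c0 v0 h0 v'0 h'0 le; have q0 : 0 < q by exact: lt_le_trans q1.
rewrite !interp_normE// -poweR_EFin -poweRM ?lee_fin ?energy_ge0//.
have iq : 0 <= q^-1 by rewrite invr_ge0 ltW.
apply: (gt0_ler_poweR iq _ _ le); rewrite in_itv/= leey andbT ?energy_ge0//.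
by rewrite mule_ge0 ?lee_fin ?energy_ge0.
Qed.

Lemma interp_norm_fin q v h : 1 <= q ->
  (forall t, 0 < t -> 0 <= v t) -> (forall t, 0 < t -> 0 <= h t) ->
  (interp_norm q%:E v h < +oo)%E -> (energy q v h < +oo)%E.
Proof.
move=> q1 v0 h0; rewrite interp_normE//; apply: lty_poweRy.
by rewrite invr_neq0// gt_eqF// (lt_le_trans _ q1).
Qed.

End energy.

Section section_integral.
Context (R : realType).
Local Notation leb := (@completed_lebesgue_measure R).
Local Notation lebT := (caratheodory_type (@wlength R idfun)^*%mu).
Local Notation pos := (`]0, +oo[%classic : set lebT).

Lemma measurable_head_integral (g : R -> R) :
  measurable_fun pos (g : lebT -> R) -> (forall t, 0 < t -> 0 <= g t) ->
  measurable_fun [set: lebT]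
    (fun t : lebT => \int[leb]_(s in `]0%R, t[) (g s)%:E)%E.
Proof.
move=> mg g0.
pose k (z : lebT * lebT) : R :=
  if ((z.2 : R) < z.1) then (if 0 < (z.2 : R) then g z.2 else 0) else 0.
have m1 : measurable_fun [set: lebT * lebT] (fun z : lebT * lebT => (z.1 : R)).
  exact: (measurableT_comp (@measurable_id_lebT R) measurable_fst).
have m2 : measurable_fun [set: lebT * lebT] (fun z : lebT * lebT => (z.2 : R)).
  exact: (measurableT_comp (@measurable_id_lebT R) measurable_snd).
have mk : measurable_fun [set: lebT * lebT] k.
  apply: measurable_fun_ifT; [exact: measurable_fun_ltr| |exact: measurable_cst].
  exact: (measurableT_comp (measurable_patch_pos mg) measurable_snd).
have k0 z : (0 <= (k z)%:E)%E.
  rewrite lee_fin /k; case: ifP => // _; case: ifPn => // z0; exact: g0.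
have mkE : measurable_fun [set: lebT * lebT] (fun z => (k z)%:E).
  exact/measurable_EFinP.
have := @measurable_fun_fubini_tonelli_F _ _ lebT lebT R leb _ mkE k0.
apply: eq_measurable_fun => t _.
rewrite /fubini_F [RHS]integral_mkcond; apply: eq_integral => s _.
rewrite patchE; case: ifPn => [|/negP] sP; rewrite inE/= in_itv/= in sP;
    rewrite /k/=.
  by case/andP: sP => -> ->.
by case: ifPn => // st; case: ifPn => // s0; exfalso; apply: sP; rewrite s0.
Qed.

Lemma measurable_tail_integral (g : R -> R) :
  measurable_fun pos (g : lebT -> R) -> (forall t, 0 < t -> 0 <= g t) ->
  measurable_fun pos
    (fun t : lebT => \int[leb]_(s in `](t : R), +oo[) (g s)%:E)%E.
Proof.
move=> mg g0.
pose k (z : lebT * lebT) : R :=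
  if ((z.1 : R) < z.2) then (if 0 < (z.2 : R) then g z.2 else 0) else 0.
have m1 : measurable_fun [set: lebT * lebT] (fun z : lebT * lebT => (z.1 : R)).
  exact: (measurableT_comp (@measurable_id_lebT R) measurable_fst).
have m2 : measurable_fun [set: lebT * lebT] (fun z : lebT * lebT => (z.2 : R)).
  exact: (measurableT_comp (@measurable_id_lebT R) measurable_snd).
have mk : measurable_fun [set: lebT * lebT] k.
  apply: measurable_fun_ifT; [exact: measurable_fun_ltr| |exact: measurable_cst].
  exact: (measurableT_comp (measurable_patch_pos mg) measurable_snd).
have k0 z : (0 <= (k z)%:E)%E.
  rewrite lee_fin /k; case: ifP => // _; case: ifPn => // z0; exact: g0.
have mkE : measurable_fun [set: lebT * lebT] (fun z => (k z)%:E).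
  exact/measurable_EFinP.
have := @measurable_fun_fubini_tonelli_F _ _ lebT lebT R leb _ mkE k0.
move=> /(@measurable_funTS _ _ _ _ pos); apply: eq_measurable_fun => t.
rewrite inE/= in_itv/= andbT => t0.
rewrite /fubini_F [RHS]integral_mkcond; apply: eq_integral => s _.
rewrite patchE; case: ifPn => [|/negP] sP; rewrite inE/= in_itv/= andbT in sP;
    rewrite /k/=.
  by rewrite sP (lt_trans t0 sP).
by case: ifPn => // st; exfalso; apply: sP.
Qed.

End section_integral.

(** * J-representations bound the K-functional *)

Section K_below_J.
Context (R : realType).
Local Notation leb := (@completed_lebesgue_measure R).
Local Notation lebT := (caratheodory_type (@wlength R idfun)^*%mu).
Local Notation pos := (`]0, +oo[%classic : set lebT).

Variables (b : R -> R) (q m : R).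
Hypothesis q1 : 1 <= q.
Hypothesis mb : measurable_fun pos (b : lebT -> R).
Hypothesis b0 : forall t, 0 < t -> 0 < b t.
Hypothesis m0 : 0 < m.
Hypothesis qm : forall s t, 0 < s -> s <= t ->
    s `^ 2^-1 * b s <= m * (t `^ 2^-1 * b t).
Hypothesis tail_fin : forall x, 0 < x -> (tail_integral q b x < +oo)%E.

Let q0 : 0 < q. Proof. by apply: lt_le_trans q1. Qed.
Let tail_pos := tail_gt0 q1 mb b0 m0 qm tail_fin.

Lemma dual_weightE s : 0 < s -> dual_weight q b s = b s `^ (1 - q) * tail b q s.
Proof.
move=> s0; rewrite /dual_weight /tail s0; congr (_ `^ _ * _).
by rewrite mulrBr mulr1 divff ?opprB// gt_eqF.
Qed.

Lemma dual_weight_gt0 s : 0 < s -> 0 < dual_weight q b s.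
Proof.
move=> s0; rewrite dual_weightE// mulr_gt0 ?powR_gt0 ?b0//.
exact: tail_pos.
Qed.

Lemma measurable_dual_weight : measurable_fun pos (dual_weight q b : lebT -> R).
Proof.
apply: (eq_measurable_fun (fun s : lebT => b s `^ (1 - q) * tail b q s)).
  by move=> s; rewrite inE/= in_itv/= andbT => s0; rewrite dual_weightE.
apply: (measurable_funM (measurableT_comp (measurable_powR _) mb)).
by apply: measurable_funTS; exact: measurable_tail.
Qed.

Lemma dual_weight_lower : exists2 c : R, 0 < c &
  forall s, 0 < s -> c * b s <= dual_weight q b s.
Proof.
have [c c0 hc] := tail_lower q1 mb b0 m0 qm tail_fin.
exists c => // s s0; rewrite dual_weightE//.
have bs := b0 s0.
have -> : c * b s = b s `^ (1 - q) * (c * b s `^ q).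
  by rewrite mulrCA powR_mul// subrK powRr1// ltW.
by rewrite ler_wpM2l ?powR_ge0// hc.
Qed.

(** The dual weight is made for this identity: the J-norm has the weight
[W ^ q * w ^ (1 - q)] that Hardy's inequality with the density [w] produces. *)
Lemma energy_dual_weightE (j : R -> R) : (forall s, 0 < s -> 0 <= j s) ->
  energy q (dual_weight q b) j =
  (\int[leb]_(s in `]0%R, +oo[)
    (tail b q s `^ q * density b q s `^ (1 - q) * (s^-1 * j s) `^ q)%:E)%E.
Proof.
move=> j0; apply: eq_integral => s; rewrite inE/= in_itv/= andbT => s0.
have bs := b0 s0; have ts := tail_pos s0; have js := j0 s s0.
have is0 : 0 < s^-1 by rewrite invr_gt0.
congr EFin; rewrite dual_weightE// /density s0.
rewrite [(_ * tail b q s) `^ q]powRM ?powR_ge0 ?(ltW ts)//.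
rewrite [(_ * b s `^ q) `^ (1 - q)]powRM ?powR_ge0 ?(ltW is0)//.
rewrite [(_ * j s) `^ q]powRM ?(ltW is0)// -!powRrM.
have {1}-> : s^-1 = s^-1 `^ (1 - q) * s^-1 `^ q.
  by rewrite powR_mul// subrK powRr1// ltW.
have -> : (1 - q) * q = q * (1 - q) by rewrite mulrC.
by ring.
Qed.

(** [K (u s) t <= min 1 (t / s) * J (u s) s], where the left bound puts [u s] into the
first space and the right one into the second. *)
Lemma Kfun_le_integral (E : topologicalLmodType R) (C : compatible_couple E)
    f (u : R -> cap_space C) t : 0 < t -> J_representations C f u ->
  ((Kfun C f t)%:E <=
    \int[leb]_(s in `]0%R, t[) (s^-1 * Jfun (u s) s)%:E +
    t%:E * \int[leb]_(s in `]t, +oo[) (s `^ (-2) * Jfun (u s) s)%:E)%E.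
Proof.
move=> t0 [su [g gf gI]].
pose j s := Jfun (u s) s.
have mpos : measurable pos by exact: leb_measurable_itv.
have mj : measurable_fun pos (j : lebT -> R) by exact: measurable_Jfun.
have j0 s : 0 <= j s by exact: Jfun_ge0.
have t0' := ltW t0.
pose k s := Kfun C (val (s^-1 *: cap_to_sum (u s))) t.
have kE s : 0 < s -> k s = s^-1 * Kfun C (val (cap_to_sum (u s))) t.
  move=> s0; rewrite /k linearZ KfunZ//; last by rewrite invr_ge0 ltW.
  exact: valP.
pose f1 s := if 0 < s then s^-1 * j s else 0.
pose f2 s := if 0 < s then s `^ (-2) * j s else 0.
pose F s := if s < t then f1 s else t * f2 s.
have mt r : measurable_fun pos (fun s : lebT => (s : R) `^ r).
  by apply: measurable_funTS; exact: measurable_powR_lebT.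
have mf1 : measurable_fun [set: lebT] (f1 : lebT -> R).
  apply: (@measurable_patch_pos R (fun s => s^-1 * j s)).
  apply: (eq_measurable_fun (fun s : lebT => (s : R) `^ (-1) * j s)).
    move=> s; rewrite inE/= in_itv/= andbT => s0.
    by rewrite powR_inv1// ltW.
  exact: (measurable_funM (mt _) mj).
have mf2 : measurable_fun [set: lebT] (f2 : lebT -> R).
  apply: (@measurable_patch_pos R (fun s => s `^ (-2) * j s)).
  exact: (measurable_funM (mt _) mj).
have f10 s : 0 <= f1 s.
  by rewrite /f1; case: ifPn => // s0; rewrite mulr_ge0// invr_ge0 ltW.
have f20 s : 0 <= f2 s.
  by rewrite /f2; case: ifPn => // s0; rewrite mulr_ge0// powR_ge0.
have F0 s : 0 <= F s by rewrite /F; case: ifP => // _; rewrite mulr_ge0.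
have mF : measurable_fun [set: lebT] (F : lebT -> R).
  apply: measurable_fun_ifT; last 2 first.
  - exact: mf1.
  - exact: (measurable_funM (measurable_cst _) mf2).
  exact: (measurable_fun_ltr (@measurable_id_lebT R) (measurable_cst _)).
have kF s : pos s -> k s <= F s.
  rewrite /= in_itv/= andbT => s0; rewrite kE// /F /f1 /f2 s0.
  have is0 : 0 < s^-1 by rewrite invr_gt0.
  case: ifPn => _.
    rewrite ler_pM2l//; apply: (le_trans (Kfun_cap_le1 _ t0')).
    by rewrite /j /Jfun le_max lexx.
  have -> : t * (s `^ (-2) * j s) = s^-1 * (t * (s^-1 * j s)).
    by rewrite powR_invn ?(ltW s0)//; field; rewrite gt_eqF.
  rewrite ler_pM2l//; apply: (le_trans (Kfun_cap_le2 _ t0')).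
  rewrite ler_pM2l// -ler_pdivrMl// invrK.
  by rewrite /j /Jfun le_max lexx orbT.
apply: (@le_trans _ _ (\int[leb]_(s in `]0%R, +oo[) (F s)%:E)%E).
  rewrite -gf.
  apply: (@seminorm_bochner_le _ lebT R leb
    completed_lebesgue_measure_is_complete _ pos _ g
    (fun g => Kfun C (val g) t) (Num.max 1 t) F mpos _ _ _ _ _ _ _ kF gI).
  - by rewrite le_max ler01.
  - by move=> x; apply: Kfun_ge0 => //; exact: valP.
  - by move=> x y; apply: KfunD => //; exact: valP.
  - by move=> a x a0; apply: KfunZ => //; exact: valP.
  - by move=> x; exact: KfunN.
  - by move=> x; exact: Kfun_le_norm.
  - exact: measurable_funTS.
have mh : measurable (`]0, t[%classic : set lebT) by exact: leb_measurable_itv.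
have mc : measurable (`[t, +oo[%classic : set lebT) by exact: leb_measurable_itv.
have mo : measurable (`]t, +oo[%classic : set lebT) by exact: leb_measurable_itv.
have mFE : measurable_fun [set: lebT] (fun s : lebT => (F s)%:E).
  exact/measurable_EFinP.
have FE0 s : (0 <= (F s)%:E)%E by rewrite lee_fin.
have posE : pos = `]0, t[%classic `|` `[t, +oo[%classic.
  apply/seteqP; split=> s; rewrite /= !in_itv/= ?andbT.
    by move=> s0; case: (ltP s t) => st; [left; rewrite s0|right].
  by move=> [/andP[]//|]; apply: lt_le_trans.
rewrite [X in integral _ X _]posE ge0_integral_setU; last 5 first.
- exact: mh.
- exact: mc.
- exact: measurable_funTS.
- by move=> s _; exact: FE0.
- apply/disj_setPLR => s /=; rewrite !in_itv/= andbT => /andP[_ st] ts.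
  by have := lt_le_trans st ts; rewrite ltxx.
apply: leeD.
  rewrite le_eqVlt; apply/orP; left; apply/eqP; apply: eq_integral => s.
  by rewrite inE/= in_itv/= => /andP[s0 st]; rewrite /F st /f1 s0.
have tE0 : (0 <= t) by exact: ltW.
apply: (@le_trans _ _ (\int[leb]_(s in `]t, +oo[) (F s)%:E)%E).
  apply: ge0_integral_lebD1; [exact: mc|exact: mFE|exact: FE0|].
  move=> s; rewrite /= !in_itv/= !andbT le_eqVlt => /orP[/eqP|]; by [right|left].
rewrite (eq_integral (fun s : lebT => (t * f2 s)%:E)); last first.
  move=> s; rewrite inE/= in_itv/= andbT => ts.
  by rewrite /F ltNge (ltW ts).
rewrite (ge0_integralZl_EFinM leb mo mf2 tE0 f20).
apply: lee_wpmul2l => //.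
rewrite le_eqVlt; apply/orP; left; apply/eqP; apply: eq_integral => s.
by rewrite inE/= in_itv/= andbT => ts; rewrite /f2 (lt_trans t0 ts).
Qed.

Let poweRD_le (x y : \bar R) : (0 <= x)%E -> (0 <= y)%E ->
  ((x + y) `^ q <= (2 `^ q)%:E * (x `^ q + y `^ q))%E.
Proof.
wlog xy : x y / (x <= y)%E => [wl x0 y0|x0 y0].
  have [/wl|/ltW/wl] := leP x y; first exact.
  by rewrite addeC (addeC (x `^ q)%E); apply.
have q0' := ltW q0.
apply: (@le_trans _ _ ((2%:E * y) `^ q)%E).
  apply: (gt0_ler_poweR q0'); rewrite ?in_itv/= ?leey ?andbT.
  - exact: adde_ge0.
  - by rewrite mule_ge0// lee_fin.
  - by rewrite (_ : 2%:E = 1 + 1)%E// ge0_muleDl ?lee_fin// !mul1e leeD2r.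
rewrite poweRM ?lee_fin// poweR_EFin lee_wpmul2l ?lee_fin ?powR_ge0//.
by rewrite leeDr// poweR_ge0.
Qed.

(** Hardy's inequality applied to the first term of [Kfun_le_integral], the dual one
to the second, and [c * b <= dual_weight q b] to return to the dual weight. *)
Theorem energy_Kfun_le_Jfun : exists2 c : R, 0 < c &
  forall (E : topologicalLmodType R) (C : compatible_couple E)
    f (u : R -> cap_space C), J_representations C f u ->
  (energy q b (Kfun C f) <=
    c%:E * energy q (dual_weight q b) (fun t => Jfun (u t) t))%E.
Proof.
have md := measurable_density q mb.
have d0 := density_ge0 b q.
have dp := density_gt0 q b0.
have mt := measurable_tail mb tail_fin.
have tn := tail_nonincreasing mb tail_fin.
have tE x : 0 < x ->
    (\int[leb]_(s in `]x, +oo[) (density b q s)%:E <= (tail b q x)%:E)%E.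
  by move=> x0; rewrite (tailE tail_fin x0).
have [c1 c10 h1] := weighted_hardy q1 md d0 dp mt tail_pos tn tE.
have [c2 c20 h2] := dual_hardy q1 m0 mb b0 qm.
have [c3 c30 h3] := dual_weight_lower.
have c3q : 0 < c3 `^ q by exact: powR_gt0.
exists (2 `^ q * (c1 + c2 / c3 `^ q)).
  by rewrite mulr_gt0 ?powR_gt0// addr_gt0// divr_gt0.
move=> E C f u uf.
pose j s := Jfun (u s) s.
have j0 s : 0 <= j s by exact: Jfun_ge0.
have mpos : measurable pos by exact: leb_measurable_itv.
have mj : measurable_fun pos (j : lebT -> R).
  by apply: measurable_Jfun => //; have [] := uf.
have fC : f \in in_sum C by have [_ [g <- _]] := uf; exact: valP.
have mp r : measurable_fun pos (fun s : lebT => (s : R) `^ r).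
  by apply: measurable_funTS; exact: measurable_powR_lebT.
have msj : measurable_fun pos (fun s : lebT => (s : R)^-1 * j s).
  apply: (eq_measurable_fun (fun s : lebT => (s : R) `^ (-1) * j s)).
    move=> s; rewrite inE/= in_itv/= andbT => s0.
    by rewrite powR_inv1// ltW.
  exact: (measurable_funM (mp _) mj).
have sj0 s : 0 < s -> 0 <= s^-1 * j s.
  by move=> s0; rewrite mulr_ge0// invr_ge0 ltW.
have ms2j : measurable_fun pos (fun s : lebT => (s : R) `^ (-2) * j s).
  exact: (measurable_funM (mp _) mj).
have s2j0 s : 0 < s -> 0 <= s `^ (-2) * j s.
  by move=> s0; rewrite mulr_ge0// powR_ge0.
pose H (t : lebT) := (\int[leb]_(s in `]0%R, t[) (s^-1 * j s)%:E)%E.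
pose G (t : lebT) :=
  (\int[leb]_(s in `](t : R), +oo[) (s `^ (-2) * j s)%:E)%E.
have mH : measurable_fun pos H.
  by apply: measurable_funTS; exact: measurable_head_integral msj sj0.
have mG : measurable_fun pos G by exact: measurable_tail_integral ms2j s2j0.
have H0 t : (0 <= H t)%E.
  apply: integral_ge0 => s; rewrite /= in_itv/= => /andP[s0 _].
  by rewrite lee_fin sj0.
have G0 (t : lebT) : pos t -> (0 <= G t)%E.
  rewrite /= in_itv/= andbT => t0.
  apply: integral_ge0 => s; rewrite /= in_itv/= andbT => ts.
  by rewrite lee_fin s2j0// (lt_trans t0 ts).
have mpq (g : lebT -> \bar R) : measurable_fun pos g ->
    measurable_fun pos (fun t => g t `^ q)%E.
  by move=> mg; exact: (measurableT_comp (measurable_poweR q) mg).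
have mw : measurable_fun pos (fun t : lebT => (density b q t)%:E).
  by apply/measurable_EFinP; exact: measurable_funTS.
have mbq r : measurable_fun pos (fun s : lebT => b s `^ r).
  exact: (measurableT_comp (measurable_powR r) mb).
have mG1 : measurable_fun pos (fun t : lebT =>
    ((t : R) `^ (q - 1) * b t `^ q)%:E).
  by apply/measurable_EFinP; exact: (measurable_funM (mp _) (mbq _)).
pose P1 (t : lebT) := ((density b q t)%:E * H t `^ q)%E.
pose P2 (t : lebT) := (((t : R) `^ (q - 1) * b t `^ q)%:E * G t `^ q)%E.
have mP1 : measurable_fun pos P1 by exact: emeasurable_funM mw (mpq _ mH).
have mP2 : measurable_fun pos P2 by exact: emeasurable_funM mG1 (mpq _ mG).
have P10 t : pos t -> (0 <= P1 t)%E.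
  by move=> _; rewrite mule_ge0 ?lee_fin ?poweR_ge0.
have P20 t : pos t -> (0 <= P2 t)%E.
  by move=> _; rewrite mule_ge0 ?poweR_ge0// lee_fin mulr_ge0 ?powR_ge0.
have P0 t : pos t -> (0 <= P1 t + P2 t)%E.
  by move=> pt; exact: adde_ge0 (P10 t pt) (P20 t pt).
have mP : measurable_fun pos (fun t => P1 t + P2 t)%E.
  exact: emeasurable_funD.
have p2q : (0 <= (2 `^ q)%:E :> \bar R)%E by rewrite lee_fin powR_ge0.
have step : (energy q b (Kfun C f) <=
    (2 `^ q)%:E * (\int[leb]_(t in pos) P1 t + \int[leb]_(t in pos) P2 t))%E.
  rewrite -(ge0_integralD leb mpos P10 mP1 P20 mP2).
  rewrite -(ge0_integralZl leb mpos mP P0 p2q).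
  apply: ge0_le_integral.
  - exact: mpos.
  - move=> t; rewrite /= in_itv/= andbT => t0.
    by rewrite lee_fin !mulr_ge0 ?powR_ge0// invr_ge0 ltW.
  - apply/measurable_EFinP.
    apply: (eq_measurable_fun (fun t : lebT =>
        density b q t * Kfun C f t `^ q)).
      move=> s; rewrite inE/= in_itv/= andbT => s0.
      by rewrite /density s0.
    apply: (measurable_funM (measurable_funTS md)).
    exact: (measurableT_comp (measurable_powR _) (measurable_Kfun fC)).
  - exact: emeasurable_funM (measurable_cst _) mP.
  - move=> t pt; have t0 : 0 < t by move: pt; rewrite /= in_itv/= andbT.
    have K0 : 0 <= Kfun C f t by apply: Kfun_ge0 => //; exact: ltW.
    have := Kfun_le_integral t0 uf; rewrite -/(H t) -/(G t) => KHG.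
    have tG0 : (0 <= t%:E * G t)%E by rewrite mule_ge0 ?G0// lee_fin ltW.
    have Kq : ((Kfun C f t `^ q)%:E <=
        (2 `^ q)%:E * (H t `^ q + (t%:E * G t) `^ q))%E.
      rewrite -poweR_EFin; apply: le_trans (poweRD_le (H0 t) tG0).
      apply: (gt0_ler_poweR (ltW q0) _ _ KHG); rewrite in_itv/= leey andbT.
        by rewrite lee_fin.
      exact: adde_ge0.
    have -> : (t^-1 * b t `^ q * Kfun C f t `^ q)%:E =
        ((density b q t)%:E * (Kfun C f t `^ q)%:E)%E.
      by rewrite -EFinM /density t0.
    apply: (@le_trans _ _ ((density b q t)%:E *
        ((2 `^ q)%:E * (H t `^ q + (t%:E * G t) `^ q)))%E).
      by apply: lee_wpmul2l => //; rewrite lee_fin.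
    rewrite muleCA le_eqVlt; apply/orP; left; apply/eqP; congr (_ * _)%E.
    rewrite ge0_muleDr ?poweR_ge0//; congr (_ + _)%E.
    rewrite poweRM ?G0 ?lee_fin ?(ltW t0)// poweR_EFin muleA -EFinM.
    congr (_%:E * _)%E; rewrite /density t0 mulrAC; congr (_ * _).
    by rewrite -powR_inv1 ?(ltW t0)// powR_mul// addrC.
apply: (le_trans step); rewrite EFinM -muleA; apply: lee_wpmul2l => //.
rewrite EFinD ge0_muleDl ?lee_fin ?(ltW c10) ?divr_ge0 ?(ltW c20) ?(ltW c3q)//.
apply: leeD.
  rewrite energy_dual_weightE; first exact: (h1 _ msj sj0).
  by move=> s _; exact: j0.
have j0' s : 0 < s -> 0 <= j s by [].
apply: (le_trans (h2 j mj j0')).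
rewrite EFinM -muleA; apply: lee_wpmul2l; first by rewrite lee_fin ltW.
rewrite lee_pdivlMl// -ge0_integralZl; last 4 first.
- exact: mpos.
- apply/measurable_EFinP; apply: (measurable_funM _
    (measurableT_comp (measurable_powR _) mj)).
  apply: (eq_measurable_fun (fun t : lebT => density b q t)).
    by move=> s; rewrite inE/= in_itv/= andbT => s0; rewrite /density s0.
  exact: measurable_funTS.
- move=> t; rewrite /= in_itv/= andbT => t0.
  by rewrite lee_fin !mulr_ge0 ?powR_ge0// invr_ge0 ltW.
- by rewrite lee_fin ltW.
have mA : measurable_fun pos (fun t : lebT =>
    (t : R)^-1 * dual_weight q b t `^ q * j t `^ q).
  apply: (eq_measurable_fun (fun t : lebT =>
      (t : R) `^ (-1) * dual_weight q b t `^ q * j t `^ q)).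
    move=> s; rewrite inE/= in_itv/= andbT => s0.
    by rewrite powR_inv1// ltW.
  apply: (measurable_funM (measurable_funM (mp _) _)
    (measurableT_comp (measurable_powR _) mj)).
  exact: (measurableT_comp (measurable_powR _) measurable_dual_weight).
apply: ge0_le_integral.
- exact: mpos.
- move=> t; rewrite /= in_itv/= andbT => t0.
  rewrite mule_ge0// lee_fin ?(ltW c3q)// !mulr_ge0 ?powR_ge0//.
  by rewrite invr_ge0 ltW.
- apply/measurable_EFinP; apply: (measurable_funM (measurable_cst _)).
  apply: (measurable_funM _ (measurableT_comp (measurable_powR _) mj)).
  apply: (eq_measurable_fun (fun t : lebT => density b q t)).
    by move=> s; rewrite inE/= in_itv/= andbT => s0; rewrite /density s0.
  exact: measurable_funTS.
- by apply/measurable_EFinP.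
- move=> t; rewrite /= in_itv/= andbT => t0; rewrite -EFinM lee_fin.
  have bt := b0 t0.
  have -> : c3 `^ q * (t^-1 * b t `^ q * j t `^ q) =
      t^-1 * (c3 * b t) `^ q * j t `^ q.
    by rewrite powRM ?(ltW c30) ?(ltW bt)//; ring.
  rewrite ler_wpM2r ?powR_ge0// ler_pM2l ?invr_gt0//.
  apply: (ge0_ler_powR (ltW q0)); rewrite ?nnegrE.
  + exact: mulr_ge0 (ltW c30) (ltW bt).
  + by apply: ltW; exact: dual_weight_gt0.
  + exact: h3.
Qed.

End K_below_J.

(** * Construction of a J-representation from the K-functional *)

Section J_below_K.
Context (R : realType).
Local Notation leb := (@completed_lebesgue_measure R).
Local Notation lebT := (caratheodory_type (@wlength R idfun)^*%mu).
Local Notation pos := (`]0, +oo[%classic : set lebT).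

Variables (b : R -> R) (q m : R).
Hypothesis q1 : 1 <= q.
Hypothesis mb : measurable_fun pos (b : lebT -> R).
Hypothesis b0 : forall t, 0 < t -> 0 < b t.
Hypothesis m0 : 0 < m.
Hypothesis qm : forall s t, 0 < s -> s <= t ->
    s `^ 2^-1 * b s <= m * (t `^ 2^-1 * b t).
Hypothesis tail_fin : forall x, 0 < x -> (tail_integral q b x < +oo)%E.

Let q0 : 0 < q. Proof. by apply: lt_le_trans q1. Qed.
Let tail_pos := tail_gt0 q1 mb b0 m0 qm tail_fin.

Let mpos : measurable pos. Proof. exact: leb_measurable_itv. Qed.

Let mp r : measurable_fun pos (fun s : lebT => (s : R) `^ r).
Proof. by apply: measurable_funTS; exact: measurable_powR_lebT. Qed.

Let md : measurable_fun [set: lebT] (density b q : lebT -> R).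
Proof. exact: measurable_density. Qed.

Lemma energy_density (h : R -> R) : energy q b h =
  (\int[leb]_(t in `]0%R, +oo[) (density b q t * h t `^ q)%:E)%E.
Proof.
apply: eq_integral => t; rewrite inE/= in_itv/= andbT => t0.
by rewrite /density t0.
Qed.

(** [K f] is non-decreasing, so [K f x ^ q * W x] is at most the energy, and [W x] is
at least a multiple of [x ^ (- q/2)]. *)
Lemma Kfun_growth (E : topologicalLmodType R) (C : compatible_couple E) f :
  f \in in_sum C -> (energy q b (Kfun C f) < +oo)%E ->
  exists2 D : R, 0 <= D & forall x, 1 <= x -> Kfun C f x <= D * x `^ 2^-1.
Proof.
move=> fC efin.
have [c c0 hc] := tail_lower_powR q1 mb b0 m0 qm tail_fin.
pose N := fine (energy q b (Kfun C f)).
have NE : N%:E = energy q b (Kfun C f).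
  by rewrite fineK// ge0_fin_numE// energy_ge0.
have N0 : 0 <= N by rewrite -lee_fin NE energy_ge0.
exists ((N / c) `^ q^-1); first exact: powR_ge0.
move=> x x1; have x0 : 0 < x by exact: lt_le_trans x1.
have K0 : 0 <= Kfun C f x by apply: Kfun_ge0 => //; exact: ltW.
have mo : measurable (`]x, +oo[%classic : set lebT) by exact: leb_measurable_itv.
have Kq0 : 0 <= Kfun C f x `^ q by exact: powR_ge0.
have mK : measurable_fun pos (fun t : lebT => density b q t * Kfun C f t `^ q).
  apply: (measurable_funM (measurable_funTS md)).
  exact: (measurableT_comp (measurable_powR _) (measurable_Kfun fC)).
have sub : (`]x, +oo[%classic `<=` pos)%classic.
  by move=> t; rewrite /= !in_itv/= !andbT; exact: lt_trans.
have KW : Kfun C f x `^ q * tail b q x <= N.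
  rewrite -lee_fin NE EFinM (tailE tail_fin x0).
  rewrite -(ge0_integralZl_EFinM leb mo md Kq0 (density_ge0 b q)) energy_density.
  apply: (@le_trans _ _ (\int[leb]_(t in `]x, +oo[)
      (density b q t * Kfun C f t `^ q)%:E)%E); last first.
    apply: ge0_subset_integral.
    - exact: mo.
    - exact: mpos.
    - by apply/measurable_EFinP.
    - by move=> t _; rewrite lee_fin mulr_ge0 ?powR_ge0// density_ge0.
    - exact: sub.
  apply: ge0_le_integral.
  - exact: mo.
  - by move=> t _; rewrite lee_fin mulr_ge0// density_ge0.
  - apply/measurable_EFinP; apply: measurable_funTS.
    exact: (measurable_funM (measurable_cst _) md).
  - by apply/measurable_EFinP; exact: (measurable_funS mpos sub mK).
  - move=> t; rewrite /= in_itv/= andbT => xt; rewrite lee_fin mulrC.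
    apply: ler_wpM2l; first exact: density_ge0.
    have KK : Kfun C f x <= Kfun C f t.
      by apply: Kfun_nondecreasing => //; exact: ltW.
    by apply: (ge0_ler_powR (ltW q0)); rewrite ?nnegrE//; exact: le_trans KK.
have xq0 : 0 < x `^ 2^-1 by exact: powR_gt0.
rewrite -ler_pdivrMr//.
have Kx0 : 0 <= Kfun C f x / x `^ 2^-1 by rewrite divr_ge0// ltW.
have iq : 0 <= q^-1 by rewrite invr_ge0 ltW.
rewrite -[leLHS](powRr1 Kx0) -[X in _ `^ X](divff (lt0r_neq0 q0)) powRrM.
apply: (ge0_ler_powR iq); rewrite ?nnegrE ?powR_ge0//.
  by rewrite divr_ge0// ltW.
rewrite ler_pdivlMr//; apply: le_trans KW.
rewrite powRM ?invr_ge0 ?(ltW xq0)// -mulrA ler_wpM2l//.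
apply: le_trans (hc x x1).
rewrite mulrC ler_wpM2l ?(ltW c0)//.
rewrite -powR_inv1 ?(ltW xq0)// -!powRrM.
by rewrite le_eqVlt; apply/orP; left; apply/eqP; congr (_ `^ _); lra.
Qed.

(** The lower bound [c * x ^ (- q/2) <= W x] read at [x_ k], where [W] is halved at
each step. *)
Lemma halving_sequence_decay (x_ : nat -> R) :
  (forall k, 1 <= x_ k) -> (forall k, tail b q (x_ k) = tail b q 1 * 2^-1 ^+ k) ->
  exists r D : R, [/\ 0 < r, r < 1, 0 <= D &
    forall k, (x_ k) `^ (- 2^-1) <= D * r ^+ k].
Proof.
move=> x1 xE.
have [c c0 hc] := tail_lower_powR q1 mb b0 m0 qm tail_fin.
have t1 := tail_pos ltr01.
have iq : 0 < q^-1 by rewrite invr_gt0.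
exists (2^-1 `^ q^-1), ((tail b q 1 / c) `^ q^-1); split.
- by rewrite powR_gt0.
- exact: powRhalf_lt1.
- exact: powR_ge0.
move=> k; have x0 : 0 < x_ k by exact: lt_le_trans (x1 k).
have h : x_ k `^ (- (q / 2)) <= (tail b q 1 / c) * 2^-1 ^+ k.
  by rewrite mulrAC ler_pdivlMr// mulrC -xE; exact: hc.
rewrite -powR_mulrn ?powR_ge0// -powRrM mulrC [q^-1 * _]mulrC powRrM.
rewrite powR_mulrn ?invr_ge0// mulrC -powRM ?divr_ge0 ?exprn_ge0 ?invr_ge0
  ?(ltW t1) ?(ltW c0)//.
have -> : - 2^-1 = - (q / 2) * q^-1 :> R.
  by field; rewrite gt_eqF.
rewrite powRrM; apply: (ge0_ler_powR (ltW iq)); rewrite ?nnegrE ?powR_ge0//.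
by rewrite mulr_ge0 ?divr_ge0 ?exprn_ge0 ?invr_ge0 ?(ltW t1) ?(ltW c0).
Qed.

Section construction.
Variable x_ : nat -> R.
Hypothesis x_0 : x_ 0%N = 1.
Hypothesis x_tail : forall k, tail b q (x_ k) = tail b q 1 * 2^-1 ^+ k.
Hypothesis x_incr : forall k, x_ k < x_ k.+1.
Hypothesis x_unbounded : forall s, exists k, s <= x_ k.

Let x_mono : {homo x_ : i j / (i <= j)%N >-> i <= j}.
Proof. by apply/nondecreasing_seqP => k; exact: ltW. Qed.

Let x_ge1 k : 1 <= x_ k. Proof. by rewrite -x_0 x_mono. Qed.
Let x_gt0 k : 0 < x_ k. Proof. exact: lt_le_trans (x_ge1 k). Qed.

Let mass (k : nat) : R := tail b q 1 * 2^-1 ^+ k.+1.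
Let mass_gt0 k : 0 < mass k.
Proof. by rewrite mulr_gt0 ?tail_pos// exprn_gt0. Qed.

Let block (k : nat) : set R := `]x_ k, x_ k.+1]%classic.
Let mblock k : measurable (block k : set lebT).
Proof. exact: leb_measurable_itv. Qed.

Let integral_block k :
  (\int[leb]_(t in block k) (density b q t)%:E = (mass k)%:E)%E.
Proof.
have := tail_split mb tail_fin (x_gt0 k) (ltW (x_incr k)).
rewrite !x_tail => h.
transitivity ((tail b q 1 * 2^-1 ^+ k)%:E - (tail b q 1 * 2^-1 ^+ k.+1)%:E)%E.
  by rewrite h addeK.
by rewrite -EFinB; congr EFin; rewrite /mass exprS; field.
Qed.

Lemma index_ex : exists e : R -> nat, forall s, (s <= 1 -> e s = 0%N) /\
  (1 < s -> block (e s) s).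
Proof.
suff /choice[e eP] : forall s, exists k : nat, (s <= 1 -> k = 0%N) /\
    (1 < s -> block k s) by exists e.
move=> s; have [s1|s1] := leP s 1; first by exists 0%N.
have ex := x_unbounded s.
have [k sk mk] := ex_minnP ex.
case: k sk mk => [|k] sk mk; first by move: sk; rewrite x_0 leNgt s1.
exists k; split => // _; rewrite /block/= in_itv/= sk andbT ltNge.
by apply/negP => /mk; rewrite ltnn.
Qed.

Let block_inj i j s : block i s -> block j s -> i = j.
Proof.
rewrite /block/= !in_itv/= => /andP[is_ si] /andP[js sj].
apply/eqP; rewrite eqn_leq; apply/andP; split; rewrite leqNgt; apply/negP => ij.
- by have := lt_le_trans is_ (le_trans sj (x_mono ij)); rewrite ltxx.
- by have := lt_le_trans js (le_trans si (x_mono ij)); rewrite ltxx.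
Qed.

Variables (e : R -> nat).
Hypothesis e_le1 : forall s, s <= 1 -> e s = 0%N.
Hypothesis e_gt1 : forall s, 1 < s -> block (e s) s.

Let e_block k s : block k s -> 1 < s /\ e s = k.
Proof.
move=> bs; have s1 : 1 < s.
  move: bs; rewrite /block/= in_itv/= => /andP[xs _].
  exact: le_lt_trans (x_ge1 k) xs.
by split => //; apply: block_inj (e_gt1 s1) bs.
Qed.

Let measurable_e_fiber k : measurable (e @^-1` [set k] : set lebT).
Proof.
have [->|k0] := eqVneq k 0%N.
  have -> : e @^-1` [set 0%N] = `]-oo, x_ 1%N]%classic.
    apply/seteqP; split=> s; rewrite /= in_itv/=.
      have [s1 _|s1] := leP s 1; first exact: le_trans (x_ge1 1).
      by move=> es; have := e_gt1 s1; rewrite es /block/= in_itv/= => /andP[].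
    have [s1 _|s1 sx] := leP s 1; first exact: e_le1.
    by apply: (e_block _).2; rewrite /block/= in_itv/= x_0 s1.
  exact: leb_measurable_itv.
have -> : e @^-1` [set k] = block k.
  apply/seteqP; split=> s /=; last by move/e_block => [].
  have [/e_le1 -> ek|s1 <-] := leP s 1; last exact: e_gt1.
  by rewrite -ek eqxx in k0.
exact: mblock.
Qed.

(* The density of the weight, normalised on each block; it vanishes below 1. *)
Let omega (s : R) : R := if 1 < s then density b q s / mass (e s) else 0.

Let omega_ge0 s : 0 <= omega s.
Proof.
rewrite /omega; case: ifP => // _.
by rewrite divr_ge0 ?density_ge0// ltW.
Qed.

Let measurable_omega : measurable_fun [set: lebT] (omega : lebT -> R).
Proof.
apply: measurable_fun_ifT; [| |exact: measurable_cst].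
  exact: (measurable_fun_ltr (measurable_cst _) (@measurable_id_lebT R)).
apply: (measurable_funM md).
exact: (@measurable_comp_fibers _ lebT (e : lebT -> nat) measurable_e_fiber _ R
  (fun k => (mass k)^-1) setT measurableT).
Qed.

Let omega_block k : (\int[leb]_(s in (pos `&` e @^-1` [set k])%classic)
  (omega s)%:E = 1)%E.
Proof.
have mk0 : 0 <= (mass k)^-1 by rewrite invr_ge0 ltW.
transitivity (\int[leb]_(s in block k) ((mass k)^-1 * density b q s)%:E)%E.
  rewrite integral_mkcond [RHS]integral_mkcond; apply: eq_integral => s _.
  rewrite !patchE; have [sb|nsb] := boolP (s \in block k).
    move: sb; rewrite inE => sb; have [s1 es] := e_block sb.
    rewrite mem_set; last first.
      by split => //=; rewrite in_itv/= andbT (lt_trans ltr01 s1).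
    by rewrite /omega s1 es mulrC.
  case: ifPn => //; rewrite inE => -[_ /= es].
  rewrite /omega; case: ifPn => // s1.
  by move/negP: nsb; case; rewrite inE -es; exact: e_gt1.
rewrite (ge0_integralZl_EFinM leb (mblock k) md mk0 (density_ge0 b q)).
by rewrite integral_block -EFinM mulVf// gt_eqF.
Qed.

Variables (E : topologicalLmodType R) (C : compatible_couple E) (f : E).
Local Notation S := (sum_couple C).
Hypothesis fC : f \in in_sum C.
Hypothesis Kfin : (energy q b (Kfun S f) < +oo)%E.

Let fS : f \in in_sum S. Proof. by rewrite in_sum_couple. Qed.
Let K k := Kfun S f (x_ k).
Let K_ge0 k : 0 <= K k.
Proof. by apply: Kfun_ge0 => //; exact: ltW. Qed.
Let K_mono i j : (i <= j)%N -> K i <= K j.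
Proof.
by move=> ij; apply: Kfun_nondecreasing => //; [exact: ltW|exact: x_mono].
Qed.

(* The factor 2 is the one of near optimality.  The factor [x_ 1] pays for the
   choice of the piece of index 0, which is optimal at 1 and not at [x_ 1]. *)
Let M := 2 * x_ 1%N.
Let M_ge0 : 0 <= M. Proof. by rewrite mulr_ge0// ltW. Qed.

Lemma pieces_ex : exists y : nat -> X0 S * X1 S, forall k,
  [/\ decompositions S f (y k),
      `|(y k).1| + x_ k.+1 * `|(y k).2| <= M * K k.+1 &
      k = 0%N -> (y k).1 = 0].
Proof.
suff /choice[y yP] : forall k, exists z : X0 S * X1 S,
  [/\ decompositions S f z, `|z.1| + x_ k.+1 * `|z.2| <= M * K k.+1 &
      k = 0%N -> z.1 = 0] by exists y.
case=> [|k]; last first.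
  have [z fz zK] := Kfun_near_optimal fS (x_gt0 k.+2).
  exists z; split => //; apply: (le_trans zK).
  rewrite ler_wpM2r//; first exact: K_ge0.
  by rewrite /M ler_peMr// x_ge1.
exists (0, Sub f fC); split => //.
  by rewrite /decompositions /= raddf0 add0r.
rewrite /= normr0 add0r -Kfun_sum_norm SubK.
have -> : Kfun C f 1 = Kfun S f 1.
  by rewrite Kfun_sum_couple_ge1.
have K01 : Kfun S f 1 <= K 1%N.
  by apply: Kfun_nondecreasing => //; exact: x_ge1.
rewrite /M -mulrA mulr_natl mulr2n -[leLHS]addr0; apply: lerD.
  by rewrite ler_pM2l.
by rewrite mulr_ge0// ltW.
Qed.

Variable y : nat -> X0 S * X1 S.
Hypothesis y_dec : forall k, decompositions S f (y k).
Hypothesis y_le : forall k, `|(y k).1| + x_ k.+1 * `|(y k).2| <= M * K k.+1.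
Hypothesis y_0 : (y 0%N).1 = 0.

Let y1_le k : `|(y k).1| <= M * K k.+1.
Proof. by apply: le_trans (y_le k); rewrite lerDl mulr_ge0// ltW. Qed.

Let y2_le k : x_ k.+1 * `|(y k).2| <= M * K k.+1.
Proof. by apply: le_trans (y_le k); rewrite lerDr. Qed.

(* The difference of consecutive first components is the opposite of that of the
   second components, hence it lies in both spaces. *)
Let step k : X0 S * X1 S := ((y k.+1).1 - (y k).1, (y k).2 - (y k.+1).2).

Let step_in_cap k : step k \in @in_cap _ _ S.
Proof.
rewrite unfold_in /step /= !raddfB /=; apply/eqP.
have h1 := y_dec k; have h2 := y_dec k.+1.
rewrite /decompositions /= in h1 h2.
have -> : sval (y k).2 = f - emb0 C (y k).1 by rewrite h1 addrC addKr.
have -> : sval (y k.+1).2 = f - emb0 C (y k.+1).1 by rewrite h2 addrC addKr.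
by rewrite opprB [RHS]addrC subrKA.
Qed.

Let uu k : cap_space S := Sub (step k) (step_in_cap k).

(* Both pieces are nearly optimal at points at least [x_ k.+1]. *)
Let Jfun_uu k : Jfun (uu k) (x_ k.+1) <= 2 * M * K k.+2.
Proof.
have K12 : M * K k.+1 <= M * K k.+2 by rewrite ler_wpM2l// K_mono.
rewrite /Jfun ge_max /= -mulrA; apply/andP; split.
  have := ler_normB (y k.+1).1 (y k).1.
  have := y1_le k; have := y1_le k.+1; lra.
have xx : x_ k.+1 * `|(y k.+1).2| <= x_ k.+2 * `|(y k.+1).2|.
  by rewrite ler_wpM2r// x_mono.
have tri : x_ k.+1 * `|(y k).2 - (y k.+1).2| <=
    x_ k.+1 * (`|(y k).2| + `|(y k.+1).2|).
  by rewrite ler_wpM2l ?(ltW (x_gt0 _))// ler_normB.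
have := y2_le k; have := y2_le k.+1.
by rewrite mulrDr in tri; lra.
Qed.

Let v k := cap_to_sum (uu k).
Let I : sum_space S := Sub f fS.

Let v_le k : `|v k| <= M * (K k.+1 / x_ k.+1 + K k.+2 / x_ k.+2).
Proof.
rewrite -Kfun_sum_norm; apply: (le_trans (Kfun_cap_le2 _ ler01)).
rewrite mul1r /=; apply: (le_trans (ler_normB _ _)); rewrite mulrDr.
by apply: lerD; rewrite mulrA ler_pdivlMr// mulrC.
Qed.

Let series_v n : val (series v n) = emb0 C (y n).1.
Proof.
elim: n => [|n IH].
  by rewrite /series/= big_geq// y_0 !raddf0.
rewrite seriesSr raddfD /= IH /=.
by rewrite raddfB /= addrCA subrr addr0.
Qed.

(* What is left after [n] increments is the second component of [y n]. *)
Let v_remainder n : `|I - series v n| <= M * (K n.+1 / x_ n.+1).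
Proof.
rewrite -Kfun_sum_norm raddfB /= series_v.
have d : decompositions S (f - emb0 C (y n).1) (0, (y n).2).
  rewrite /decompositions /= raddf0 add0r.
  by have := y_dec n; rewrite /decompositions /= => ->; rewrite addrAC subrr add0r.
apply: (le_trans (Kfun_le ler01 d)); rewrite /= normr0 add0r mul1r.
by rewrite mulrA ler_pdivlMr// mulrC.
Qed.

Let K_decay : exists r D : R, [/\ 0 < r, r < 1, 0 <= D &
  forall k, K k / x_ k <= D * r ^+ k].
Proof.
have [D D0 hD] := Kfun_growth fS Kfin.
have [r [D' [r0 r1 D'0 hr]]] := halving_sequence_decay x_ge1 x_tail.
exists r, (D * D'); split; [exact: r0|exact: r1|exact: mulr_ge0|].
move=> k; rewrite ler_pdivrMr//; apply: (le_trans (hD _ (x_ge1 k))).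
rewrite -!mulrA ler_wpM2l//.
apply: (@le_trans _ _ (x_ k `^ (- 2^-1) * x_ k)).
  rewrite -{3}[x_ k]powRr1 ?(ltW (x_gt0 k))// powR_mul//.
  by rewrite le_eqVlt; apply/orP; left; apply/eqP; congr (_ `^ _); lra.
by rewrite mulrA ler_wpM2r// ltW.
Qed.

Let v_summable : cvgn (series (fun k => `|v k|)).
Proof.
have [r [D [r0 r1 D0 hK]]] := K_decay.
have r1' : `|r| < 1 by rewrite ger0_norm// ltW.
apply: (@series_le_cvg _ _ (geometric (M * (2 * D)) r)).
- by move=> n; exact: normr_ge0.
- move=> n; apply: mulr_ge0; last exact: exprn_ge0 (ltW r0).
  by apply: mulr_ge0; [exact: M_ge0|exact: mulr_ge0].
- move=> n; apply: (le_trans (v_le n)); rewrite /= -(mulrA M).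
  apply: ler_wpM2l; first exact: M_ge0.
  have s1 : r ^+ n.+1 <= r ^+ n.
    by rewrite exprS ger_pMl ?exprn_gt0// ltW.
  have s2 : r ^+ n.+2 <= r ^+ n.+1.
    by rewrite [leLHS]exprS ger_pMl ?exprn_gt0// ltW.
  have h1 : D * r ^+ n.+1 <= D * r ^+ n by rewrite ler_wpM2l.
  have h2 : D * r ^+ n.+2 <= D * r ^+ n.
    by rewrite ler_wpM2l// (le_trans s2).
  by have := hK n.+1; have := hK n.+2; lra.
- exact: is_cvg_geometric_series.
Qed.

Let v_cvg : series v @ \oo --> I.
Proof.
have [r [D [r0 r1 D0 hK]]] := K_decay.
have r1' : `|r| < 1 by rewrite ger0_norm// ltW.
apply/cvgrPdist_le => eps eps0.
have g0 : geometric (M * D) r @ \oo --> (0 : R) by exact: cvg_geometric.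
near=> n; apply: (le_trans (v_remainder n)).
apply: (@le_trans _ _ (geometric (M * D) r n)).
  rewrite /= -(mulrA M); apply: ler_wpM2l; first exact: M_ge0.
  apply: (le_trans (hK _)).
  rewrite ler_wpM2l// exprS ger_pMl ?exprn_gt0//; exact: ltW.
near: n; move/cvgr_le : g0; exact.
Unshelve. all: by end_near. Qed.

Let u (s : R) : cap_space S := (s * omega s) *: uu (e s).

Let somega_ge0 s : 0 <= s * omega s.
Proof.
have [s0|s0] := leP 0 s; first by rewrite mulr_ge0.
rewrite /omega ifF ?mulr0//; apply/negbTE; rewrite -leNgt.
by rewrite (le_trans (ltW s0)).
Qed.

Let u_represents : J_representations S f u.
Proof.
split.
  apply: (@strongly_measurable_density _ lebT R leb _ (fun s => s * omega s) e uu).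
  - exact: (measurable_funM (@measurable_id_lebT R) measurable_omega).
  - exact: somega_ge0.
  - exact: measurable_e_fiber.
exists I; first by rewrite SubK.
rewrite (_ : (fun s => _) = (fun s => omega s *: v (e s))).
  exact: (@bochner_density _ lebT R leb _ omega e v measurable_omega omega_ge0
    measurable_e_fiber pos I mpos omega_block v_summable v_cvg).
apply/funext => s; rewrite /u cap_to_sumZ scalerA; congr (_ *: _).
have [s1|s1] := leP s 1; first by rewrite /omega ltNge s1 !mulr0.
by rewrite mulrA mulVf ?mul1r// gt_eqF// (lt_trans ltr01 s1).
Qed.

(* On block [k] the tail is at most twice the mass of the block, which cancels the
   normalisation of [omega]; the powers of [b] combine to [b s]. *)
Let Jfun_u_le s : 1 < s ->
  dual_weight q b s * Jfun (u s) s <= 4 * M * (b s * K (e s).+2).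
Proof.
move=> s1; have s0 : 0 < s := lt_trans ltr01 s1.
set k := e s; have := e_gt1 s1; rewrite -/k /block/= in_itv/= => /andP[xs sx].
have bs := b0 s0; have mk := mass_gt0 k.
have b1q : 0 < b s `^ (1 - q) by exact: powR_gt0.
rewrite (JfunZ _ _ (somega_ge0 s)) (dual_weightE b q1 s0) -/k.
have Ws : tail b q s <= 2 * mass k.
  have -> : 2 * mass k = tail b q (x_ k).
    by rewrite x_tail /mass exprS; field.
  apply: (tail_nonincreasing mb tail_fin); rewrite ?in_itv/= ?andbT//.
  exact: ltW.
have Js : Jfun (uu k) s <= 2 * M * K k.+2.
  exact: le_trans (Jfun_nondecreasing _ sx) (Jfun_uu k).
have so : s * omega s = b s `^ q / mass k.
  rewrite /omega s1 -/k /density s0; field.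
  by rewrite (gt_eqF s0) (gt_eqF mk).
have bq : b s `^ (1 - q) * b s `^ q = b s.
  by rewrite powR_mul// subrK powRr1// ltW.
rewrite so.
apply: (@le_trans _ _ (b s `^ (1 - q) * (2 * mass k) *
    (b s `^ q / mass k * (2 * M * K k.+2)))).
  have c0 : 0 <= b s `^ q / mass k by rewrite divr_ge0 ?powR_ge0// ltW.
  apply: ler_pM.
  - by rewrite mulr_ge0 ?(ltW b1q)// ltW// tail_pos.
  - by rewrite mulr_ge0// Jfun_ge0.
  - by rewrite ler_pM2l.
  - by rewrite ler_wpM2l.
have -> : b s `^ (1 - q) * (2 * mass k) *
    (b s `^ q / mass k * (2 * M * K k.+2)) =
    4 * M * ((b s `^ (1 - q) * b s `^ q) * K k.+2).
  by field; rewrite gt_eqF.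
by rewrite bq.
Qed.

Let mJ : measurable_fun pos (fun s : lebT => Jfun (u s) s).
Proof. by apply: measurable_Jfun => //; have [] := u_represents. Qed.

Let Z (s : R) : R :=
  if 0 < s then s^-1 * dual_weight q b s `^ q * Jfun (u s) s `^ q else 0.

Let mZ : measurable_fun [set: lebT] (Z : lebT -> R).
Proof.
apply: (@measurable_patch_pos R
  (fun s => s^-1 * dual_weight q b s `^ q * Jfun (u s) s `^ q)).
apply: (eq_measurable_fun (fun s : lebT =>
    (s : R) `^ (-1) * dual_weight q b s `^ q * Jfun (u s) s `^ q)).
  move=> s; rewrite inE/= in_itv/= andbT => s0.
  by rewrite powR_inv1// ltW.
have mA := measurable_dual_weight q1 mb tail_fin.
exact: (measurable_funM (measurable_funM (mp _)
  (measurableT_comp (measurable_powR q) mA))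
  (measurableT_comp (measurable_powR q) mJ)).
Qed.

Let Z_ge0 s : 0 <= Z s.
Proof.
rewrite /Z; case: ifPn => // s0.
by rewrite !mulr_ge0 ?powR_ge0// invr_ge0 ltW.
Qed.

Let Z_le1 s : s <= 1 -> Z s = 0.
Proof.
move=> s1; rewrite /Z /u /omega (ltNge 1) s1 mulr0 scale0r.
case: ifP => // _.
have -> : Jfun (0 : cap_space S) s = 0.
  by rewrite -[X in Jfun X](scale0r (0 : cap_space S)) JfunZ// mul0r.
by rewrite powR0 ?mulr0// gt_eqF.
Qed.

Let Z_block k s : block k s ->
  Z s <= (4 * M) `^ q * K k.+2 `^ q * density b q s.
Proof.
move=> bs; have [s1 es] := e_block bs.
have s0 : 0 < s := lt_trans ltr01 s1.
have bs0 := b0 s0.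
have A0 := ltW (dual_weight_gt0 q1 mb b0 m0 qm tail_fin s0).
rewrite /Z s0 /density s0 -mulrA -(powRM _ A0 (Jfun_ge0 (u s) s)).
have M40 : 0 <= 4 * M by apply: mulr_ge0 => //; exact: M_ge0.
have -> : (4 * M) `^ q * K k.+2 `^ q * (s^-1 * b s `^ q) =
    s^-1 * (4 * M * (b s * K k.+2)) `^ q.
  rewrite (powRM _ M40); last exact: mulr_ge0 (ltW bs0) (K_ge0 _).
  by rewrite (powRM _ (ltW bs0) (K_ge0 _)); ring.
rewrite ler_pM2l ?invr_gt0//; apply: (ge0_ler_powR (ltW q0)); rewrite ?nnegrE.
- exact: mulr_ge0 A0 (Jfun_ge0 _ _).
- exact: mulr_ge0 M40 (mulr_ge0 (ltW bs0) (K_ge0 _)).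
- by rewrite -es; exact: Jfun_u_le.
Qed.

Let N (s : R) : R := if 0 < s then density b q s * Kfun S f s `^ q else 0.

Let mN : measurable_fun [set: lebT] (N : lebT -> R).
Proof.
apply: (@measurable_patch_pos R (fun s => density b q s * Kfun S f s `^ q)).
apply: (measurable_funM (measurable_funTS md)).
exact: (measurableT_comp (measurable_powR _) (measurable_Kfun fS)).
Qed.

Let N_ge0 s : 0 <= N s.
Proof.
by rewrite /N; case: ifP => // _; rewrite mulr_ge0 ?powR_ge0// density_ge0.
Qed.

Let c : R := 4 * (4 * M) `^ q.
Let c_ge0 : 0 <= c. Proof. by rewrite mulr_ge0 ?powR_ge0. Qed.

(* Block k carries four times the mass of block k + 2, where K is larger. *)
Let Z_block_integral k : (\int[leb]_(s in block k) (Z s)%:E <=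
  c%:E * \int[leb]_(s in block k.+2) (N s)%:E)%E.
Proof.
have MK0 : 0 <= (4 * M) `^ q * K k.+2 `^ q by rewrite mulr_ge0 ?powR_ge0.
apply: (@le_trans _ _ (\int[leb]_(s in block k)
    ((4 * M) `^ q * K k.+2 `^ q * density b q s)%:E)%E).
  apply: ge0_le_integral_EFin.
  - exact: mblock.
  - exact: mZ.
  - exact: (measurable_funM (measurable_cst _) md).
  - by move=> s _; exact: Z_ge0.
  - by move=> s; exact: Z_block.
rewrite (ge0_integralZl_EFinM leb (mblock k) md MK0 (density_ge0 b q)).
rewrite integral_block.
have -> : (((4 * M) `^ q * K k.+2 `^ q)%:E * (mass k)%:E =
    c%:E * ((K k.+2 `^ q)%:E * (mass k.+2)%:E))%E.
  by rewrite -!EFinM; congr EFin; rewrite /c /mass !exprS; field.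
apply: lee_wpmul2l; first by rewrite lee_fin.
rewrite -integral_block.
rewrite -(ge0_integralZl_EFinM leb (mblock _) md (powR_ge0 _ _) (density_ge0 b q)).
apply: ge0_le_integral_EFin.
- exact: mblock.
- exact: (measurable_funM (measurable_cst _) md).
- exact: mN.
- by move=> s _; rewrite mulr_ge0 ?powR_ge0// density_ge0.
- move=> s; rewrite /block/= in_itv/= => /andP[xs _].
  have s0 : 0 < s by exact: lt_trans xs.
  have KK : K k.+2 <= Kfun S f s.
    by apply: Kfun_nondecreasing => //; exact: ltW.
  rewrite /N s0 mulrC ler_wpM2l ?density_ge0//.
  apply: (ge0_ler_powR (ltW q0)) => //; rewrite nnegrE.
    exact: K_ge0.
  exact: le_trans (K_ge0 _) KK.
Qed.

Let energy_u : (energy q (dual_weight q b) (fun s => Jfun (u s) s) <=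
  c%:E * energy q b (Kfun S f))%E.
Proof.
have mo : measurable (`]1, +oo[%classic : set lebT) by exact: leb_measurable_itv.
rewrite [leLHS](_ : _ = \int[leb]_(s in `]1%R, +oo[) (Z s)%:E)%E; last first.
  rewrite /energy integral_mkcond [RHS]integral_mkcond.
  apply: eq_integral => s _; rewrite !patchE.
  have [s1|s1] := leP s 1.
    rewrite [in RHS]memNset; last by rewrite /= in_itv/= ltNge s1.
    case: ifPn => //; rewrite inE/= in_itv/= andbT => s0.
    by have := Z_le1 s1; rewrite /Z s0 => ->.
  have s0 : 0 < s := lt_trans ltr01 s1.
  rewrite mem_set; last by rewrite /= in_itv/= s0.
  rewrite mem_set; last by rewrite /= in_itv/= s1.
  by rewrite /Z s0.
have mZE : measurable_fun [set: lebT] (fun s : lebT => (Z s)%:E).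
  by apply/measurable_EFinP; exact: mZ.
have ZE0 s : (0 <= (Z s)%:E)%E by rewrite lee_fin Z_ge0.
have cov : (`]1, +oo[%classic `<=` \bigcup_k block k)%classic.
  by move=> s; rewrite /= in_itv/= andbT => /e_gt1 ?; exists (e s).
apply: (le_trans (ge0_integral_cover leb mo mblock mZE ZE0 cov)).
apply: (@le_trans _ _ (\sum_(k <oo)
    c%:E * \int[leb]_(s in block k.+2) (N s)%:E)%E).
  apply: lee_nneseries => [k _ _|k _]; last exact: Z_block_integral.
  by apply: integral_ge0 => s _.
rewrite nneseriesZl; last first.
  by move=> k _; apply: integral_ge0 => s _; rewrite lee_fin N_ge0.
apply: lee_wpmul2l; first by rewrite lee_fin.
have triv : trivIset setT (fun k => block k.+2).
  move=> i j _ _ [s [si sj]].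
  by apply: succn_inj; apply: succn_inj; exact: block_inj si sj.
have mU : measurable (\bigcup_k block k.+2 : set lebT).
  by apply: bigcup_measurable => k _; exact: mblock.
have mNE : measurable_fun [set: lebT] (fun s : lebT => (N s)%:E).
  by apply/measurable_EFinP; exact: mN.
have mNU : measurable_fun (\bigcup_k block k.+2 : set lebT)
    (fun s : lebT => (N s)%:E).
  exact: measurable_funTS.
have NU0 (s : lebT) : (\bigcup_k block k.+2)%classic s -> (0 <= (N s)%:E)%E.
  by move=> _; rewrite lee_fin N_ge0.
rewrite -(ge0_integral_bigcup leb (fun k => mblock k.+2) mNU NU0 triv).
rewrite energy_density.
rewrite [leRHS](_ : _ = \int[leb]_(s in pos) (N s)%:E)%E; last first.
  apply: eq_integral => s; rewrite inE/= in_itv/= andbT => s0.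
  by rewrite /N s0.
apply: ge0_subset_integral_EFin.
- exact: mU.
- exact: mpos.
- exact: mN.
- exact: N_ge0.
- move=> s [k _]; rewrite /block/= !in_itv/= andbT => /andP[xs _].
  exact: lt_trans xs.
Qed.

Lemma construction_correct : exists2 u : R -> cap_space S,
  J_representations S f u &
  (energy q (dual_weight q b) (fun s => Jfun (u s) s) <=
    c%:E * energy q b (Kfun S f))%E.
Proof. by exists u. Qed.

End construction.

(** The points [x_] and the constant depend on the weight alone, hence the bound is
uniform in the couple and in [f]. *)
Theorem energy_Jfun_le_Kfun : exists2 c : R, 0 < c &
  forall (E : topologicalLmodType R) (C : compatible_couple E) f,
    f \in in_sum C -> (energy q b (Kfun (sum_couple C) f) < +oo)%E ->
  exists2 u : R -> cap_space (sum_couple C),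
    J_representations (sum_couple C) f u &
    (energy q (dual_weight q b) (fun s => Jfun (u s) s) <=
      c%:E * energy q b (Kfun (sum_couple C) f))%E.
Proof.
have [x_ [x_0 x_tail x_incr x_unb]] := halving_sequence q1 mb b0 m0 qm tail_fin.
have x1_0 : 0 < x_ 1%N by apply: lt_trans (x_incr 0%N); rewrite x_0.
have [e eP] := index_ex x_0 x_unb.
exists (4 * (4 * (2 * x_ 1%N)) `^ q).
  apply: mulr_gt0 => //; apply: powR_gt0.
  by apply: mulr_gt0 => //; apply: mulr_gt0.
move=> E C f fC Kfin.
have [y yP] := pieces_ex x_0 x_incr fC.
apply: (construction_correct x_0 x_tail x_incr (fun s => (eP s).1)
  (fun s => (eP s).2) fC Kfin (y := y)).
- by move=> k; have [] := yP k.
- by move=> k; have [] := yP k.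
- by have [_ _] := yP 0%N; exact.
Qed.

End J_below_K.

(** * Comparison of the two K-norms *)

Section K_comparison.
Context (R : realType).
Local Notation leb := (@completed_lebesgue_measure R).
Local Notation lebT := (caratheodory_type (@wlength R idfun)^*%mu).
Local Notation pos := (`]0, +oo[%classic : set lebT).

Let mpos : measurable pos. Proof. exact: leb_measurable_itv. Qed.

(** Two energies with the same integrand beyond 1.  Below 1 the first is at most
[kappa ^ q * M], and [kappa ^ q * T] is at most the common part beyond 1. *)
Lemma energy_comparison (q : R) (v w phi : R -> R) (M T : R) : 1 <= q ->
  measurable_fun pos (v : lebT -> R) -> measurable_fun pos (w : lebT -> R) ->
  measurable_fun pos (phi : lebT -> R) ->
  (forall t, 0 < t -> 0 <= phi t) ->
  (forall t, 1 < t -> v t = w t) ->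
  (\int[leb]_(t in `]0%R, 1%R]) (density v q t * phi t `^ q)%:E <= M%:E)%E ->
  0 < T -> (\int[leb]_(t in `]1%R, +oo[) (density w q t)%:E = T%:E)%E ->
  forall (h k : R -> R) (kappa : R),
    measurable_fun pos (h : lebT -> R) -> measurable_fun pos (k : lebT -> R) ->
    (forall t, 0 < t -> 0 <= h t) -> 0 <= kappa ->
    (forall t, 0 < t -> t <= 1 -> h t <= kappa * phi t) ->
    (forall t, 1 < t -> h t = k t) -> (forall t, 1 < t -> kappa <= k t) ->
  (energy q v h <= (1 + M / T)%:E * energy q w k)%E.
Proof.
move=> q1 mv mw mphi phi0 vw hM T0 hT h k kappa mh mk h0 kappa0 hphi hk kk.
have q0 : 0 < q by exact: lt_le_trans q1.
have mhead : measurable (`]0, 1]%classic : set lebT) by exact: leb_measurable_itv.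
have mtail : measurable (`]1, +oo[%classic : set lebT)
  by exact: leb_measurable_itv.
have mdv : measurable_fun [set: lebT] (density v q : lebT -> R).
  exact: measurable_density.
have mdw : measurable_fun [set: lebT] (density w q : lebT -> R).
  exact: measurable_density.
pose patch (d g : R -> R) (t : R) : R := if 0 < t then d t * g t `^ q else 0.
have mpatch (d g : R -> R) : measurable_fun [set: lebT] (d : lebT -> R) ->
    measurable_fun pos (g : lebT -> R) ->
    measurable_fun [set: lebT] (patch d g : lebT -> R).
  move=> md mg; apply: (@measurable_patch_pos R (fun t => d t * g t `^ q)).
  apply: (measurable_funM (measurable_funTS md)).
  exact: (measurableT_comp (measurable_powR _) mg).
have patch0 (d g : R -> R) t : (forall t, 0 <= d t) -> 0 <= patch d g t.
  by move=> d0; rewrite /patch; case: ifP => // _; rewrite mulr_ge0 ?powR_ge0.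
have energyE (d g : R -> R) :
    energy q d g = (\int[leb]_(t in pos) (patch (density d q) g t)%:E)%E.
  rewrite energy_density; apply: eq_integral => t.
  by rewrite inE/= in_itv/= andbT /patch => ->.
have tail_le : (\int[leb]_(t in `]1%R, +oo[) (patch (density v q) h t)%:E <=
    energy q w k)%E.
  rewrite energyE; apply: (@le_trans _ _
      (\int[leb]_(t in `]1%R, +oo[) (patch (density w q) k t)%:E)%E).
    rewrite le_eqVlt; apply/orP; left; apply/eqP.
    apply: eq_integral => t; rewrite inE/= in_itv/= andbT => t1.
    by rewrite /patch /density hk// vw.
  apply: ge0_subset_integral_EFin.
  - exact: mtail.
  - exact: mpos.
  - exact: mpatch.
  - by move=> t; apply: patch0; exact: density_ge0.
  - by move=> t; rewrite /= !in_itv/= !andbT; exact: lt_trans.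
have kappa_le : ((kappa `^ q)%:E * T%:E <= energy q w k)%E.
  rewrite -hT -(ge0_integralZl_EFinM leb mtail mdw (powR_ge0 _ _)
    (density_ge0 w q)).
  apply: le_trans tail_le; apply: ge0_le_integral_EFin.
  - exact: mtail.
  - exact: (measurable_funM (measurable_cst _) mdw).
  - exact: mpatch.
  - by move=> t _; rewrite mulr_ge0 ?powR_ge0 ?density_ge0.
  - move=> t; rewrite /= in_itv/= andbT => t1.
    have t0 : 0 < t := lt_trans ltr01 t1.
    have <- : density v q t = density w q t by rewrite /density vw.
    rewrite /patch t0 mulrC ler_wpM2l ?density_ge0//.
    apply: (ge0_ler_powR (ltW q0)); rewrite ?nnegrE//; first exact: h0.
    by rewrite hk// kk.
have head_le : (\int[leb]_(t in `]0%R, 1%R]) (patch (density v q) h t)%:E <=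
    (kappa `^ q)%:E * M%:E)%E.
  apply: (@le_trans _ _ ((kappa `^ q)%:E *
      \int[leb]_(t in `]0%R, 1%R]) (patch (density v q) phi t)%:E)%E); last first.
    apply: lee_wpmul2l; first by rewrite lee_fin powR_ge0.
    apply: le_trans hM; rewrite le_eqVlt; apply/orP; left; apply/eqP.
    apply: eq_integral => t; rewrite inE/= in_itv/= => /andP[t0 _].
    by rewrite /patch t0.
  rewrite -(ge0_integralZl_EFinM leb mhead (mpatch _ _ mdv mphi) (powR_ge0 _ _)
    (fun t => patch0 _ _ t (density_ge0 v q))).
  apply: ge0_le_integral_EFin.
  - exact: mhead.
  - exact: mpatch.
  - exact: (measurable_funM (measurable_cst _) (mpatch _ _ mdv mphi)).
  - by move=> t _; apply: patch0; exact: density_ge0.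
  - move=> t; rewrite /= in_itv/= => /andP[t0 t1].
    rewrite /patch t0 mulrCA ler_wpM2l ?density_ge0//.
    rewrite -(powRM q kappa0 (phi0 t t0)).
    apply: (ge0_ler_powR (ltW q0)); rewrite ?nnegrE ?h0 ?hphi//.
    by rewrite mulr_ge0 ?phi0.
have M0 : 0 <= M.
  rewrite -lee_fin; apply: le_trans hM; apply: integral_ge0 => t _.
  by rewrite lee_fin mulr_ge0 ?powR_ge0 ?density_ge0.
have -> : energy q v h =
    (\int[leb]_(t in `]0%R, 1%R]) (patch (density v q) h t)%:E +
     \int[leb]_(t in `]1%R, +oo[) (patch (density v q) h t)%:E)%E.
  rewrite energyE -ge0_integral_setU.
  - congr integral; apply/seteqP; split=> t; rewrite /= !in_itv/= ?andbT.
      by move=> t0; rewrite t0/=; case: (leP t 1) => t1; [left|right].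
    by move=> [/andP[]//|]; apply: lt_trans.
  - exact: mhead.
  - exact: mtail.
  - by apply/measurable_EFinP; apply: measurable_funTS; exact: mpatch.
  - by move=> t _; rewrite lee_fin; apply: patch0; exact: density_ge0.
  - apply/disj_setPS => t [/=]; rewrite !in_itv/= andbT => /andP[_ t1].
    by rewrite ltNge t1.
rewrite addeC EFinD ge0_muleDl ?lee_fin ?divr_ge0 ?(ltW T0)// mul1e.
apply: leeD; first exact: tail_le.
apply: (le_trans head_le).
have -> : ((kappa `^ q)%:E * M%:E = (M / T)%:E * ((kappa `^ q)%:E * T%:E))%E.
  by rewrite -!EFinM; congr EFin; field; rewrite gt_eqF.
by apply: lee_wpmul2l => //; rewrite lee_fin divr_ge0// ltW.
Qed.

Variables (b B : R -> R) (q : R).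
Hypothesis q1 : 1 <= q.
Hypothesis mb : measurable_fun pos (b : lebT -> R).
Hypothesis b_int : (tail_integral q b 0 < +oo)%E.
Hypothesis mB : measurable_fun pos (B : lebT -> R).
Hypothesis B0 : forall t, 0 < t -> 0 < B t.
Variable m : R.
Hypothesis m0 : 0 < m.
Hypothesis qm : forall s t, 0 < s -> s <= t ->
    s `^ 2^-1 * B s <= m * (t `^ 2^-1 * B t).
Hypothesis tail_fin : forall x, 0 < x -> (tail_integral q B x < +oo)%E.
Hypothesis Bb : forall t, 1 <= t -> B t = b t.

Let tail_density_B :
  (\int[leb]_(t in `]1%R, +oo[) (density B q t)%:E = (tail B q 1)%:E)%E.
Proof. by rewrite (tailE tail_fin ltr01). Qed.

Let tail_density_b :
  (\int[leb]_(t in `]1%R, +oo[) (density b q t)%:E = (tail B q 1)%:E)%E.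
Proof.
rewrite -tail_density_B; apply: eq_integral => t.
by rewrite inE/= in_itv/= andbT => t1; rewrite /density Bb// ltW.
Qed.

Let tail1_gt0 : 0 < tail B q 1.
Proof. exact: (tail_gt0 q1 mB B0 m0 qm tail_fin ltr01). Qed.

(** [energy_comparison] with [kappa = K f 1] and the constant profile [phi = 1]: below
1 the integral of [t^-1 * b t ^ q] is finite. *)
Lemma energy_K_le_sum_couple : exists2 c : R, 0 < c &
  forall (E : topologicalLmodType R) (C : compatible_couple E) f,
    f \in in_sum C ->
  (energy q b (Kfun C f) <= c%:E * energy q B (Kfun (sum_couple C) f))%E.
Proof.
have mhead : measurable (`]0, 1]%classic : set lebT) by exact: leb_measurable_itv.
pose M := fine (tail_integral q b 0).
have tail0 : (0 <= tail_integral q b 0)%E.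
  apply: integral_ge0 => t; rewrite /= in_itv/= andbT => t0.
  by rewrite lee_fin mulr_ge0 ?powR_ge0// invr_ge0 ltW.
have ME : M%:E = tail_integral q b 0 by rewrite fineK// ge0_fin_numE.
have M0 : 0 <= M by rewrite -lee_fin ME.
exists (1 + M / tail B q 1).
  by rewrite ltr_pwDl// divr_ge0// ltW.
move=> E C f fC; have fS : f \in in_sum (sum_couple C) by rewrite in_sum_couple.
apply: (@energy_comparison q b B (fun=> 1) M (tail B q 1) q1 mb mB
  (measurable_cst _) _ _ _ tail1_gt0 tail_density_B _ _ (Kfun C f 1)).
- by move=> t _; exact: ler01.
- by move=> t t1; rewrite Bb// ltW.
- rewrite ME /tail_integral.
  apply: (@le_trans _ _ (\int[leb]_(t in pos) (density b q t)%:E)%E).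
    rewrite (eq_integral (fun t : lebT => (density b q t)%:E)).
      apply: ge0_subset_integral_EFin.
      - exact: mhead.
      - exact: mpos.
      - exact: measurable_density.
      - exact: density_ge0.
      - by move=> t; rewrite /= !in_itv/= andbT => /andP[].
    by move=> t _; rewrite powR1 mulr1.
  rewrite le_eqVlt; apply/orP; left; apply/eqP.
  apply: eq_integral => t; rewrite inE/= in_itv/= andbT => t0.
  by rewrite /density t0.
- exact: measurable_Kfun.
- exact: measurable_Kfun.
- by move=> t t0; apply: Kfun_ge0 => //; exact: ltW.
- by apply: Kfun_ge0 => //; exact: ler01.
- by move=> t t0 t1; rewrite mulr1; apply: Kfun_nondecreasing => //; exact: ltW.
- by move=> t t1; rewrite Kfun_sum_couple_ge1// ltW.
- move=> t t1; rewrite Kfun_sum_couple_ge1 ?(ltW t1)//.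
  by apply: Kfun_nondecreasing => //; exact: ltW.
Qed.

(** [energy_comparison] with [kappa = K f 1] and the profile [phi t = t]: the factor
[t ^ q] makes [t^-1 * B t ^ q] integrable at 0, by quasi-monotonicity of
[t ^ (1/2) * B t]. *)
Lemma energy_sum_couple_le_K : exists2 c : R, 0 < c &
  forall (E : topologicalLmodType R) (C : compatible_couple E) f,
    f \in in_sum C ->
  (energy q B (Kfun (sum_couple C) f) <= c%:E * energy q b (Kfun C f))%E.
Proof.
have q0 : 0 < q by exact: lt_le_trans q1.
have mhead : measurable (`]0, 1]%classic : set lebT) by exact: leb_measurable_itv.
have mhead2 : measurable (`]0, 2[%classic : set lebT) by exact: leb_measurable_itv.
have [c c0 hc] := integral_powR_head_le R.
have B10 := B0 ltr01.
have mB1 : 0 <= m * B 1 by rewrite mulr_ge0// ltW.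
pose M := (m * B 1) `^ q * (c * 2 `^ 2^-1).
have M0 : 0 <= M.
  apply: mulr_ge0; first exact: powR_ge0.
  by apply: mulr_ge0; [exact: ltW|exact: powR_ge0].
have mid : measurable_fun pos (fun t : lebT => (t : R)).
  by apply: measurable_funTS; exact: measurable_id_lebT.
have mdB : measurable_fun [set: lebT] (density B q : lebT -> R).
  exact: measurable_density.
have mp r : measurable_fun [set: lebT] (fun t : lebT => (t : R) `^ r).
  exact: measurable_powR_lebT.
have p0 r (t : R) : 0 <= t `^ r by exact: powR_ge0.
have hM : (\int[leb]_(t in `]0%R, 1%R]) (density B q t * t `^ q)%:E <= M%:E)%E.
  apply: (@le_trans _ _ (\int[leb]_(t in `]0%R, 1%R])
      ((m * B 1) `^ q * t `^ (- 2^-1))%:E)%E).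
    apply: ge0_le_integral_EFin.
    - exact: mhead.
    - exact: (measurable_funM mdB (mp _)).
    - exact: (measurable_funM (measurable_cst _) (mp _)).
    - by move=> t _; rewrite mulr_ge0 ?powR_ge0 ?density_ge0.
    - move=> t; rewrite /= in_itv/= => /andP[t0 t1].
      have Bt := B0 t0.
      have hq : (t `^ 2^-1 * B t) `^ q <= (m * B 1) `^ q.
        apply: (ge0_ler_powR (ltW q0)); rewrite ?nnegrE//.
          exact: mulr_ge0 (powR_ge0 _ _) (ltW Bt).
        by apply: le_trans (qm t0 t1) _; rewrite powR1 mul1r.
      have -> : density B q t * t `^ q =
          (t `^ 2^-1 * B t) `^ q * (t^-1 * t `^ (2^-1 * q)).
        rewrite /density t0 (powRM _ (powR_ge0 _ _) (ltW Bt)) -powRrM.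
        have -> : t `^ q = t `^ (2^-1 * q) * t `^ (2^-1 * q).
          by rewrite powR_mul//; congr (_ `^ _); field.
        ring.
      apply: ler_pM.
      - exact: powR_ge0.
      - by apply: mulr_ge0; [rewrite invr_ge0 ltW|exact: powR_ge0].
      - exact: hq.
      - rewrite -powR_inv1 ?(ltW t0)// powR_mul//.
        by apply: ger_powR; [rewrite t0 t1|move: q1; lra].
  have := @ge0_integralZl_EFinM _ _ _ leb _ _ _ mhead (mp (- 2^-1))
    (powR_ge0 (m * B 1) q) (p0 _).
  move=> ->; rewrite /M EFinM; apply: lee_wpmul2l; first by rewrite lee_fin powR_ge0.
  apply: le_trans (hc 2 _); last by rewrite ltr0n.
  apply: ge0_subset_integral_EFin.
  - exact: mhead.
  - exact: mhead2.
  - exact: mp.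
  - exact: p0.
  - move=> t; rewrite /= !in_itv/= => /andP[-> t1]/=.
    by apply: (le_lt_trans t1); rewrite ltr1n.
exists (1 + M / tail B q 1).
  by rewrite ltr_pwDl// divr_ge0// ltW.
move=> E C f fC; have fS : f \in in_sum (sum_couple C) by rewrite in_sum_couple.
apply: (@energy_comparison q B b id M (tail B q 1) q1 mB mb
  mid _ _ hM tail1_gt0 tail_density_b _ _ (Kfun C f 1)).
- by move=> t; exact: ltW.
- by move=> t t1; rewrite Bb// ltW.
- exact: measurable_Kfun.
- exact: measurable_Kfun.
- by move=> t t0; apply: Kfun_ge0 => //; exact: ltW.
- by apply: Kfun_ge0 => //; exact: ler01.
- by move=> t t0 t1; rewrite Kfun_sum_couple_le1 ?(ltW t0)// mulrC.
- by move=> t t1; rewrite Kfun_sum_couple_ge1// ltW.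
- move=> t t1; apply: Kfun_nondecreasing => //; exact: ltW.
Qed.

End K_comparison.

(** * The equalities of spaces *)

Section spaces.
Context (R : realType).
Local Notation leb := (@completed_lebesgue_measure R).
Local Notation lebT := (caratheodory_type (@wlength R idfun)^*%mu).
Local Notation pos := (`]0, +oo[%classic : set lebT).

(** [B ^ q] is dominated by [b ^ q] on [[1, oo)] and by a multiple of [beta ^ q] on
[(0, 1)]. *)
Lemma tail_integral_lty (q : R) (b beta B : R -> R) : 1 <= q ->
  slowly_varying b -> (tail_integral q b 0 < +oo)%E ->
  slowly_varying beta ->
  (forall x : R, 0 < x -> (tail_integral q beta x < +oo)%E) ->
  slowly_varying B -> (forall x : R, 1 <= x -> B x = b x) ->
  equivalent_on `]0, 1[ B beta ->
  forall x, 0 < x -> (tail_integral q B x < +oo)%E.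
Proof.
move=> q1 [mb b0 _] b_fin [mbeta beta0 _] beta_fin [mB B0 _] Bb [c c0 Bbeta] x x0.
have q0 : 0 < q by exact: lt_le_trans q1.
have mx : measurable (`]x, +oo[%classic : set lebT) by exact: leb_measurable_itv.
have mpos : measurable pos by exact: leb_measurable_itv.
have md (w : R -> R) : measurable_fun pos (w : lebT -> R) ->
    measurable_fun [set: lebT] (density w q : lebT -> R).
  exact: measurable_density.
have mdb := md _ mb; have mdbeta := md _ mbeta; have mdB := md _ mB.
have dE (w : R -> R) y : 0 <= y ->
    tail_integral q w y = (\int[leb]_(t in `]y, +oo[) (density w q t)%:E)%E.
  move=> y0; apply: eq_integral => t; rewrite inE/= in_itv/= andbT => yt.
  by rewrite /density (le_lt_trans y0 yt).
have cq0 : 0 <= c `^ q by exact: powR_ge0.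
apply: (@le_lt_trans _ _ (tail_integral q b 0 +
    (c `^ q)%:E * tail_integral q beta x)%E); last first.
  apply: lte_add_pinfty; first exact: b_fin.
  apply: lte_mul_pinfty; [by rewrite lee_fin| |exact: beta_fin].
  by rewrite fin_numE.
rewrite !dE ?(ltW x0)//.
rewrite -(ge0_integralZl_EFinM leb mx mdbeta cq0 (density_ge0 beta q)).
apply: (@le_trans _ _ (\int[leb]_(t in `]x, +oo[) (density b q t)%:E +
    \int[leb]_(t in `]x, +oo[) (c `^ q * density beta q t)%:E)%E); last first.
  apply: leeD2r; apply: ge0_subset_integral_EFin.
  - exact: mx.
  - exact: mpos.
  - exact: mdb.
  - exact: density_ge0.
  - by move=> t; rewrite /= !in_itv/= !andbT; exact: lt_trans.
rewrite -(@ge0_integralD _ _ _ leb _ mx).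
- under [leRHS]eq_integral do rewrite -EFinD.
  apply: ge0_le_integral_EFin.
  - exact: mx.
  - exact: mdB.
  - exact: (measurable_funD mdb (measurable_funM (measurable_cst _) mdbeta)).
  - by move=> t _; exact: density_ge0.
  - move=> t; rewrite /= in_itv/= andbT => xt; have t0 := lt_trans x0 xt.
    rewrite /density t0; have [t1|t1] := leP 1 t.
      by rewrite Bb// lerDl !mulr_ge0 ?powR_ge0// invr_ge0 ltW.
    have tI : `]0, 1[%classic t by rewrite /= in_itv/= t0.
    have [h _] := Bbeta t tI.
    rewrite mulrCA -mulrDr ler_pM2l ?invr_gt0// -powRM ?(ltW c0) ?(ltW (beta0 _ t0))//.
    rewrite ler_wpDl ?powR_ge0//.
    apply: (ge0_ler_powR (ltW q0)); rewrite ?nnegrE.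
    - exact: ltW (B0 _ t0).
    - exact: mulr_ge0 (ltW c0) (ltW (beta0 _ t0)).
    - exact: h.
- by move=> t _; rewrite lee_fin density_ge0.
- by apply/measurable_EFinP; apply: measurable_funTS; exact: mdb.
- by move=> t _; rewrite lee_fin mulr_ge0 ?density_ge0.
- apply/measurable_EFinP; apply: measurable_funTS.
  exact: (measurable_funM (measurable_cst _) mdbeta).
Qed.

Lemma same_space_intro (E : Type) (Y Z : normed_subset R E) :
  (forall f, 0 <= ns_norm Y f)%E -> (forall f, 0 <= ns_norm Z f)%E ->
  ns_set Y = ns_set Z ->
  (exists2 c : R, 0 < c &
    forall f, ns_set Y f -> (ns_norm Y f <= c%:E * ns_norm Z f)%E) ->
  (exists2 c : R, 0 < c &
    forall f, ns_set Y f -> (ns_norm Z f <= c%:E * ns_norm Y f)%E) ->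
  same_space Y Z.
Proof.
move=> Y0 Z0 YZ [c c0 hc] [d d0 hd]; split => //.
exists (c + d); first exact: addr_gt0.
move=> f fY; split.
- apply: (le_trans (hc f fY)); apply: lee_wpmul2r => //.
  by rewrite lee_fin lerDl ltW.
- apply: (le_trans (hd f fY)); apply: lee_wpmul2r => //.
  by rewrite lee_fin lerDr ltW.
Qed.

Lemma interp_norm_ge0 (q : \bar R) (v h : R -> R) : (0 <= interp_norm q v h)%E.
Proof. exact: Lnorm_ge0. Qed.

Lemma Jnorm_ge0 (E : topologicalLmodType R) (C : compatible_couple E)
  (q : \bar R) (v : R -> R) f : (0 <= Jnorm C q v f)%E.
Proof. by apply: le_ereal_inf_tmp => _ [u _ <-]; exact: interp_norm_ge0. Qed.

End spaces.

Theorem theorem1p11 (R : realType) (E : topologicalLmodType R)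
    (C : compatible_couple E) (q : R) (b beta B : R -> R)
    (hq : 1 <= q)
    (hb : slowly_varying b)
    (hb_int : (tail_integral q b 0 < +oo)%E)
    (hbeta : slowly_varying beta)
    (hbeta_int : forall x : R, 0 < x -> (tail_integral q beta x < +oo)%E)
    (hbeta_div : tail_integral q beta 0 = +oo%E)
    (hB : slowly_varying B)
    (hBb : forall x : R, 1 <= x -> B x = b x)
    (hBbeta : equivalent_on `]0, 1[ B beta) :
  same_space (Kspace C q%:E b) (Kspace (sum_couple C) q%:E B) /\
  same_space (Kspace (sum_couple C) q%:E B)
             (Jspace (sum_couple C) q%:E (dual_weight q B)).
Proof.
have tail_fin := tail_integral_lty hq hb hb_int hbeta hbeta_int hB hBb hBbeta.
have [m m0 qm] := slowly_varying_quasi_monotone hB.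
have [mb b0 _] := hb; have [mB B0 _] := hB.
have A0 := dual_weight_gt0 hq mB B0 m0 qm tail_fin.
have w0 (w : R -> R) : (forall t, 0 < t -> 0 < w t) ->
    forall t, 0 < t -> 0 <= w t.
  by move=> w0 t t0; exact: ltW (w0 t t0).
have K0 (D : compatible_couple E) f : f \in in_sum D ->
    forall t, 0 < t -> 0 <= Kfun D f t.
  by move=> fD t t0; apply: Kfun_ge0 => //; exact: ltW.
have J0 (D : compatible_couple E) (u : R -> cap_space D) t :
    0 < t -> 0 <= Jfun (u t) t.
  by move=> _; exact: Jfun_ge0.
have cq (c : R) : 0 < c -> 0 < c `^ q^-1 by move=> c0; exact: powR_gt0.
have CS f : (f \in in_sum (sum_couple C)) = (f \in in_sum C).
  exact: in_sum_couple.
split.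
- have [c c0 hc] := energy_K_le_sum_couple hq mb hb_int mB B0 m0 qm tail_fin hBb.
  have [d d0 hd] := energy_sum_couple_le_K hq mb mB B0 m0 qm tail_fin hBb.
  have le1 f : f \in in_sum C -> (Knorm C q%:E b f <=
      (c `^ q^-1)%:E * Knorm (sum_couple C) q%:E B f)%E.
    move=> fC; apply: (interp_norm_le hq (ltW c0) (w0 _ b0) (K0 _ _ fC)
      (w0 _ B0) _ (hc E C f fC)).
    by apply: K0; rewrite CS.
  have le2 f : f \in in_sum C -> (Knorm (sum_couple C) q%:E B f <=
      (d `^ q^-1)%:E * Knorm C q%:E b f)%E.
    move=> fC; apply: (interp_norm_le hq (ltW d0) (w0 _ B0) _ (w0 _ b0)
      (K0 _ _ fC) (hd E C f fC)).
    by apply: K0; rewrite CS.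
  apply: same_space_intro.
  + by move=> f; exact: interp_norm_ge0.
  + by move=> f; exact: interp_norm_ge0.
  + apply/seteqP; split=> f [fC fin]; split.
    * by rewrite CS.
    * apply: (le_lt_trans (le2 f fC)).
      by apply: lte_mul_pinfty fin => //; rewrite lee_fin ltW// cq.
    * by rewrite -CS.
    * rewrite CS in fC; apply: (le_lt_trans (le1 f fC)).
      by apply: lte_mul_pinfty fin => //; rewrite lee_fin ltW// cq.
  + by exists (c `^ q^-1); [exact: cq|move=> f [fC _]; exact: le1].
  + by exists (d `^ q^-1); [exact: cq|move=> f [fC _]; exact: le2].
- set S := sum_couple C.
  have [c c0 hc] := energy_Kfun_le_Jfun hq mB B0 m0 qm tail_fin.
  have [d d0 hd] := energy_Jfun_le_Kfun hq mB B0 m0 qm tail_fin.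
  have rep_sum f u : J_representations S f u -> f \in in_sum S.
    by move=> [_ [g <- _]]; exact: valP.
  have le1 f : J_representations S f !=set0 -> (Knorm S q%:E B f <=
      (c `^ q^-1)%:E * Jnorm S q%:E (dual_weight q B) f)%E.
    move=> [u0 fu0]; rewrite -lee_pdivrMl ?cq//.
    apply: le_ereal_inf_tmp => _ [u fu <-]; rewrite lee_pdivrMl ?cq//.
    exact: (interp_norm_le hq (ltW c0) (w0 _ B0) (K0 _ _ (rep_sum _ _ fu))
      (w0 _ A0) (J0 _ u) (hc E S f u fu)).
  have le2 f : ns_set (Kspace S q%:E B) f -> J_representations S f !=set0 /\
      (Jnorm S q%:E (dual_weight q B) f <=
        (d `^ q^-1)%:E * Knorm S q%:E B f)%E.
    move=> [fS fin]; have fC : f \in in_sum C by rewrite -CS.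
    have efin := interp_norm_fin hq (w0 _ B0) (K0 _ _ fS) fin.
    have [u fu hu] := hd E C f fC efin; split; first by exists u.
    apply: (@le_trans _ _ (interp_norm q%:E (dual_weight q B)
        (fun t => Jfun (u t) t))).
      by apply: ereal_inf_lbound; exists u.
    exact: (interp_norm_le hq (ltW d0) (w0 _ A0) (J0 _ u) (w0 _ B0)
      (K0 _ _ fS) hu).
  apply: same_space_intro.
  + by move=> f; exact: interp_norm_ge0.
  + by move=> f; exact: Jnorm_ge0.
  + apply/seteqP; split=> f.
    * move=> fK; have [fu le] := le2 f fK; split => //.
      apply: (le_lt_trans le); have [_ fin] := fK.
      by apply: lte_mul_pinfty fin => //; rewrite lee_fin ltW// cq.
    * move=> [fu fin]; split; first by have [u /rep_sum] := fu.
      apply: (le_lt_trans (le1 f fu)).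
      by apply: lte_mul_pinfty fin => //; rewrite lee_fin ltW// cq.
  + exists (c `^ q^-1); first exact: cq.
    by move=> f fK; apply: le1; have [] := le2 f fK.
  + exists (d `^ q^-1); first exact: cq.
    by move=> f fK; have [] := le2 f fK.
Qed.
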